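(* Let $g\ge1$ and $(\bm w,\bm\rho)\in\mathfrak C_g$. For $x,y\in\mathcal D$ the normalized bidifferential of the second kind on $\mathcal S_g$ is given by $$\omega(x,y)=\omega^{(0)}(x,y)-L(x)\,(I-A)^{-1}R(y),$$ where $(I-A)^{-1}=\sum_{n\ge0}A^n$ is convergent for $(\bm w,\bm\rho)\in\mathfrak C_g$.
   Context: $\mathcal I_+=\{1,\ldots,g\}$, $\mathcal I=\{\pm1,\ldots,\pm g\}$. Parameters $w_a\in\mathbb C$ ($a\in\mathcal I$), $\rho_a\in\mathbb C\setminus\{0\}$ with $\rho_{-a}=\rho_a$. $\mathfrak C_g\subset\mathbb C^{3g}$ is the set of $(\bm w,\bm\rho)=(w_1,w_{-1},\rho_1,\ldots,w_g,w_{-g},\rho_g)$ with $|w_a-w_b|>|\rho_a|^{1/2}+|\rho_b|^{1/2}$ for all $a\ne b$ in $\mathcal I$. $\mathcal C_a$ is the circle with centre $w_a$ and radius $|\rho_a|^{1/2}$. $\gamma_az=w_{-a}+\rho_a/(z-w_a)$, so $\gamma_{-a}=\gamma_a^{-1}$; $\Gamma=\langle\gamma_1,\ldots,\gamma_g\rangle$ is the Schottky group, $\mathcal S_g=(\widehat{\mathbb C}\setminus\Lambda(\Gamma))/\Gamma$ ($\Lambda$ = limit set) is a compact Riemann surface of genus $g$, and $\mathcal D\subset\widehat{\mathbb C}$ is the fundamental region exterior to all the circles $\mathcal C_a$; forms are written in the coordinate of $\mathcal D$. $\omega(x,y)$ is the unique symmetric bidifferential on $\mathcal S_g$ of the form $\big((x-y)^{-2}+\text{regular}\big)dx\,dy$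 with $\oint_{\alpha_a}\omega(x,\cdot)=0$ for all $a\in\mathcal I_+$, where the cycle $\alpha_a$ is represented by $\mathcal C_{-a}$. $\omega^{(0)}(x,y)=\dfrac{dx\,dy}{(x-y)^2}$. For $a\in\mathcal I$, $k\ge1$: $L_a(k,x)=\dfrac{\sqrt k\,\rho_a^{k/2}}{(x-w_a)^{k+1}}dx$ (fixed square roots with $\rho_{-a}^{1/2}=\rho_a^{1/2}$). $L(x)=(L_a(k,x))$ is the infinite row vector and $R(y)=(L_{-a}(k,y))$ the infinite column vector, indexed by $(a,k)$. $A=(A_{ab}(k,l))$ is the infinite matrix indexed by $a,b\in\mathcal I$, $k,l\ge1$, with $A_{ab}(k,l)=\dfrac{(-1)^k(k+l-1)!}{\sqrt{kl}\,(k-1)!(l-1)!}\dfrac{\rho_a^{k/2}\rho_b^{l/2}}{(w_{-a}-w_b)^{k+l}}$ if $a\ne-b$ and $A_{ab}(k,l)=0$ if $a=-b$. Convergence of $(I-A)^{-1}$ means convergence of its matrix entries. *)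

(* Defs.v *)
From mathcomp Require Import ssreflect ssrfun ssrbool eqtype ssrnat fintype bigop.
From Stdlib Require Import Reals.
From Coquelicot Require Import Coquelicot.

Set Implicit Arguments.
Unset Strict Implicit.
Unset Printing Implicit Defensive.

Local Open Scope R_scope.
Local Open Scope C_scope.

(* The index set {±1, ..., ±g}: (i, true) stands for i+1 and (i, false) for
   -(i+1). *)
Definition letter (g : nat) : Type := ('I_g * bool)%type.

Definition neg g (a : letter g) : letter g := (a.1, ~~ a.2).

(* The parameters are w : letter g -> C and rho : 'I_g -> C; since
   rho_{-a} = rho_a, the parameter rho_a is rho a.1. *)

Definition radius g (rho : 'I_g -> C) (a : letter g) : R :=
  sqrt (Cmod (rho a.1)).

Definition schottky_space g (w : letter g -> C) (rho : 'I_g -> C) : Prop :=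
  (forall i : 'I_g, rho i <> 0) /\
  (forall a b : letter g, a <> b ->
     (Cmod (w a - w b) > radius rho a + radius rho b)%R).

(* None is the point at infinity. *)
Definition sphere : Type := option C.

Definition sphere_ball (p : sphere) (eps : R) (q : sphere) : Prop :=
  match p, q with
  | Some z, Some z' => (Cmod (z' - z) < eps)%R
  | Some _, None => False
  | None, Some z' => (/ eps < Cmod z')%R
  | None, None => True
  end.

Definition sphere_lim (u : nat -> sphere) (p : sphere) : Prop :=
  forall eps : R, (0 < eps)%R -> eventually (fun n => sphere_ball p eps (u n)).

(* The standard local coordinate at a finite point is z; at infinity it is
   1/z.  [param p] is the corresponding local parametrization and [coord p] its
   inverse (with junk values off the chart domain). *)
Definition param (p : sphere) (s : C) : sphere :=
  match p with
  | Some _ => Some s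
  | None => if Ceq_dec s 0 then None else Some (/ s)
  end.

Definition coord (p q : sphere) : C :=
  match p, q with
  | Some _, Some z => z
  | None, Some z => / z
  | _, None => 0
  end.

(* [derivative_at T p d]: d is the derivative of T at p with respect to the
   standard local coordinates at p and at T p. *)
Definition derivative_at (T : sphere -> sphere) (p : sphere) (d : C) : Prop :=
  is_derive (K := C_AbsRing) (V := C_NormedModule)
    (fun s : C => coord (T p) (T (param p s))) (coord p p) d.

Definition gamma g (w : letter g -> C) (rho : 'I_g -> C) (a : letter g)
    (p : sphere) : sphere :=
  match p with
  | Some z =>
      if Ceq_dec z (w a) then None
      else Some (w (neg a) + rho a.1 / (z - w a))
  | None => Some (w (neg a))
  end.

(* The letters are closed under negation and gamma (neg a) is the inverse of
   gamma a, so the generated monoid is the generated group. *)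
Inductive schottky_group g (w : letter g -> C) (rho : 'I_g -> C) :
    (sphere -> sphere) -> Prop :=
| schottky_id : schottky_group w rho (fun p => p)
| schottky_comp (a : letter g) (T : sphere -> sphere) :
    schottky_group w rho T ->
    schottky_group w rho (fun p => gamma w rho a (T p)).

Definition limit_set g (w : letter g -> C) (rho : 'I_g -> C) (p : sphere)
    : Prop :=
  exists (z : sphere) (T : nat -> sphere -> sphere),
    [/\ forall n, schottky_group w rho (T n),
        forall m n, m <> n -> exists q, T m q <> T n q
      & sphere_lim (fun n => T n z) p].

Definition regular_set g (w : letter g -> C) (rho : 'I_g -> C) (p : sphere)
    : Prop :=
  ~ limit_set w rho p.

Definition same_orbit g (w : letter g -> C) (rho : 'I_g -> C) (p q : sphere)
    : Prop :=
  exists T, schottky_group w rho T /\ T p = q.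

Definition fundamental_region g (w : letter g -> C) (rho : 'I_g -> C)
    (p : sphere) : Prop :=
  match p with
  | Some z => forall a : letter g, (Cmod (z - w a) > radius rho a)%R
  | None => True
  end.

(* The point with parameter t on the circle with centre w_a and radius
   |rho_a|^{1/2}, and the velocity of this parametrization. *)
Definition circle g (w : letter g -> C) (rho : 'I_g -> C) (a : letter g)
    (t : R) : C :=
  w a + radius rho a * (cos t, sin t).

Definition circle_velocity g (rho : 'I_g -> C) (a : letter g) (t : R) : C :=
  Ci * (radius rho a * (cos t, sin t)).

(* A bidifferential on the surface is given by its lift to the regular set:
   F x y is the coefficient of the lift at (x, y) with respect to the standard
   local coordinates at x and at y; for finite x and y it is the coefficient of
   dx dy.  Values outside the regular set and on the poles are irrelevant. *)
Definition bidiff : Type := sphere -> sphere -> C.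

(* The derivative at s, with respect to the coordinate s of [param p], of the
   standard local coordinate at the point [param p s]. *)
Definition coord_change (p : sphere) (s : C) : C :=
  match p with
  | Some _ => RtoC 1
  | None => if Ceq_dec s 0 then RtoC 1 else - / (s * s)
  end.

(* The coefficient of ds dt when the bidifferential is written in the
   standard local coordinates s around p and t around q. *)
Definition local_expr (F : bidiff) (p q : sphere) (s t : C) : C :=
  F (param p s) (param q t) * coord_change p s * coord_change q t.

Definition holomorphic2_at (h : C -> C -> C) (s t : C) : Prop :=
  ex_filterdiff (K := C_AbsRing)
    (U := prod_NormedModule C_AbsRing C_NormedModule C_NormedModule)
    (V := C_NormedModule)
    (fun st : C * C => h st.1 st.2) (locally (s, t)).

(* F is invariant under the action of the group on each variable, is
   symmetric, is holomorphic except where x and y are the same point of the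
   surface, and is (x-y)^{-2} + regular near the diagonal. *)
Definition symmetric_second_kind g (w : letter g -> C) (rho : 'I_g -> C)
    (F : bidiff) : Prop :=
  [/\ forall T U x y d e,
        schottky_group w rho T -> schottky_group w rho U ->
        regular_set w rho x -> regular_set w rho y ->
        ~ same_orbit w rho x y ->
        derivative_at T x d -> derivative_at U y e ->
        F (T x) (U y) * d * e = F x y,
      forall x y, regular_set w rho x -> regular_set w rho y ->
        ~ same_orbit w rho x y -> F x y = F y x,
      forall x y, regular_set w rho x -> regular_set w rho y ->
        ~ same_orbit w rho x y ->
        holomorphic2_at (local_expr F x y) (coord x x) (coord y y)
    & forall x, regular_set w rho x ->
        exists (h : C -> C -> C) (eps : R), (0 < eps)%R /\
          forall s t : C,
            (Cmod (s - coord x x) < eps)%R -> (Cmod (t - coord x x) < eps)%R ->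
            holomorphic2_at h s t /\
            (s <> t -> local_expr F x x s t = / ((s - t) ^ 2) + h s t)].

(* The cycle alpha_i, represented by the circle with index -i, for i > 0; the
   period is a form in the points x of the surface that are not on the cycle. *)
Definition zero_alpha_periods g (w : letter g -> C) (rho : 'I_g -> C)
    (F : bidiff) : Prop :=
  forall (i : 'I_g) (x : sphere),
    regular_set w rho x ->
    (forall t : R, ~ same_orbit w rho x (Some (circle w rho (i, false) t))) ->
    is_RInt (V := C_R_NormedModule)
      (fun t : R => F x (Some (circle w rho (i, false) t))
                    * circle_velocity rho (i, false) t)
      0%R (2 * PI)%R (RtoC 0).

Definition normalized_bidiff g (w : letter g -> C) (rho : 'I_g -> C)
    (F : bidiff) : Prop :=
  symmetric_second_kind w rho F /\ zero_alpha_periods w rho F.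

(* dx dy / (x-y)^2.  With x = 1/s it is - ds dy / (1 - s y)^2. *)
Definition omega0 : bidiff := fun x y =>
  match x, y with
  | Some x, Some y => / ((x - y) ^ 2)
  | None, Some _ | Some _, None => - (1)
  | None, None => 0 (* pole *)
  end.

(* The index (a, n) stands for the pair (a, k) with k = n + 1. *)
Definition index (g : nat) : Type := (letter g * nat)%type.

Definition vec (g : nat) : Type := index g -> C.

Definition mat (g : nat) : Type := index g -> index g -> C.

(* The index set carries no order, so sums over it are required to converge
   absolutely. *)
Definition is_sum g (u : vec g) (s : C) : Prop :=
  (forall a : letter g, ex_series (fun n => Cmod (u (a, n)))) /\
  is_series (K := C_AbsRing) (V := C_NormedModule)
    (fun n => \big[Cplus/RtoC 0]_(a : ('I_g * bool)%type) u (a, n)) s.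

Definition is_mulmv g (M : mat g) (u v : vec g) : Prop :=
  forall i, is_sum (fun k => M i k * u k) (v i).

Definition is_mulmm g (M N Q : mat g) : Prop :=
  forall i j, is_sum (fun k => M i k * N k j) (Q i j).

Definition idm g : mat g := fun i j => if i == j then RtoC 1 else RtoC 0.

Definition subm g (M N : mat g) : mat g := fun i j => M i j - N i j.

Definition is_powers g (M : mat g) (P : nat -> mat g) : Prop :=
  P 0%nat = @idm g /\ forall n, is_mulmm M (P n) (P n.+1).

Definition is_inverse g (M N : mat g) : Prop :=
  is_mulmm M N (@idm g) /\ is_mulmm N M (@idm g).

(* N is the entrywise sum of the powers of M. *)
Definition is_neumann_sum g (M N : mat g) : Prop :=
  exists P : nat -> mat g, is_powers M P /\
    forall i j, is_series (K := C_AbsRing) (V := C_NormedModule)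
                  (fun n => P n i j) (N i j).

(* Below, sq i is the chosen square root of rho i. *)

(* The coefficient of L_a(k, x).  With x = 1/s,
   dx / (x-w)^{k+1} = - s^{k-1} ds / (1 - s w)^{k+1}. *)
Definition Lform g (w : letter g -> C) (sq : 'I_g -> C) (a : letter g)
    (k : nat) (x : sphere) : C :=
  match x with
  | Some x => sqrt (INR k) * sq a.1 ^ k / (x - w a) ^ k.+1
  | None => if k == 1%nat then - sq a.1 else RtoC 0
  end.

Definition Lrow g (w : letter g -> C) (sq : 'I_g -> C) (x : sphere) : vec g :=
  fun i => Lform w sq i.1 i.2.+1 x.

Definition Rcol g (w : letter g -> C) (sq : 'I_g -> C) (y : sphere) : vec g :=
  fun i => Lform w sq (neg i.1) i.2.+1 y.

Definition Acoef g (w : letter g -> C) (sq : 'I_g -> C) (a b : letter g)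
    (k l : nat) : C :=
  if a == neg b then RtoC 0
  else RtoC ((-1) ^ k * INR (k + l - 1)`! /
             (sqrt (INR k * INR l) * INR (k - 1)`! * INR (l - 1)`!))%R
       * (sq a.1 ^ k * sq b.1 ^ l / (w (neg a) - w b) ^ (k + l)).

Definition Amat g (w : letter g -> C) (sq : 'I_g -> C) : mat g :=
  fun i j => Acoef w sq i.1 j.1 i.2.+1 j.2.+1.

(* Main.v *)
(* Up to signs, A is the Grunsky matrix of the disjoint discs bounded by the
   circles.  The kernel - ln |z - z'| is positive on neutral charges, and for
   charges placed at roots of unity on the circles this is the inequality
   |p A q| <= |p| |q|.  A fixed enlargement of the discs keeps them disjoint, so
   A = D B D with B a contraction and D diagonal with geometrically decaying
   entries; hence all sums over indices, and the Neumann series, converge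
   geometrically.

   Fix y and let f be omega(., y).  By Liouville, f - omega0(., y) is the sum of
   its principal parts at the centres w_a: the difference extends to
   an entire function vanishing at infinity.  The coefficients of
   (z - w_a)^(-1) vanish because of the normalization of the periods; let X be
   the vector of the other coefficients, scaled so that the sum of the principal
   parts is L X.  Since gamma_a maps C_a to C_(-a) and f dz is invariant, the
   principal part at w_a is given by the Taylor part of f at w_(-a), to which
   omega0 contributes -R and the other principal parts contribute A X.  Thus
   X = - R + A X, so X = - (I - A)^(-1) R. *)
From HB Require Import structures.
From mathcomp Require Import ssreflect ssrfun ssrbool eqtype ssrnat seq choice.
From mathcomp Require Import fintype bigop binomial zify.
Require Import Defs.
From Stdlib Require Import Reals Lra Lia ClassicalEpsilon.
From Coquelicot Require Import Coquelicot.

Set Implicit Arguments.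
Unset Strict Implicit.
Unset Printing Implicit Defensive.
Local Open Scope R_scope.

(** The inequality for A is reached with finite sums only: N-th roots of unity turn the moments of a
    charge into discrete Fourier coefficients, so no integration over the circles is involved. The
    obstacle is the singularity of the kernel on the diagonal. It is replaced by - ln (eps + |z -
    z'|^2). Between different circles this costs O(eps); within one circle [joukowski_root] absorbs
    eps exactly into a factor t < 1, and in the final estimate t^k is simply bounded by 1. A complex
    charge is treated through its real and imaginary parts.

    On the analytic side two margins do the work: [lam] > 1 is the enlargement that keeps the discs
    disjoint, and [mu] in (1, lam] measures how far y stays outside the circles. Finiteness of the
    set of letters gives both. They make omega(., y) holomorphic on closed annuli around the
    circles, whence geometric bounds for the Laurent coefficients, and the interchanges of sums rest
    on such bounds. That the region lies off the limit set is itself proved, by ping-pong and the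
    pigeonhole principle. Infinity needs the coordinate 1/z, both for x and for y. *)

Local Notation neg := Defs.neg.

(** * Finite sums *)

HB.instance Definition _ := Monoid.isComLaw.Build C (RtoC 0) Cplus
  Cplus_assoc Cplus_comm Cplus_0_l.
HB.instance Definition _ := Monoid.isMulLaw.Build C (RtoC 0) Cmult
  Cmult_0_l Cmult_0_r.
HB.instance Definition _ := Monoid.isAddLaw.Build C Cmult Cplus
  Cmult_plus_distr_r Cmult_plus_distr_l.

Fact Rplus_assoc_ssr : associative Rplus.
Proof. by move=> x y z; ring. Qed.
HB.instance Definition _ := Monoid.isComLaw.Build R 0 Rplus
  Rplus_assoc_ssr Rplus_comm Rplus_0_l.
HB.instance Definition _ := Monoid.isMulLaw.Build R 0 Rmult
  Rmult_0_l Rmult_0_r.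
HB.instance Definition _ := Monoid.isAddLaw.Build R Rmult Rplus
  Rmult_plus_distr_r Rmult_plus_distr_l.

Definition csum (T : finType) (F : T -> C) : C :=
  \big[Cplus/RtoC 0]_(i : T) F i.
Definition rsum (T : finType) (F : T -> R) : R := \big[Rplus/0]_(i : T) F i.

Section FiniteSums.
Variables T U : finType.

Lemma eq_csum (F G : T -> C) : (forall i, F i = G i) -> csum F = csum G.
Proof. by move=> h; apply: eq_bigr => i _. Qed.

Lemma eq_rsum (F G : T -> R) : (forall i, F i = G i) -> rsum F = rsum G.
Proof. by move=> h; apply: eq_bigr => i _. Qed.

Lemma csumD (F G : T -> C) :
  csum (fun i => F i + G i)%C = (csum F + csum G)%C.
Proof. exact: big_split. Qed.

Lemma rsumD (F G : T -> R) : rsum (fun i => F i + G i) = rsum F + rsum G.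
Proof. exact: big_split. Qed.

Lemma csumMl c (F : T -> C) : csum (fun i => c * F i)%C = (c * csum F)%C.
Proof. by rewrite /csum big_distrr. Qed.

Lemma csumMr c (F : T -> C) : csum (fun i => F i * c)%C = (csum F * c)%C.
Proof. by rewrite /csum big_distrl. Qed.

Lemma rsumMl c (F : T -> R) : rsum (fun i => c * F i) = c * rsum F.
Proof. by rewrite /rsum big_distrr. Qed.

Lemma rsumMr c (F : T -> R) : rsum (fun i => F i * c) = rsum F * c.
Proof. by rewrite /rsum big_distrl. Qed.

Lemma csum0 : csum (fun _ : T => RtoC 0) = RtoC 0.
Proof. by rewrite /csum big1. Qed.

Lemma csumN (F : T -> C) : csum (fun i => - F i)%C = (- csum F)%C.
Proof.
have -> : (- csum F = - (1) * csum F)%C by ring.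
by rewrite -csumMl; apply: eq_csum => i; ring.
Qed.

Lemma csumB (F G : T -> C) :
  csum (fun i => F i - G i)%C = (csum F - csum G)%C.
Proof. by rewrite csumD csumN. Qed.

Lemma csum_exchange (F : T -> U -> C) :
  csum (fun i => csum (fun j => F i j)) = csum (fun j => csum (fun i => F i j)).
Proof. exact: exchange_big. Qed.

Lemma csum_pair (F : T * U -> C) :
  csum F = csum (fun i => csum (fun j => F (i, j))).
Proof. by rewrite /csum (pair_big xpredT xpredT (fun i j => F (i, j))) /=; apply: eq_bigr => -[]. Qed.

Lemma rsum_pair (F : T * U -> R) :
  rsum F = rsum (fun i => rsum (fun j => F (i, j))).
Proof. by rewrite /rsum (pair_big xpredT xpredT (fun i j => F (i, j))) /=; apply: eq_bigr => -[]. Qed.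

Lemma Cmod_csum (F : T -> C) : Cmod (csum F) <= rsum (fun i => Cmod (F i)).
Proof.
apply: (big_ind2 (fun x y => Cmod x <= y)).
- by rewrite Cmod_0; apply: Rle_refl.
- move=> x1 x2 y1 y2 h1 h2; apply: Rle_trans (Cmod_triangle _ _) _.
  exact: Rplus_le_compat.
- by move=> i _; apply: Rle_refl.
Qed.

Lemma rsum_le (F G : T -> R) : (forall i, F i <= G i) -> rsum F <= rsum G.
Proof.
move=> h; apply: (big_ind2 Rle) => //; first exact: Rle_refl.
by move=> x1 x2 y1 y2; apply: Rplus_le_compat.
Qed.

Lemma rsum_ge0 (F : T -> R) : (forall i, 0 <= F i) -> 0 <= rsum F.
Proof.
move=> h; apply: (big_ind (Rle 0)) => //; first exact: Rle_refl.
by move=> x y; apply: Rplus_le_le_0_compat.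
Qed.

Lemma rsum_ge (F : T -> R) i : (forall i, 0 <= F i) -> F i <= rsum F.
Proof.
move=> h; rewrite /rsum (bigD1 i) //= -{1}(Rplus_0_r (F i)).
apply: Rplus_le_compat_l; apply: (big_ind (Rle 0)) => //; first exact: Rle_refl.
by move=> x y; apply: Rplus_le_le_0_compat.
Qed.

Lemma csum_delta (F : T -> C) i :
  (forall j, j != i -> F j = RtoC 0) -> csum F = F i.
Proof.
by move=> h; rewrite /csum (bigD1 i) //= big1 => [|j /h //]; rewrite Cplus_0_r.
Qed.

Lemma conj_csum (F : T -> C) : Cconj (csum F) = csum (fun i => Cconj (F i)).
Proof.
apply: (big_morph Cconj Cplus_conj).
by apply: injective_projections => /=; ring.
Qed.

Lemma Re_csum (F : T -> C) : Re (csum F) = rsum (fun i => Re (F i)).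
Proof. exact: (big_morph Re). Qed.

Lemma csum_RtoC (F : T -> R) : csum (fun i => RtoC (F i)) = RtoC (rsum F).
Proof. by symmetry; apply: (big_morph RtoC RtoC_plus). Qed.

End FiniteSums.

Lemma csumS n (F : nat -> C) :
  csum (fun i : 'I_n.+1 => F i) = (csum (fun i : 'I_n => F i) + F n)%C.
Proof. by rewrite /csum big_ord_recr. Qed.

Lemma rsumS n (F : nat -> R) :
  rsum (fun i : 'I_n.+1 => F i) = rsum (fun i : 'I_n => F i) + F n.
Proof. by rewrite /rsum big_ord_recr. Qed.

Lemma csum_ord0 (F : 'I_0 -> C) : csum F = RtoC 0.
Proof. by rewrite /csum big_ord0. Qed.

Lemma rsum_ord0 (F : 'I_0 -> R) : rsum F = 0.
Proof. by rewrite /rsum big_ord0. Qed.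

Lemma csum_recl n (F : nat -> C) :
  csum (fun i : 'I_n.+1 => F i) = (F 0%nat + csum (fun i : 'I_n => F i.+1))%C.
Proof. by rewrite /csum big_ord_recl. Qed.

Lemma csum_widen m n (F : nat -> C) : (m <= n)%nat ->
  (forall i, (m <= i)%nat -> F i = RtoC 0) ->
  csum (fun i : 'I_n => F i) = csum (fun i : 'I_m => F i).
Proof.
move=> le_mn h; elim: n le_mn => [|n IH]; first by rewrite leqn0 => /eqP ->.
rewrite leq_eqVlt => /orP[/eqP -> //|le_mn].
by rewrite csumS h // Cplus_0_r IH.
Qed.

Lemma sum_n_csum (F : nat -> C) n :
  sum_n (G := C_NormedModule) F n = csum (fun i : 'I_n.+1 => F i).
Proof.
elim: n => [|n IH]; first by rewrite sum_O /csum big_ord_recr big_ord0 /= Cplus_0_l.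
rewrite sum_Sn IH (csumS n.+1); exact: erefl.
Qed.

Lemma sum_n_rsum (F : nat -> R) n :
  sum_n F n = rsum (fun i : 'I_n.+1 => F i).
Proof.
elim: n => [|n IH]; first by rewrite sum_O /rsum big_ord_recr big_ord0 /= Rplus_0_l.
rewrite sum_Sn IH (rsumS n.+1); exact: erefl.
Qed.

Lemma geometric_csum n (z : C) :
  (csum (fun i : 'I_n => z ^ i) * (1 - z))%C = (1 - z ^ n)%C.
Proof.
elim: n => [|n IH]; first by rewrite csum_ord0 /=; ring.
by rewrite csumS Cmult_plus_distr_r IH /=; ring.
Qed.

Lemma RtoC_INR_add m n : RtoC (INR (m + n)%nat) = (RtoC (INR m) + RtoC (INR n))%C.
Proof. by rewrite -RtoC_plus plus_INR. Qed.

Lemma binomial_csum n (x y : C) :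
  ((x + y) ^ n)%C =
  csum (fun i : 'I_n.+1 => RtoC (INR 'C(n, i)) * (x ^ i * y ^ (n - i)))%C.
Proof.
elim: n => [|n IH].
  rewrite (csumS 0 (fun i => RtoC (INR 'C(0, i)) * (x ^ i * y ^ (0 - i)))%C).
  by rewrite csum_ord0 bin0 /=; ring.
rewrite (csum_recl n.+1
  (fun i => RtoC (INR 'C(n.+1, i)) * (x ^ i * y ^ (n.+1 - i)))%C).
rewrite (eq_csum (G := fun i : 'I_n.+1 =>
   RtoC (INR 'C(n, i.+1)) * (x ^ i.+1 * y ^ (n - i)) +
   x * (RtoC (INR 'C(n, i)) * (x ^ i * y ^ (n - i))))%C); last first.
  by move=> i; rewrite binS RtoC_INR_add subSS /=; ring.
rewrite csumD csumMl -IH.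
have -> : ((x + y) ^ n.+1 = y * (x + y) ^ n + x * (x + y) ^ n)%C by simpl; ring.
rewrite Cplus_assoc; congr Cplus; rewrite {1}IH -csumMl.
have := csum_recl n.+1
  (fun i => RtoC (INR 'C(n, i)) * (x ^ i * y ^ (n.+1 - i)))%C.
rewrite /= => e; rewrite !bin0 in e *; rewrite /= in e *; rewrite -e => {e}.
rewrite (csumS n.+1 (fun i => RtoC (INR 'C(n, i)) * (x ^ i * y ^ (n.+1 - i)))%C).
rewrite bin_small //= Cmult_0_l Cplus_0_r; apply: eq_csum => i.
by rewrite subSn ?(ltnSE (ltn_ord i)) //=; ring.
Qed.

Lemma eventually_fin (T : finType) (P : T -> nat -> Prop) :
  (forall c, eventually (P c)) -> eventually (fun n => forall c, P c n).
Proof.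
move=> h.
have : forall s : list T, eventually (fun n => forall c, List.In c s -> P c n).
  elim=> [|a s IH]; first by exists 0%nat.
  apply: filter_imp (filter_and _ _ (h a) IH) => n [ha hs] c [<- //|]; exact: hs.
move=> /(_ (enum T)); apply: filter_imp => n hn c; apply: hn.
have := mem_enum T c; rewrite inE.
elim: (enum T) => //= a s IH; rewrite in_cons => /orP[/eqP -> |/IH]; tauto.
Qed.

Lemma Cmod_sub_ge x y : Cmod x - Cmod y <= Cmod (x - y).
Proof.
have := Cmod_triangle (x - y) y; have -> : (x - y + y = x)%C by ring.
lra.
Qed.

Lemma Re_RtoC_mult k z : Re (RtoC k * z)%C = k * Re z.
Proof. by rewrite /Re /=; ring. Qed.

Lemma Re_minus a b : Re (a - b)%C = Re a - Re b.
Proof. by []. Qed.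

Lemma rsum_const0 (T : finType) : rsum (fun _ : T => 0) = 0.
Proof. by rewrite /rsum big1. Qed.

Lemma is_derive_rsum (F : nat -> R -> R) (dF : nat -> R) x m :
  (forall i, is_derive (F i) x (dF i)) ->
  is_derive (fun t => rsum (fun i : 'I_m => F i t)) x
    (rsum (fun i : 'I_m => dF i)).
Proof.
move=> h; elim: m => [|m IH].
  rewrite rsum_ord0; apply: (is_derive_ext (fun _ => 0)) => [t|].
    by rewrite rsum_ord0.
  exact: is_derive_const.
rewrite rsumS; apply: (is_derive_ext (fun t => plus (rsum (fun i : 'I_m => F i t)) (F m t))).
  by move=> t; rewrite (rsumS m (fun i => F i t)).
exact: is_derive_plus.
Qed.

(** * Taylor estimate for ln |1 - u|^2 *)

Lemma Cmod_one_sub (u : C) t :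
  Cmod (1 - RtoC t * u) ^ 2 = 1 - 2 * t * Re u + t ^ 2 * Cmod u ^ 2.
Proof. by rewrite !Cmod2_alt; case: u => a b; rewrite /Re /Im /=; ring. Qed.

(* The derivative in t of the remainder at t u is [2 Re (u (t u)^m / (1 - t u))]. *)
Lemma log_taylor (u : C) theta m : Cmod u <= theta -> theta < 1 ->
  Rabs (- ln (Cmod (1 - u) ^ 2) -
        2 * Re (csum (fun i : 'I_m => u ^ i.+1 / RtoC (INR i.+1))%C))
  <= 2 * (theta ^ m.+1 / (1 - theta)).
Proof.
move=> hu ht; have h0 := Cmod_ge_0 u.
pose D t := 1 - 2 * t * Re u + t ^ 2 * Cmod u ^ 2.
pose phi t := - ln (D t) -
  2 * rsum (fun i : 'I_m => Re (u ^ i.+1)%C / INR i.+1 * t ^ i.+1).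
pose dphi t := (2 * Re u - 2 * t * Cmod u ^ 2) / D t -
  2 * rsum (fun i : 'I_m => Re (u ^ i.+1)%C * t ^ i).
have hmod t : 0 <= t <= 1 -> 1 - theta <= Cmod (1 - RtoC t * u).
  move=> [t0 t1]; have := Cmod_sub_ge 1 (RtoC t * u).
  rewrite Cmod_1 Cmod_mult Cmod_R Rabs_pos_eq //; nra.
have hD t : 0 <= t <= 1 -> 0 < D t.
  move=> h; rewrite /D -Cmod_one_sub; have := hmod t h => h1.
  by apply: pow_lt; lra.
have dp t : 0 <= t <= 1 -> is_derive phi t (dphi t).
  move=> h; rewrite /phi /dphi; apply: (is_derive_minus (V := R_NormedModule)).
    have := hD t h; rewrite /D => h1; auto_derive => //; field; lra.
  apply: is_derive_scal.
  apply: (is_derive_rsum (F := fun i t => Re (u ^ i.+1)%C / INR i.+1 * t ^ i.+1)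
     (dF := fun i => Re (u ^ i.+1)%C * t ^ i)) => i.
  have hi : INR i.+1 <> 0 by apply: not_0_INR.
  auto_derive => //; rewrite -/(INR i.+1) /=; field; exact: hi.
have hdphi t : 0 <= t <= 1 ->
  dphi t = 2 * Re (u * (RtoC t * u) ^ m / (1 - RtoC t * u))%C.
  move=> h; have h1 := hmod t h.
  have nz : (1 - RtoC t * u)%C <> RtoC 0.
    by move=> e; move: h1; rewrite e Cmod_0; lra.
  rewrite /dphi.
  have -> : rsum (fun i : 'I_m => Re (u ^ i.+1)%C * t ^ i) =
     Re (u * csum (fun i : 'I_m => (RtoC t * u) ^ i))%C.
    rewrite -csumMl Re_csum; apply: eq_rsum => i.
    rewrite Cpow_mult_l -RtoC_pow.
    have -> : (u * (RtoC (t ^ i) * u ^ i) = RtoC (t ^ i) * u ^ i.+1)%C.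
      by rewrite /=; ring.
    by rewrite Re_RtoC_mult; ring.
  have -> : csum (fun i : 'I_m => (RtoC t * u) ^ i)%C =
    ((1 - (RtoC t * u) ^ m) / (1 - RtoC t * u))%C.
    by rewrite -geometric_csum; field.
  have e1 : (2 * Re u - 2 * t * Cmod u ^ 2) / D t = 2 * Re (u / (1 - RtoC t * u))%C.
    have := hD t h; rewrite /D -Cmod_one_sub => hd.
    have -> : (u / (1 - RtoC t * u) =
       RtoC (/ Cmod (1 - RtoC t * u) ^ 2) * (u * Cconj (1 - RtoC t * u)))%C.
      have e := Cmod2_conj (1 - RtoC t * u).
      have nz2 : RtoC (Cmod (1 - RtoC t * u) ^ 2) <> RtoC 0.
        by move=> /RtoC_inj; lra.
      have nz3 : Cconj (1 - RtoC t * u) <> RtoC 0.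
        by move=> e3; apply: nz2; rewrite e e3 Cmult_0_r.
      by rewrite RtoC_inv; last lra; rewrite e; field.
    rewrite Re_RtoC_mult /Rdiv Rmult_comm (Cmod2_alt u).
    by move: (/ _) => k; case: (u) => p q; rewrite /Re /Im /=; ring.
  rewrite e1 -Rmult_minus_distr_l -Re_minus; congr (2 * Re _).
  by field.
(* The mean value theorem suffices in place of integrating [dphi]: the claimed bound holds for
   [dphi c] at every c in [0, 1]. *)
have [c [hc e]] : exists c, 0 <= c <= 1 /\ phi 1 - phi 0 = dphi c * (1 - 0).
  have [||c [hc e]] := MVT_gen phi 0 1 dphi.
  - by move=> x; rewrite Rmin_left ?Rmax_right; try lra; move=> hx; apply: dp; lra.
  - move=> x; rewrite Rmin_left ?Rmax_right; try lra; move=> hx.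
    apply/continuity_pt_filterlim; apply: ex_derive_continuous.
    by exists (dphi x); apply: dp.
  by exists c; move: hc; rewrite Rmin_left ?Rmax_right; lra.
have e0 : phi 0 = 0.
  rewrite /phi /D (_ : 1 - _ + _ = 1); last by rewrite /=; ring.
  rewrite ln_1 (eq_rsum (G := fun=> 0)) ?rsum_const0; first by ring.
  by move=> i /=; ring.
have e1 : phi 1 = - ln (Cmod (1 - u) ^ 2) -
        2 * Re (csum (fun i : 'I_m => u ^ i.+1 / RtoC (INR i.+1))%C).
  rewrite /phi /D -Cmod_one_sub Cmult_1_l Re_csum; congr (_ - 2 * _).
  apply: eq_rsum => i; rewrite pow1 Rmult_1_r.
  rewrite /Cdiv Cmult_comm -RtoC_inv; last exact: not_0_INR.
  by rewrite Re_RtoC_mult; field; apply: not_0_INR.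
rewrite -e1 (_ : phi 1 = dphi c); last lra.
rewrite hdphi // Rabs_mult Rabs_pos_eq; last lra.
apply: Rmult_le_compat_l; first lra.
apply: Rle_trans (re_le_Cmod _) _.
have h1 := hmod c hc.
have nz : (1 - RtoC c * u)%C <> RtoC 0.
  by move=> e'; move: h1; rewrite e' Cmod_0; lra.
rewrite Cmod_div // Cmod_mult Cmod_pow Cmod_mult Cmod_R Rabs_pos_eq; last lra.
apply: Rmult_le_compat.
- by apply: Rmult_le_pos => //; apply: pow_le; nra.
- by apply: Rlt_le; apply: Rinv_0_lt_compat; lra.
- rewrite /=; apply: Rmult_le_compat => //; first by apply: pow_le; nra.
  by apply: pow_incr; nra.
- by apply: Rinv_le_contravar; lra.
Qed.

(** * Negativity of the logarithmic energy *)

Lemma geo_small theta c delta : 0 <= theta < 1 -> 0 < delta ->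
  eventually (fun m => c * theta ^ m <= delta).
Proof.
move=> ht hd.
have hc : 0 < delta / (Rabs c + 1).
  by apply: Rdiv_lt_0_compat => //; have := Rabs_pos c; lra.
have [||N hN] := pow_lt_1_zero theta _ (delta / (Rabs c + 1)) => //.
  by rewrite Rabs_pos_eq; lra.
exists N => n hn; have h := hN n hn.
have ge0 : 0 <= theta ^ n by apply: pow_le; lra.
rewrite Rabs_pos_eq // in h.
have h2 : (Rabs c + 1) * theta ^ n <= delta.
  have := Rabs_pos c => h3.
  have -> : delta = (Rabs c + 1) * (delta / (Rabs c + 1)) by field; lra.
  by apply: Rmult_le_compat_l; lra.
have := Rle_abs c; nra.
Qed.

Section Psd.
Variable T : finType.
Implicit Types K : T -> T -> R.

Definition qform K (c : T -> R) : R :=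
  rsum (fun i => rsum (fun j => c i * c j * K i j)).

Definition psd K : Prop := forall c, 0 <= qform K c.

Lemma eq_qform K K' c : (forall i j, K i j = K' i j) -> qform K c = qform K' c.
Proof. by move=> h; apply: eq_rsum => i; apply: eq_rsum => j; rewrite h. Qed.

Lemma qformD K K' c :
  qform (fun i j => K i j + K' i j) c = qform K c + qform K' c.
Proof.
rewrite /qform -rsumD; apply: eq_rsum => i; rewrite -rsumD; apply: eq_rsum => j.
ring.
Qed.

Lemma qformZ a K c : qform (fun i j => a * K i j) c = a * qform K c.
Proof.
rewrite /qform -rsumMl; apply: eq_rsum => i; rewrite -rsumMl; apply: eq_rsum => j.
ring.
Qed.

Lemma psd_ext K K' : (forall i j, K i j = K' i j) -> psd K -> psd K'.
Proof. by move=> h hK c; rewrite -(eq_qform c h). Qed.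

Lemma psdD K K' : psd K -> psd K' -> psd (fun i j => K i j + K' i j).
Proof. by move=> h h' c; rewrite qformD; apply: Rplus_le_le_0_compat. Qed.

Lemma psdZ a K : 0 <= a -> psd K -> psd (fun i j => a * K i j).
Proof. by move=> ha h c; rewrite qformZ; apply: Rmult_le_pos. Qed.

(** The Schur product with a rank-one kernel is a congruence by the diagonal matrix of [v]:
    substitute [c i * v i] for [c i]. *)
Lemma psd_gram (v : T -> R) K : psd K -> psd (fun i j => v i * v j * K i j).
Proof.
move=> h c; have := h (fun i => c i * v i); rewrite /qform.
by rewrite (eq_rsum (G := fun i => rsum (fun j => c i * c j * (v i * v j * K i j)))) //
  => i; apply: eq_rsum => j; ring.
Qed.

Lemma psd_one : psd (fun _ _ => 1).
Proof.
move=> c; have -> : qform (fun _ _ => 1) c = rsum c * rsum c.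
  rewrite /qform -rsumMr; apply: eq_rsum => i; rewrite -rsumMl.
  by apply: eq_rsum => j; ring.
exact: Rle_0_sqr.
Qed.

Lemma psd_zero : psd (fun _ _ => 0).
Proof.
by apply: psd_ext (psdZ (Rle_refl 0) psd_one) => i j; rewrite Rmult_0_l.
Qed.

Lemma psd_rsum m (F : nat -> T -> T -> R) :
  (forall k, psd (F k)) -> psd (fun i j => rsum (fun k : 'I_m => F k i j)).
Proof.
move=> h; elim: m => [|m IH].
  by apply: psd_ext psd_zero => i j; rewrite rsum_ord0.
by apply: psd_ext (psdD IH (h m)) => i j; rewrite (rsumS m (fun k => F k i j)).
Qed.

Lemma qform_approx K K' c delta :
  (forall i j, Rabs (K i j - K' i j) <= delta) ->
  qform K' c - delta * rsum (fun i => Rabs (c i)) ^ 2 <= qform K c.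
Proof.
move=> h.
suff : qform (fun i j => K' i j - K i j) c <=
    delta * rsum (fun i => Rabs (c i)) ^ 2.
  rewrite (eq_qform (K' := fun i j => K' i j + (-1) * K i j)) ?qformD ?qformZ; first lra.
  by move=> i j; ring.
have -> : delta * rsum (fun i => Rabs (c i)) ^ 2 =
   rsum (fun i => rsum (fun j => Rabs (c i) * Rabs (c j) * delta)).
  rewrite (_ : _ * _ = rsum (fun i => Rabs (c i)) * (rsum (fun i => Rabs (c i)) * delta)); last ring.
  rewrite -rsumMr; apply: eq_rsum => i; rewrite -rsumMr -rsumMl; apply: eq_rsum => j; ring.
apply: rsum_le => i; apply: rsum_le => j.
apply: Rle_trans (Rle_abs _) _; rewrite !Rabs_mult.
apply: Rmult_le_compat_l; first by apply: Rmult_le_pos; apply: Rabs_pos.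
by rewrite Rabs_minus_sym.
Qed.

Lemma psd_lim K :
  (forall delta, 0 < delta ->
     exists K', psd K' /\ forall i j, Rabs (K i j - K' i j) <= delta) ->
  psd K.
Proof.
move=> h c; apply: Rnot_lt_le => hneg.
set S := rsum (fun i => Rabs (c i)) ^ 2.
have S0 : 0 <= S by apply: pow2_ge_0.
have hd : 0 < - qform K c / (2 * (S + 1)) by apply: Rdiv_lt_0_compat; lra.
have [K' [pK' /qform_approx - /(_ c)]] := h _ hd; rewrite -/S.
have := pK' c; set d := _ / _ => h1 h2.
have e : d * (2 * (S + 1)) = - qform K c by rewrite /d; field; lra.
nra.
Qed.

(* With h x = 1 + |x|^2 one has
   [eps + |x - y|^2 = h x * h y * (1 - kappa)], where kappa is a Gram kernel,
   and [- ln (1 - kappa)] is a power series in kappa with positive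
   coefficients. *)
Lemma log_energy_real (x : T -> C) (c : T -> R) eps : 0 < eps < 1 ->
  rsum c = 0 ->
  qform (fun i j => ln (eps + Cmod (x i - x j) ^ 2)) c <= 0.
Proof.
move=> he hc.
pose h i := 1 + Cmod (x i) ^ 2.
have h1 i : 1 <= h i by rewrite /h; have := pow2_ge_0 (Cmod (x i)); lra.
have h0 i : / h i <> 0 by apply: Rinv_neq_0_compat; have := h1 i; lra.
pose kap i j := (1 - eps + 2 * (Re (x i) * Re (x j)) + 2 * (Im (x i) * Im (x j))
   + Cmod (x i) ^ 2 * Cmod (x j) ^ 2) / (h i * h j).
(* [kap] is a sum of four rank-one kernels with nonnegative coefficients (1 - eps is one of them),
   so multiplication by [kap] preserves positivity, and all powers of [kap] are positive. *)
have psd_kap K : psd K -> psd (fun i j => kap i j * K i j).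
  move=> hK.
  have g1 := psdZ (a := 1 - eps) ltac:(lra) (psd_gram (fun i => / h i) hK).
  have g2 := psdZ (a := 2) ltac:(lra) (psd_gram (fun i => Re (x i) / h i) hK).
  have g3 := psdZ (a := 2) ltac:(lra) (psd_gram (fun i => Im (x i) / h i) hK).
  have g4 := psd_gram (fun i => Cmod (x i) ^ 2 / h i) hK.
  apply: psd_ext (psdD (psdD (psdD g1 g2) g3) g4) => i j.
  by rewrite /kap; field; have := h1 i; have := h1 j; lra.
have kapE i j : h i * h j * (1 - kap i j) = eps + Cmod (x i - x j) ^ 2.
  have := h1 i; have := h1 j => hj hi; rewrite /kap /h in hi hj *.
  move: hi hj; rewrite !Cmod2_alt.
  case: (x i) => a b; case: (x j) => a' b'; rewrite /Re /Im /= => hi hj; field; lra.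
pose H := rsum h.
have hH i : h i <= H by apply: (rsum_ge (F := h)) => k; have := h1 k; lra.
have lnE i j : ln (eps + Cmod (x i - x j) ^ 2) =
    ln (h i) + ln (h j) - - ln (1 - kap i j).
  have p : 0 < eps + Cmod (x i - x j) ^ 2 by have := pow2_ge_0 (Cmod (x i - x j)); lra.
  have hi := h1 i; have hj := h1 j; have hij : 0 < h i * h j by nra.
  have k0 : 0 < 1 - kap i j by move: p; rewrite -kapE; nra.
  by rewrite -kapE !ln_mult; lra.
(* The terms ln (h i) and ln (h j) depend on one index only, so the neutrality of [c] cancels
   them. *)
suff pl : psd (fun i j => - ln (1 - kap i j)).
  rewrite (eq_qform (K' := fun i j =>
     (ln (h i) + ln (h j)) + (-1) * - ln (1 - kap i j))); last first.
    by move=> i j; rewrite lnE; ring.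
  rewrite qformD qformZ.
  have -> : qform (fun i j => ln (h i) + ln (h j)) c = 0.
    rewrite qformD.
    have -> : qform (fun i j => ln (h i)) c = rsum (fun i => c i * ln (h i)) * rsum c.
      rewrite /qform -rsumMr; apply: eq_rsum => i; rewrite -rsumMl.
      by apply: eq_rsum => j; ring.
    have -> : qform (fun i j => ln (h j)) c = rsum c * rsum (fun i => c i * ln (h i)).
      rewrite /qform -rsumMr; apply: eq_rsum => i; rewrite -rsumMl.
      by apply: eq_rsum => j; ring.
    by rewrite hc; ring.
  by have := pl c; lra.
have [t0|tn] : (forall i : T, False) \/ exists i : T, True.
  by case: (pickP (fun _ : T => true)) => [i _|e]; [right; exists i | left => i; have := e i].
  by apply: psd_lim => d hd; exists (fun _ _ => 0); split => [|i]; [apply: psd_zero | case: (t0 i)].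
have H1 : 1 <= H by case: tn => i _; apply: Rle_trans (hH i).
(* From below, h i * h j * kap i j = |1 + x_i conj x_j|^2 - eps gives kap >= - eps; from above, 1 -
   kap >= eps / H^2. With eps = 0 the diagonal values of [kap] would be 1 and the series would
   diverge there. *)
pose theta := Rmax eps (1 - eps / (H * H)).
have hq : 0 < eps / (H * H) by apply: Rdiv_lt_0_compat; nra.
have ht : 0 <= theta < 1.
  by split; [apply: Rle_trans (Rmax_l _ _); lra | apply: Rmax_lub_lt; lra].
have kth i j : Rabs (kap i j) <= theta.
  have hi := h1 i; have hj := h1 j; have hij : 1 <= h i * h j by nra.
  apply: Rabs_le; split.
    have : - eps <= kap i j.
      apply: (Rmult_le_reg_l (h i * h j)); first lra.
      have -> : h i * h j * kap i j = h i * h j - (eps + Cmod (x i - x j) ^ 2).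
        by rewrite -kapE; ring.
      rewrite /h in hij *; rewrite !Cmod2_alt in hij *.
      move: hij; case: (x i) => a b; case: (x j) => a' b'; rewrite /Re /Im /= => hij.
      have := pow2_ge_0 (1 + a * a' + b * b'); have := pow2_ge_0 (a * b' - b * a').
      nra.
    by have := Rmax_l eps (1 - eps / (H * H)); rewrite -/theta; lra.
  apply: Rle_trans (Rmax_r _ _).
  suff : eps / (H * H) <= 1 - kap i j by lra.
  apply: (Rmult_le_reg_l (h i * h j)); first lra.
  rewrite kapE; apply: (Rle_trans _ (H * H * (eps / (H * H)))).
    apply: Rmult_le_compat_r; first lra.
    by apply: Rmult_le_compat; try lra; apply: hH.
  have -> : H * H * (eps / (H * H)) = eps by field; lra.
  by have := pow2_ge_0 (Cmod (x i - x j)); lra.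
have psdk n : psd (fun i j => kap i j ^ n).
  by elim: n => [|n IH] /=; [apply: psd_one | apply: psd_kap].
apply: psd_lim => delta hdelta.
have [m hm] := geo_small (theta / (1 - theta)) ht hdelta.
exists (fun i j => rsum (fun k : 'I_m => kap i j ^ k.+1 / INR k.+1)); split.
  apply: (psd_rsum m (F := fun k i j => kap i j ^ k.+1 / INR k.+1)) => k.
  have hk : 0 <= / INR k.+1.
    by apply: Rlt_le; apply: Rinv_0_lt_compat; apply: lt_0_INR; lia.
  by apply: psd_ext (psdZ hk (psdk k.+1)) => i j; rewrite /Rdiv Rmult_comm.
move=> i j.
have := @log_taylor (RtoC (kap i j)) theta m.
rewrite Cmod_R => /(_ (kth i j) (proj2 ht)).
have -> : csum (fun i0 : 'I_m => RtoC (kap i j) ^ i0.+1 / RtoC (INR i0.+1))%C =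
  RtoC (rsum (fun k : 'I_m => kap i j ^ k.+1 / INR k.+1)).
  rewrite -csum_RtoC; apply: eq_csum => k.
  by rewrite RtoC_div ?RtoC_pow //; apply: not_0_INR.
have -> : (1 - RtoC (kap i j))%C = RtoC (1 - kap i j) by rewrite RtoC_minus.
have pk : 0 < 1 - kap i j.
  by have := kth i j; have := Rle_abs (kap i j); lra.
rewrite Cmod_R (Rabs_pos_eq (1 - kap i j)); last lra.
have -> : ln ((1 - kap i j) ^ 2) = 2 * ln (1 - kap i j).
  by rewrite /= Rmult_1_r ln_mult //; ring.
rewrite /Re /=; set S := rsum _ => h2.
have h3 := hm m (le_n m).
have e : theta / (1 - theta) * theta ^ m = theta * theta ^ m / (1 - theta) by field; lra.
rewrite e in h3.
have -> : - ln (1 - kap i j) - S = / 2 * (- (2 * ln (1 - kap i j)) - 2 * S) by field.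
rewrite Rabs_mult Rabs_pos_eq; lra.
Qed.

End Psd.

(** * The Grunsky inequality *)

Definition cis (t : R) : C := (cos t, sin t).

Lemma cis_add s t : (cis (s + t) = cis s * cis t)%C.
Proof.
rewrite /cis cos_plus sin_plus; apply: injective_projections => /=; ring.
Qed.

Lemma cis0 : cis 0 = RtoC 1.
Proof. by rewrite /cis cos_0 sin_0. Qed.

Lemma cis_pow t n : (cis t ^ n)%C = cis (INR n * t).
Proof.
elim: n => [|n IH]; first by rewrite /= Rmult_0_l cis0.
by rewrite Cpow_S IH -cis_add S_INR; congr cis; ring.
Qed.

Lemma Cmod_cis t : Cmod (cis t) = 1.
Proof.
rewrite /Cmod /cis /=; have := sin2_cos2 t; rewrite /Rsqr => h.
rewrite (_ : _ + _ = 1); first exact: sqrt_1.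
lra.
Qed.

Lemma cis_period t n : cis (t + 2 * INR n * PI) = cis t.
Proof. by rewrite /cis cos_period sin_period. Qed.

Lemma cis_neq1 t : 0 < t < 2 * PI -> cis t <> RtoC 1.
Proof.
move=> ht [] hc _.
have hs : 0 < sin (t / 2) by apply: sin_gt_0; lra.
have := cos_2a_sin (t / 2); have -> : 2 * (t / 2) = t by field.
rewrite hc; nra.
Qed.

Definition root (N : nat) (j : nat) : C := cis (2 * PI * INR j / INR N).

Lemma Cmod_root N j : Cmod (root N j) = 1. Proof. exact: Cmod_cis. Qed.

Lemma root_conj N j : (root N j * Cconj (root N j) = 1)%C.
Proof. by rewrite -Cmod2_conj Cmod_root pow1. Qed.

Lemma root_sum N d : (d < N)%nat ->
  csum (fun j : 'I_N => root N j ^ d)%C =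
  if d == 0%nat then RtoC (INR N) else RtoC 0.
Proof.
move=> hd; case: eqP => [->|/eqP d0].
  rewrite /= csum_RtoC; congr RtoC; elim: (N) => [|n IH].
    by rewrite rsum_ord0.
  by rewrite (rsumS n (fun=> 1)) IH S_INR.
have hN : 0 < INR N by apply: lt_0_INR; apply/ltP; apply: leq_ltn_trans hd.
pose z := cis (2 * PI * INR d / INR N).
rewrite (eq_csum (G := fun j : 'I_N => z ^ j)%C); last first.
  move=> j; rewrite !cis_pow; congr cis; field; lra.
have z1 : z <> RtoC 1.
  apply: cis_neq1.
  have h1 : 0 < INR d by apply: lt_0_INR; apply/ltP; rewrite lt0n.
  have h2 : INR d < INR N by apply: lt_INR; apply/ltP.
  have hp := PI_RGT_0; split; first by apply: Rdiv_lt_0_compat; nra.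
  apply: (Rmult_lt_reg_r (INR N)) => //.
  have -> : 2 * PI * INR d / INR N * INR N = 2 * PI * INR d by field; lra.
  nra.
have zN : (z ^ N)%C = RtoC 1.
  rewrite cis_pow.
  have -> : INR N * (2 * PI * INR d / INR N) = 0 + 2 * INR d * PI by field; lra.
  by rewrite cis_period cis0.
have := geometric_csum N z; rewrite zN => h.
have nz : (1 - z)%C <> RtoC 0.
  by move=> h0; apply: z1; clearbody z; have e : (z = 1 - (1 - z))%C by [ring]; rewrite e h0; ring.
have -> : csum (fun j : 'I_N => z ^ j)%C =
  (csum (fun j : 'I_N => z ^ j)%C * (1 - z) / (1 - z))%C by field.
by rewrite h; field.
Qed.

Lemma root_pow_sub N j a b : (b <= a)%nat ->
  (root N j ^ a * Cconj (root N j) ^ b = root N j ^ (a - b))%C.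
Proof.
move=> h; rewrite -{1}(subnK h) Cpow_add_r -Cmult_assoc -Cpow_mult_l root_conj.
by rewrite Cpow_1_l Cmult_1_r.
Qed.

(** The two hypotheses say |a - b| < N, so that congruence of the exponents modulo N becomes
    equality. *)
Lemma root_orth N a b : (a < b + N)%nat -> (b < a + N)%nat ->
  csum (fun j : 'I_N => root N j ^ a * Cconj (root N j) ^ b)%C =
  if a == b then RtoC (INR N) else RtoC 0.
Proof.
move=> hab hba; case: (leqP b a) => hle.
  rewrite (eq_csum (G := fun j : 'I_N => root N j ^ (a - b))%C); last first.
    by move=> j; apply: root_pow_sub.
  rewrite root_sum; last by rewrite ltn_subLR.
  by rewrite subn_eq0; case: (eqVneq a b) => [->|ne]; rewrite ?leqnn // leqNgt ltn_neqAle eq_sym ne hle.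
rewrite (eq_csum (G := fun j : 'I_N => Cconj (root N j ^ (b - a)))%C); last first.
  move=> j; rewrite -(root_pow_sub N j (ltnW hle)) Cmult_conj !Cpow_conj Cconj_conj.
  by rewrite Cmult_comm.
rewrite -conj_csum root_sum; last by rewrite ltn_subLR // ltnW.
rewrite subn_eq0 leqNgt hle /= (ltn_eqF hle).
by apply: injective_projections => /=; ring.
Qed.

(** The left side runs along the antidiagonals i + l + 1 = n. With K + K <= m, every antidiagonal
    that meets the square of side K is among them. *)
Lemma antidiagonal_csum (H : nat -> nat -> C) K m : (K + K <= m)%nat ->
  (forall i l, (i < m)%nat -> (l < m)%nat -> (K <= i)%nat \/ (K <= l)%nat ->
     H i l = RtoC 0) ->
  csum (fun n : 'I_m => csum (fun i : 'I_n => H i (n.-1 - i)%nat)) =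
  csum (fun i : 'I_K => csum (fun l : 'I_K => H i l)).
Proof.
move=> hm hH.
pose ind i l n := if (i + l).+1 == n then H i l else RtoC 0.
have -> : csum (fun n : 'I_m => csum (fun i : 'I_n => H i (n.-1 - i)%nat)) =
  csum (fun n : 'I_m => csum (fun i : 'I_m => csum (fun l : 'I_m => ind i l n))).
  apply: eq_csum => n.
  transitivity (csum (fun i : 'I_n => csum (fun l : 'I_m => ind i l n))).
    apply: eq_csum => i.
    have hl : (n.-1 - i < m)%nat by have := ltn_ord i; have := ltn_ord n; lia.
    rewrite (csum_delta (i := Ordinal hl)) /=.
      rewrite /ind ifT //; apply/eqP; have := ltn_ord i; lia.
    move=> j /eqP hj; rewrite /ind ifF //; apply/eqP => e; apply: hj; apply: val_inj => /=.
    by lia.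
  symmetry; apply: (@csum_widen n m (fun i => csum (fun l : 'I_m => ind i l n))).
  - exact: ltnW (ltn_ord n).
  - move=> i hi; rewrite (eq_csum (G := fun=> RtoC 0)) ?csum0 // => l.
    by rewrite /ind ifF //; apply/eqP; lia.
rewrite csum_exchange.
pose H' i l := if (i < K)%nat && (l < K)%nat then H i l else RtoC 0.
rewrite (eq_csum (G := fun i : 'I_m => csum (fun l : 'I_m => H' i l))); last first.
  move=> i; rewrite csum_exchange; apply: eq_csum => l; rewrite /H'.
  case: ifP => [/andP[hi hl]|h].
    have hn : ((i + l).+1 < m)%nat by lia.
    rewrite (csum_delta (i := Ordinal hn)) /ind /= ?eqxx // => j /eqP hj.
    by rewrite ifF //; apply/eqP => e; apply: hj; apply: val_inj.
  rewrite (eq_csum (G := fun=> RtoC 0)) ?csum0 // => n; rewrite /ind; case: ifP => // _.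
  apply: hH => //; move/negbT: h; rewrite negb_and -!leqNgt => /orP[]; tauto.
have hK : (K <= m)%nat by lia.
rewrite (csum_widen (m := K) (F := fun i => csum (fun l : 'I_m => H' i l))) //; last first.
  move=> i hi; rewrite (eq_csum (G := fun=> RtoC 0)) ?csum0 // => l.
  by rewrite /H' ltnNge hi.
apply: eq_csum => i.
rewrite (csum_widen (m := K) (F := fun l => H' i l)) //.
  by apply: eq_csum => l; rewrite /H' !ltn_ord.
by move=> l hl; rewrite /H' (ltnNge l) hl andbF.
Qed.

(** The coefficient of X^k Y^l in - ln (1 - X - Y), for k, l >= 1. *)
Definition log_coef (k l : nat) : R :=
  INR ((k + l).-1)`! / (INR k`! * INR l`!).

Lemma INR_fact_neq0 n : INR n`! <> 0.
Proof. by apply: not_0_INR; apply/eqP; rewrite -lt0n fact_gt0. Qed.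

Lemma log_coefE i l :
  INR 'C((i + l).+2, i.+1) / INR (i + l).+2 = log_coef i.+1 l.+1.
Proof.
rewrite /log_coef (_ : (i.+1 + l.+1).-1 = (i + l).+1)%nat; last lia.
have hi := @INR_fact_neq0 i.+1; have hl := @INR_fact_neq0 l.+1.
have hn : INR (i + l).+2 <> 0 by apply: not_0_INR.
apply: (Rmult_eq_reg_r (INR (i + l).+2 * (INR i.+1`! * INR l.+1`!))); last first.
  by apply: Rmult_integral_contrapositive_currified => //; apply: Rmult_integral_contrapositive_currified.
transitivity (INR 'C((i + l).+2, i.+1) * (INR i.+1`! * INR l.+1`!)).
  by move: hn; generalize (INR (i + l).+2) => k hn; field.
transitivity (INR (i + l).+2 * INR (i + l).+1`!); last first.
  move: hi hl; generalize (INR i.+1`!) (INR l.+1`!) => p q hp hq.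
  by field.
have h := @bin_fact (i + l).+2 i.+1 ltac:(lia).
rewrite -!mult_INR; congr INR; move: h; rewrite factS.
have -> : ((i + l).+2 - i.+1 = l.+1)%nat by lia.
move=> h; exact: h.
Qed.

Section Moments.
Variables (J J' : finType) (al : J -> C) (al' : J' -> C) (e : J -> C) (e' : J' -> C).
Let A k := csum (fun j => al j * e j ^ k)%C.
Let A' k := csum (fun j => al' j * e' j ^ k)%C.

Lemma moment_pow (X Y : C) n :
  csum (fun j => csum (fun j' => al j * al' j' * (X * e j + Y * e' j') ^ n)%C) =
  csum (fun i : 'I_n.+1 =>
    RtoC (INR 'C(n, i)) * (X ^ i * Y ^ (n - i) * (A i * A' (n - i))))%C.
Proof.
transitivity (csum (fun j => csum (fun i : 'I_n.+1 => csum (fun j' =>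
    RtoC (INR 'C(n, i)) * (X ^ i * Y ^ (n - i) *
     ((al j * e j ^ i) * (al' j' * e' j' ^ (n - i))))))))%C.
  apply: eq_csum => j; rewrite -csum_exchange; apply: eq_csum => j'.
  rewrite binomial_csum -csumMl; apply: eq_csum => i.
  by rewrite !Cpow_mult_l; ring.
rewrite csum_exchange; apply: eq_csum => i.
rewrite /A -csumMr -!csumMl; apply: eq_csum => j.
by rewrite -!csumMl; apply: eq_csum => j'.
Qed.

(** Expanding the powers by the binomial theorem leaves products of moments. Neutrality kills the
    terms with k = 0 or l = 0, and the vanishing of the moments of orders above K makes the
    truncated logarithm yield a complete square block of coefficients. *)
Lemma moment_log (X Y : C) K m : (K + K <= m)%nat ->
  A 0%nat = RtoC 0 -> A' 0%nat = RtoC 0 ->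
  (forall k, (K < k <= m)%nat -> A k = RtoC 0 /\ A' k = RtoC 0) ->
  csum (fun n : 'I_m => csum (fun j => csum (fun j' =>
     al j * al' j' * (X * e j + Y * e' j') ^ n.+1)) / RtoC (INR n.+1))%C =
  csum (fun k : 'I_K => csum (fun l : 'I_K => RtoC (log_coef k.+1 l.+1) *
     (X ^ k.+1 * Y ^ l.+1 * (A k.+1 * A' l.+1))))%C.
Proof.
move=> hm A0 A0' hA.
pose H k l := (RtoC (log_coef k.+1 l.+1) * (X ^ k.+1 * Y ^ l.+1 * (A k.+1 * A' l.+1)))%C.
rewrite -(antidiagonal_csum (H := H) hm); last first.
  move=> i l hi hl [h|h]; rewrite /H.
    by rewrite (proj1 (hA i.+1 _)); [ring | lia].
  by rewrite (proj2 (hA l.+1 _)); [ring | lia].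
apply: eq_csum => n; rewrite moment_pow.
rewrite (csumS n.+1 (fun i => RtoC (INR 'C(n.+1, i)) *
  (X ^ i * Y ^ (n.+1 - i) * (A i * A' (n.+1 - i))))%C) subnn A0'.
rewrite (csum_recl n (fun i => RtoC (INR 'C(n.+1, i)) *
  (X ^ i * Y ^ (n.+1 - i) * (A i * A' (n.+1 - i))))%C) A0.
rewrite !(Cmult_0_l, Cmult_0_r) Cplus_0_r Cplus_0_l /Cdiv -csumMr.
apply: eq_csum => i; rewrite /H -log_coefE.
have hi := ltn_ord i.
have -> : (i + (n.-1 - i)).+2 = n.+1 by lia.
have -> : (n.-1 - i).+1 = (n.+1 - i.+1)%nat by lia.
by rewrite RtoC_div ?/Cdiv; [ring | apply: not_0_INR].
Qed.

End Moments.

Lemma rsum_const n c : rsum (fun _ : 'I_n => c) = INR n * c.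
Proof.
elim: n => [|n IH]; first by rewrite rsum_ord0 /=; ring.
by rewrite (rsumS n (fun=> c)) IH S_INR; ring.
Qed.

Section Charge.
Variables (N K : nat).

(* A neutral charge distribution on the N-th roots of unity whose moments of
   orders 1, ..., K are [s] and whose conjugate moments are [q]. *)
Definition charge (s q : nat -> C) (j : nat) : C :=
  (/ RtoC (INR N) * csum (fun k : 'I_K =>
     s k * Cconj (root N j) ^ k.+1 + q k * root N j ^ k.+1))%C.

Definition cconj_fun (s : nat -> C) k := Cconj (s k).

Lemma charge_conj s q j : (0 < N)%nat ->
  Cconj (charge s q j) = charge (cconj_fun q) (cconj_fun s) j.
Proof.
move=> hN; rewrite /charge Cmult_conj Cinv_conj; last first.
  by move=> /RtoC_inj; apply: not_0_INR; lia.
have -> : Cconj (RtoC (INR N)) = RtoC (INR N).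
  by apply: injective_projections => /=; ring.
congr Cmult; rewrite conj_csum; apply: eq_csum => k.
by rewrite Cplus_conj !Cmult_conj !Cpow_conj Cconj_conj Cplus_comm.
Qed.

(** The condition n + K < N excludes aliasing: the [q] terms have frequency n + k + 1, strictly
    between 0 and N, and the [s] terms survive only for n = k + 1. The case n = 0 is neutrality. *)
Lemma charge_moment s q n : (n + K < N)%nat ->
  csum (fun j : 'I_N => charge s q j * root N j ^ n)%C =
  if (0 < n <= K)%nat then s n.-1 else RtoC 0.
Proof.
move=> hn.
have nzN : RtoC (INR N) <> RtoC 0 by move=> /RtoC_inj; apply: not_0_INR; lia.
rewrite (eq_csum (G := fun j : 'I_N => csum (fun k : 'I_K => / RtoC (INR N) *
    (s k * (root N j ^ n * Cconj (root N j) ^ k.+1) +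
     q k * (root N j ^ (n + k.+1) * Cconj (root N j) ^ 0))))%C); last first.
  move=> j; rewrite /charge Cmult_comm -csumMl -csumMl; apply: eq_csum => k.
  by rewrite Cpow_add_r /=; ring.
rewrite csum_exchange.
rewrite (eq_csum (G := fun k : 'I_K => if n == k.+1 then s k else RtoC 0)); last first.
  move=> k; have hk := ltn_ord k.
  rewrite csumMl csumD !csumMl !root_orth; try lia.
  rewrite (_ : (n + k.+1 == 0)%nat = false); last by rewrite addnS.
  by case: ifP => _; field.
case: ifP => [/andP[h0 hK]|h].
  have hk : (n.-1 < K)%nat by lia.
  rewrite (csum_delta (i := Ordinal hk)) /= ?prednK ?eqxx // => j /eqP hj.
  by rewrite ifF //; apply/eqP => e; apply: hj; apply: val_inj => /=; lia.
rewrite (eq_csum (G := fun=> RtoC 0)) ?csum0 // => k; rewrite ifF //; apply/eqP => e.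
by have := ltn_ord k; move: h; rewrite e /= => -> .
Qed.

(** The bound does not depend on N: the total mass stays controlled when N is chosen after the
    accuracy of the kernel. *)
Lemma charge_abs s q : (0 < N)%nat ->
  rsum (fun j : 'I_N => Cmod (charge s q j)) <=
  rsum (fun k : 'I_K => Cmod (s k) + Cmod (q k)).
Proof.
move=> hN; have hN' : 0 < INR N by apply: lt_0_INR; apply/ltP.
set S := rsum (fun k : 'I_K => _).
have -> : S = rsum (fun j : 'I_N => / INR N * S).
  by rewrite rsum_const; field; lra.
apply: rsum_le => j; rewrite /charge Cmod_mult Cmod_inv; last first.
  by move=> /RtoC_inj; lra.
rewrite Cmod_R Rabs_pos_eq; last lra.
apply: Rmult_le_compat_l; first by apply: Rlt_le; apply: Rinv_0_lt_compat.
apply: Rle_trans (Cmod_csum _) _; apply: rsum_le => k.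
apply: Rle_trans (Cmod_triangle _ _) _.
rewrite !Cmod_mult !Cmod_pow Cmod_conj !Cmod_root !pow1; lra.
Qed.

End Charge.

(** The Taylor polynomial of - ln (1 - u). *)
Definition log_poly (m : nat) (u : C) : C :=
  csum (fun n : 'I_m => u ^ n.+1 / RtoC (INR n.+1))%C.

Section Grunsky.
Variables (T : finType) (w sq : T -> C).
Hypothesis sq0 : forall a, sq a <> RtoC 0.
Hypothesis sep : forall a b, a <> b -> Cmod (sq a) + Cmod (sq b) < Cmod (w a - w b).
Variables (K : nat) (s q : T -> nat -> C).

(** For a <> b and k, l >= 1, the coefficient of z^k z'^l in the expansion of - ln ((w a + sq a z) -
    (w b + sq b z')), that is, of the logarithmic kernel between two circles. *)
Definition gcoef (a b : T) (k l : nat) : C :=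
  if a == b then RtoC 0
  else (RtoC (log_coef k l) *
    ((-(1)) ^ k * (sq a ^ k * sq b ^ l) / (w a - w b) ^ (k + l)))%C.

Lemma w_neq a b : a <> b -> (w a - w b)%C <> RtoC 0.
Proof.
move=> h e; have := sep h; rewrite e Cmod_0.
by have := Cmod_ge_0 (sq a); have := Cmod_ge_0 (sq b); lra.
Qed.

Lemma sign_sq n : ((- (1)) ^ n * (- (1)) ^ n = RtoC 1)%C.
Proof. by rewrite -Cpow_mult_l (_ : (- (1) * - (1) = RtoC 1)%C) ?Cpow_1_l //; ring. Qed.

Lemma sign_neq0 n : ((- (1)) ^ n)%C <> RtoC 0.
Proof. by apply: Cpow_nz => e; have := Cmod_m1; rewrite e Cmod_0; lra. Qed.

Lemma gcoef_sym a b k l : gcoef a b k l = gcoef b a l k.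
Proof.
rewrite /gcoef eq_sym; case: eqP => // h.
have nz := w_neq (fun e => h (esym e)).
rewrite /log_coef (addnC l k) (Rmult_comm (INR l`!)).
have -> : (w b - w a = - (1) * (w a - w b))%C by ring.
rewrite Cpow_mult_l [((- (1)) ^ (k + l))%C]Cpow_add_r.
have := @sign_neq0 k; have := @sign_neq0 l; have := Cpow_nz _ (k + l) nz.
have := sign_sq k.
move: ((- (1)) ^ k)%C ((- (1)) ^ l)%C ((w a - w b) ^ (k + l))%C => x y z e hz hy hx.
congr Cmult; have -> : (y * (sq b ^ l * sq a ^ k) / (x * y * z) =
  (x * x) * (sq a ^ k * sq b ^ l) / (x * z))%C by rewrite e; field.
by field.
Qed.

Variables (N m : nat).
Hypotheses (Km : (K + K <= m)%nat) (mN : (m + K < N)%nat).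

(** The charge placed on circle c has moments [s c], and its complex conjugate [sgc] has moments
    [q c]. Two independent families of moments make the off-diagonal energy bilinear in [s] and
    [q]. *)
Definition sg c := charge N K (s c) (cconj_fun (q c)).
Definition sgc c := charge N K (q c) (cconj_fun (s c)).

Lemma sg_conj c j : Cconj (sg c j) = sgc c j.
Proof.
rewrite /sg charge_conj; last lia.
congr Cmult; apply: eq_csum => k.
by rewrite /cconj_fun Cconj_conj.
Qed.

Lemma sgc_conj c j : Cconj (sgc c j) = sg c j.
Proof. by rewrite -sg_conj Cconj_conj. Qed.

Lemma sg_moment c n : (n <= m)%nat ->
  csum (fun j : 'I_N => sg c j * root N j ^ n)%C =
  if (0 < n <= K)%nat then s c n.-1 else RtoC 0.
Proof. by move=> h; apply: charge_moment; lia. Qed.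

Lemma sgc_moment c n : (n <= m)%nat ->
  csum (fun j : 'I_N => sgc c j * root N j ^ n)%C =
  if (0 < n <= K)%nat then q c n.-1 else RtoC 0.
Proof. by move=> h; apply: charge_moment; lia. Qed.

(** The u for which the difference of the two points on the circles is (w c - w b) (1 - u). *)
Definition cross_arg (c b : T) (j j' : nat) : C :=
  (- sq c / (w c - w b) * root N j + sq b / (w c - w b) * root N j')%C.

Lemma cross_block c b : c <> b ->
  csum (fun j : 'I_N => csum (fun j' : 'I_N =>
    (sg c j * sgc b j' + sgc c j * sg b j') * log_poly m (cross_arg c b j j')))%C =
  csum (fun k : 'I_K => csum (fun l : 'I_K =>
    gcoef c b k.+1 l.+1 * (s c k * q b l + q c k * s b l)))%C.
Proof.
move=> cb; have nz := w_neq cb.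
have red (al al' : T -> nat -> C) (f f' : T -> nat -> C) :
  (forall c n, (n <= m)%nat -> csum (fun j : 'I_N => al c j * root N j ^ n)%C =
     if (0 < n <= K)%nat then f c n.-1 else RtoC 0) ->
  (forall c n, (n <= m)%nat -> csum (fun j : 'I_N => al' c j * root N j ^ n)%C =
     if (0 < n <= K)%nat then f' c n.-1 else RtoC 0) ->
  csum (fun j : 'I_N => csum (fun j' : 'I_N =>
    al c j * al' b j' * log_poly m (cross_arg c b j j')))%C =
  csum (fun k : 'I_K => csum (fun l : 'I_K => gcoef c b k.+1 l.+1 * (f c k * f' b l)))%C.
  move=> h h'.
  have := @moment_log 'I_N 'I_N (al c) (al' b) (root N) (root N)
    (- sq c / (w c - w b))%C (sq b / (w c - w b))%C K m Km.
  rewrite (h c 0%nat) // (h' b 0%nat) // => /(_ erefl erefl) hm.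
  transitivity (csum (fun n : 'I_m => csum (fun j : 'I_N => csum (fun j' : 'I_N =>
      al c j * al' b j' * cross_arg c b j j' ^ n.+1)) / RtoC (INR n.+1))%C).
    rewrite /Cdiv; symmetry.
    rewrite (eq_csum (G := fun n : 'I_m => csum (fun j : 'I_N => csum (fun j' : 'I_N =>
      al c j * al' b j' * (cross_arg c b j j' ^ n.+1 / RtoC (INR n.+1)))))%C); last first.
      move=> n; rewrite -csumMr; apply: eq_csum => j; rewrite -csumMr; apply: eq_csum => j'.
      by rewrite /Cdiv; ring.
    rewrite csum_exchange; apply: eq_csum => j; rewrite csum_exchange; apply: eq_csum => j'.
    by rewrite csumMl.
  rewrite hm.
    apply: eq_csum => k; apply: eq_csum => l; rewrite h ?h' ?ltn_ord; try by have := ltn_ord k; have := ltn_ord l; lia.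
    rewrite -!pred_Sn.
    rewrite /gcoef; case: eqP => // _.
    rewrite -[(_ ^ (k.+1 + l.+1))%C]/((w c - w b) ^ (k.+1 + l.+1)%coq_nat)%C Cpow_add_r.
    have -> : (- sq c = - (1) * sq c)%C by ring.
    rewrite /Cdiv !Cpow_mult_l !Cpow_inv //.
    have z1 := Cpow_nz _ k.+1 nz; have z2 := Cpow_nz _ l.+1 nz.
    move: z1 z2; move: ((w c - w b) ^ k.+1)%C ((w c - w b) ^ l.+1)%C => x y hx hy.
    by rewrite !andbT !ltn0Sn; field.
  move=> k hk; rewrite h ?h'; try lia.
  by rewrite !ifF //; lia.
rewrite (eq_csum (G := fun j : 'I_N => (csum (fun j' : 'I_N =>
    sg c j * sgc b j' * log_poly m (cross_arg c b j j')) + csum (fun j' : 'I_N =>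
    sgc c j * sg b j' * log_poly m (cross_arg c b j j')))%C)); last first.
  by move=> j; rewrite -csumD; apply: eq_csum => j'; ring.
rewrite csumD (red sg sgc s q) ?(red sgc sg q s); try exact: sg_moment; try exact: sgc_moment.
rewrite -csumD; apply: eq_csum => k; rewrite -csumD; apply: eq_csum => l; ring.
Qed.

(** Within one circle the kernel is a function of z conj z', hence diagonal in the characters z^n:
    the energy is a weighted sum of squares of moments. *)
Lemma self_block c (t : R) :
  csum (fun j : 'I_N => csum (fun j' : 'I_N =>
    (sg c j * sgc c j' + sgc c j * sg c j') *
    log_poly m (RtoC t * (root N j * Cconj (root N j')))))%C =
  RtoC (rsum (fun k : 'I_K => t ^ k.+1 / INR k.+1 *
    (Cmod (s c k) ^ 2 + Cmod (q c k) ^ 2))).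
Proof.
transitivity (csum (fun n : 'I_m => RtoC (t ^ n.+1 / INR n.+1) *
  (csum (fun j : 'I_N => sg c j * root N j ^ n.+1) *
     Cconj (csum (fun j : 'I_N => sg c j * root N j ^ n.+1)) +
   csum (fun j : 'I_N => sgc c j * root N j ^ n.+1) *
     Cconj (csum (fun j : 'I_N => sgc c j * root N j ^ n.+1))))%C).
  symmetry.
  rewrite (eq_csum (G := fun n : 'I_m => csum (fun j : 'I_N => csum (fun j' : 'I_N =>
    (sg c j * sgc c j' + sgc c j * sg c j') *
     ((RtoC t * (root N j * Cconj (root N j'))) ^ n.+1 / RtoC (INR n.+1)))))%C); last first.
    move=> n; rewrite !conj_csum -!csumMr -csumD -csumMl; apply: eq_csum => j.
    rewrite -!csumMl -csumD -csumMl; apply: eq_csum => j'.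
    rewrite (Cmult_conj (sg c j')) (Cmult_conj (sgc c j')) sg_conj sgc_conj !Cpow_conj !Cpow_mult_l RtoC_div; last exact: not_0_INR.
    by rewrite RtoC_pow /Cdiv; ring.
  rewrite csum_exchange; apply: eq_csum => j; rewrite csum_exchange; apply: eq_csum => j'.
  by rewrite csumMl.
rewrite -csum_RtoC.
pose F n := (RtoC (t ^ n.+1 / INR n.+1) * (if (n < K)%nat then
   RtoC (Cmod (s c n) ^ 2 + Cmod (q c n) ^ 2) else RtoC 0))%C.
transitivity (csum (fun n : 'I_m => F n)).
  apply: eq_csum => n; have hn := ltn_ord n; rewrite sg_moment ?sgc_moment //.
  rewrite /F /=; case: ifP => h; congr Cmult.
    by rewrite -!Cmod2_conj RtoC_plus.
  ring.
rewrite (csum_widen (m := K) (F := F)); last first.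
- by move=> i hi; rewrite /F ltnNge hi /=; ring.
- lia.
by apply: eq_csum => k; rewrite /F ltn_ord RtoC_mult.
Qed.

End Grunsky.

Lemma fin_pos_lower (T : finType) (f : T -> R) :
  (forall c, 0 < f c) -> exists2 d, 0 < d & forall c, d <= f c.
Proof.
move=> h.
have [d d0 hd] : exists2 d, 0 < d & forall c, c \in enum T -> d <= f c.
  elim: (enum T) => [|a s [d d0 IH]]; first by exists 1 => //; lra.
  exists (Rmin d (f a)); first by apply: Rmin_glb_lt.
  move=> c; rewrite in_cons => /orP[/eqP ->|/IH hc]; first exact: Rmin_r.
  exact: Rle_trans (Rmin_l _ _) hc.
by exists d => // c; apply: hd; rewrite mem_enum.
Qed.

(** The smaller root of t + 1/t = 2 + a. For z, z' on the unit circle it gives a + |z - z'|^2 = |1 -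
    t z conj z'|^2 / t, so the regularization of the kernel becomes a contraction of its
    argument. *)
Definition joukowski_root (a : R) : R := (2 + a - sqrt (a ^ 2 + 4 * a)) / 2.

Lemma joukowski_rootP a : 0 < a ->
  0 < joukowski_root a < 1 /\ (1 - joukowski_root a) ^ 2 = a * joukowski_root a.
Proof.
move=> a0; rewrite /joukowski_root; set r := sqrt _.
have r0 : 0 <= r by apply: sqrt_pos.
have e : r * r = a ^ 2 + 4 * a by apply: sqrt_sqrt; nra.
have h1 : r < 2 + a by nra.
have h2 : a < r by nra.
split; first lra.
have -> : (1 - (2 + a - r) / 2) ^ 2 = (a ^ 2 + r * r - 2 * a * r) / 4 by field.
rewrite e; field.
Qed.

Section GrunskyInequality.
Variables (T : finType) (w sq : T -> C).
Hypothesis sq0 : forall a, sq a <> RtoC 0.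
Hypothesis sep : forall a b, a <> b -> Cmod (sq a) + Cmod (sq b) < Cmod (w a - w b).
Variables (K : nat) (s q : T -> nat -> C).

Let S := rsum (fun c => rsum (fun k : 'I_K => Cmod (s c k) + Cmod (q c k))).
Let energy : R :=
  rsum (fun c => rsum (fun k : 'I_K => (Cmod (s c k) ^ 2 + Cmod (q c k) ^ 2) / INR k.+1))
  + 2 * Re (csum (fun c => csum (fun b => csum (fun k : 'I_K => csum (fun l : 'I_K =>
      gcoef w sq c b k.+1 l.+1 * (s c k * q b l))))))%C.

(** Disjointness of the discs gives |u| <= theta < 1 for the argument u of [log_poly], and keeps the
    points at distance at least d, so that eps changes the logarithm by at most eps / d^2. *)
Lemma cross_kernel eps d c b N j j' m theta : c <> b -> 0 < eps -> 0 < d ->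
  d <= Cmod (w c - w b) - Cmod (sq c) - Cmod (sq b) ->
  theta = (Cmod (sq c) + Cmod (sq b)) / Cmod (w c - w b) ->
  Rabs (- ln (eps + Cmod (w c + sq c * root N j - (w b + sq b * root N j')) ^ 2)
    - (- ln (Cmod (w c - w b) ^ 2) + 2 * Re (log_poly m (cross_arg w sq N c b j j'))))
  <= eps / d ^ 2 + 2 * (theta ^ m.+1 / (1 - theta)).
Proof.
move=> cb e0 d0 hd ht; set u := cross_arg _ _ _ _ _ _ _.
have nz : (w c - w b)%C <> RtoC 0 by exact: (w_neq sep cb).
set W := (w c - w b)%C in nz hd ht *.
have W0 : 0 < Cmod W by apply/Cmod_gt_0.
have rc := Cmod_ge_0 (sq c); have rb := Cmod_ge_0 (sq b).
have ht1 : theta < 1.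
  by rewrite ht; apply/Rlt_div_l => //; lra.
have hu : Cmod u <= theta.
  rewrite /u /cross_arg -/W ht.
  have -> : (- sq c / W * root N j + sq b / W * root N j' =
     (- sq c * root N j + sq b * root N j') / W)%C by field.
  rewrite Cmod_div //; apply: Rmult_le_compat_r.
    by apply: Rlt_le; apply: Rinv_0_lt_compat.
  apply: Rle_trans (Cmod_triangle _ _) _.
  by rewrite !Cmod_mult Cmod_opp !Cmod_root; lra.
have e1 : (w c + sq c * root N j - (w b + sq b * root N j') = W * (1 - u))%C.
  by rewrite /u /cross_arg /W; field.
rewrite e1 Cmod_mult.
have h1 : d <= Cmod W * Cmod (1 - u).
  have := Cmod_sub_ge 1 u; rewrite Cmod_1 => h2.
  have : Cmod W * (1 - theta) <= Cmod W * Cmod (1 - u).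
    by apply: Rmult_le_compat_l; lra.
  rewrite ht; have -> : Cmod W * (1 - (Cmod (sq c) + Cmod (sq b)) / Cmod W) =
    Cmod W - Cmod (sq c) - Cmod (sq b) by field; lra.
  lra.
have v0 : 0 < Cmod (1 - u) by nra.
have := @log_taylor u theta m hu ht1; rewrite -/(log_poly m u).
have -> : (Cmod W * Cmod (1 - u)) ^ 2 = Cmod W ^ 2 * Cmod (1 - u) ^ 2 by ring.
have p1 : 0 < Cmod W ^ 2 by apply: pow_lt.
have p2 : 0 < Cmod (1 - u) ^ 2 by apply: pow_lt.
have hp : d ^ 2 <= Cmod W ^ 2 * Cmod (1 - u) ^ 2.
  by rewrite -Rpow_mult_distr; apply: pow_incr; lra.
have hp0 : 0 < d ^ 2 by apply: pow_lt.
have l1 : 0 <= ln (eps + Cmod W ^ 2 * Cmod (1 - u) ^ 2) -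
   (ln (Cmod W ^ 2) + ln (Cmod (1 - u) ^ 2)) <= eps / d ^ 2.
  rewrite -ln_mult //; set X := Cmod W ^ 2 * _ in hp *.
  have X0 : 0 < X by lra.
  split; first by have := ln_le X (eps + X) X0 ltac:(lra); lra.
  rewrite -ln_div; try lra.
  have -> : (eps + X) / X = 1 + eps / X by field; lra.
  have hx : eps / X <= eps / d ^ 2.
    by apply: Rmult_le_compat_l; [lra | apply: Rinv_le_contravar].
  have hx0 : 0 < eps / X by apply: Rdiv_lt_0_compat.
  have := exp_ineq1 (eps / X) ltac:(lra) => hx1.
  have := ln_le (1 + eps / X) (exp (eps / X)) ltac:(lra) ltac:(lra).
  by rewrite ln_exp; lra.
move=> /Rabs_le_between h2; apply/Rabs_le_between.
lra.
Qed.

(** The regularized kernel equals an additive constant plus - ln |1 - t z conj z'|^2 exactly, so the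
    only error is the Taylor tail. *)
Lemma self_kernel eps c N j j' m : 0 < eps ->
  let t := joukowski_root (eps / Cmod (sq c) ^ 2) in
  Rabs (- ln (eps + Cmod (w c + sq c * root N j - (w c + sq c * root N j')) ^ 2)
    - (- ln (Cmod (sq c) ^ 2 / t) +
       2 * Re (log_poly m (RtoC t * (root N j * Cconj (root N j'))))))
  <= 2 * (t ^ m.+1 / (1 - t)).
Proof.
move=> e0 t; have r0 : 0 < Cmod (sq c) by apply/Cmod_gt_0.
have r2 : 0 < Cmod (sq c) ^ 2 by apply: pow_lt.
have [ht e] := joukowski_rootP (Rdiv_lt_0_compat _ _ e0 r2); rewrite -/t in ht e.
set v := (root N j * Cconj (root N j'))%C.
have v1 : Cmod v = 1 by rewrite Cmod_mult Cmod_conj !Cmod_root; ring.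
have hu : Cmod (RtoC t * v) <= t.
  by rewrite Cmod_mult v1 Cmod_R Rabs_pos_eq; lra.
have := @log_taylor (RtoC t * v)%C t m hu (proj2 ht); rewrite -/(log_poly m _).
have -> : (w c + sq c * root N j - (w c + sq c * root N j') =
   sq c * (root N j - root N j'))%C by ring.
have ev : Cmod (root N j - root N j') ^ 2 = 2 - 2 * Re v.
  have h1 := Cmod_root N j; have h2 := Cmod_root N j'.
  have := Cmod2_alt (root N j); have := Cmod2_alt (root N j').
  rewrite h1 h2 Cmod2_alt /v; case: (root N j) => a b; case: (root N j') => a' b'.
  rewrite /Re /Im /=; nra.
have -> : eps + Cmod (sq c * (root N j - root N j')) ^ 2 =
   Cmod (sq c) ^ 2 / t * Cmod (1 - RtoC t * v) ^ 2.
  rewrite Cmod_mult Rpow_mult_distr ev Cmod_one_sub v1.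
  have -> : 1 - 2 * t * Re v + t ^ 2 * 1 ^ 2 = (1 - t) ^ 2 + t * (2 - 2 * Re v) by ring.
  by rewrite e; field; lra.
rewrite ln_mult.
- by move=> /Rabs_le_between h; apply/Rabs_le_between; lra.
- by apply: Rdiv_lt_0_compat; lra.
apply: pow_lt; have := Cmod_sub_ge 1 (RtoC t * v); rewrite Cmod_1; lra.
Qed.

(** The inequality [log_energy_real] is applied to the real and to the imaginary part of the charge,
    with the kernel replaced by a constant for each pair of circles plus a truncated logarithm.
    Every error is at most delta times a bound depending on the total mass [S] only. *)
Lemma grunsky_energy : 0 <= energy.
Proof.
suff h delta : 0 < delta -> - (2 * S ^ 2) * delta <= energy.
  apply: Rnot_lt_le => hneg; have S2 := pow2_ge_0 S.
  have hd : 0 < - energy / (2 * (2 * S ^ 2 + 1)) by apply: Rdiv_lt_0_compat; lra.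
  have := h _ hd; set d := _ / _ => h1.
  have e : d * (2 * (2 * S ^ 2 + 1)) = - energy by rewrite /d; field; lra.
  by nra.
move=> hdelta.
pose gap (cb : T * T) := if cb.1 == cb.2 then 1 else
  Cmod (w cb.1 - w cb.2) - Cmod (sq cb.1) - Cmod (sq cb.2).
have gap0 cb : 0 < gap cb.
  by rewrite /gap; case: eqP => [_|/sep]; lra.
have [d d0 hd] := fin_pos_lower gap0.
(* Half of delta pays for eps / d^2 between different circles, the other half for the Taylor
   tails. *)
pose eps := Rmin (/ 2) (delta / 2 * d ^ 2).
have d2 : 0 < d ^ 2 by apply: pow_lt.
have eps0 : 0 < eps by apply: Rmin_glb_lt; nra.
have eps1 : eps < 1 by apply: Rle_lt_trans (Rmin_l _ _) _; lra.
have epsd : eps / d ^ 2 <= delta / 2.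
  apply: (Rmult_le_reg_r (d ^ 2)) => //.
  rewrite (_ : eps / d ^ 2 * d ^ 2 = eps); first exact: Rmin_r.
  by field; lra.
pose tt c := joukowski_root (eps / Cmod (sq c) ^ 2).
have htt c : 0 < tt c < 1.
  by apply: (proj1 (joukowski_rootP _)); apply: Rdiv_lt_0_compat => //;
     apply: pow_lt; apply/Cmod_gt_0.
pose theta (cb : T * T) := if cb.1 == cb.2 then tt cb.1 else
  (Cmod (sq cb.1) + Cmod (sq cb.2)) / Cmod (w cb.1 - w cb.2).
have htheta cb : 0 <= theta cb < 1.
  rewrite /theta; case: eqP => [_|h]; first by have := htt cb.1; lra.
  have W0 : 0 < Cmod (w cb.1 - w cb.2) by apply/Cmod_gt_0; apply: (w_neq sep h).
  have := sep h; have := Cmod_ge_0 (sq cb.1); have := Cmod_ge_0 (sq cb.2) => ? ? ?.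
  split; first by apply: Rdiv_le_0_compat; lra.
  by apply/Rlt_div_l => //; lra.
(* The order of the choices is eps, then m, then N: the ratio [tt c] within one circle tends to 1 as
   eps tends to 0, so the degree m depends on eps. Adding K + K to m makes room for all products of
   two moments of order up to K. *)
have [m0 hm0] := eventually_fin (fun cb => geo_small
  (2 * theta cb / (1 - theta cb)) (htheta cb) (ltac:(lra) : 0 < delta / 2)).
pose m := (m0 + (K + K))%nat; pose N := (m + K).+1.
have Km : (K + K <= m)%nat by rewrite leq_addl.
have mN : (m + K < N)%nat by [].
have tail cb : 2 * (theta cb ^ m.+1 / (1 - theta cb)) <= delta / 2.
  have := hm0 m ltac:(lia) cb; have := htheta cb => h1.
  have -> : 2 * theta cb / (1 - theta cb) * theta cb ^ m =
     2 * (theta cb ^ m.+1 / (1 - theta cb)) by rewrite /=; field; lra.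
  by [].
pose pt (i : T * 'I_N) : C := (w i.1 + sq i.1 * root N i.2)%C.
pose ch (i : T * 'I_N) : C := sg K s q N i.1 i.2.
pose chc (i : T * 'I_N) : C := sgc K s q N i.1 i.2.
have chE i : chc i = Cconj (ch i) by rewrite /ch (sg_conj s q Km mN).
pose uu (i j : T * 'I_N) : C := if i.1 == j.1
  then (RtoC (tt i.1) * (root N i.2 * Cconj (root N j.2)))%C
  else cross_arg w sq N i.1 j.1 i.2 j.2.
pose cst (c b : T) : R := if c == b then - ln (Cmod (sq c) ^ 2 / tt c)
  else - ln (Cmod (w c - w b) ^ 2).
pose kt i j := 2 * Re (log_poly m (uu i j)).
have approx i j : Rabs (- ln (eps + Cmod (pt i - pt j) ^ 2) - (cst i.1 j.1 + kt i j)) <= delta.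
  rewrite /kt /uu /cst /pt; case: i => c j1; case: j => b j2 /=.
  case: eqP => [<-|cb].
    apply: Rle_trans (self_kernel c N j1 j2 m eps0) _.
    have th : theta (c, c) = tt c by rewrite /theta eqxx.
    by have := tail (c, c); rewrite th -/(tt c); lra.
  have hdd : d <= Cmod (w c - w b) - Cmod (sq c) - Cmod (sq b).
    by have := hd (c, b); rewrite /gap /=; case: eqP.
  apply: Rle_trans (cross_kernel N j1 j2 m cb eps0 d0 hdd erefl) _.
  have th : theta (c, b) = (Cmod (sq c) + Cmod (sq b)) / Cmod (w c - w b).
    by rewrite /theta /= (negbTE (introN eqP cb)).
  by have := tail (c, b); rewrite th; lra.
have neutral c : csum (fun j : 'I_N => ch (c, j)) = RtoC 0.
  have := sg_moment s q Km mN c (leq0n m) => /= <-.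
  by apply: eq_csum => j; rewrite Cmult_1_r.
have bound (f : T * 'I_N -> R) : (forall i, Rabs (f i) <= Cmod (ch i)) ->
    (forall c, rsum (fun j : 'I_N => f (c, j)) = 0) -> - (S ^ 2) * delta <= qform kt f.
  move=> hf hf0.
  have tot : rsum f = 0.
    by rewrite rsum_pair (eq_rsum (G := fun=> 0)) ?rsum_const0.
  have SS : rsum (fun i => Rabs (f i)) <= S.
    apply: Rle_trans (rsum_le hf) _; rewrite rsum_pair; apply: rsum_le => c.
    rewrite /ch /=; apply: Rle_trans (charge_abs K (s c) (cconj_fun (q c)) _) _ => //.
    by apply: rsum_le => k; rewrite /cconj_fun Cmod_conj; lra.
  have SS0 : 0 <= rsum (fun i => Rabs (f i)) by apply: rsum_ge0 => i; apply: Rabs_pos.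
  have h1 := log_energy_real pt (conj eps0 eps1) tot.
  have h2 := @qform_approx _ (fun i j => cst i.1 j.1 + kt i j)
     (fun i j => - ln (eps + Cmod (pt i - pt j) ^ 2)) f delta.
  have {}h2 := h2 (fun i j => eq_ind_r (fun x => x <= delta) (approx i j)
    (Rabs_minus_sym _ _)).
  rewrite qformD in h2.
  (* Every single circle carries total charge zero, so a kernel that depends only on the two circles
     contributes nothing. *)
  have h3 : qform (fun i j : T * 'I_N => cst i.1 j.1) f = 0.
    rewrite /qform rsum_pair (eq_rsum (G := fun=> 0)) ?rsum_const0 // => c.
    rewrite (eq_rsum (G := fun j : 'I_N => f (c, j) *
      rsum (fun b => cst c b * rsum (fun j' : 'I_N => f (b, j'))))).
      by rewrite rsumMr hf0 Rmult_0_l.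
    move=> j; rewrite rsum_pair -rsumMl; apply: eq_rsum => b; rewrite -!rsumMl.
    by apply: eq_rsum => j' /=; ring.
  have h4 : qform (fun i j => - ln (eps + Cmod (pt i - pt j) ^ 2)) f =
    - qform (fun i j => ln (eps + Cmod (pt i - pt j) ^ 2)) f.
    rewrite (eq_qform (K' := fun i j => (-1) * ln (eps + Cmod (pt i - pt j) ^ 2))).
      by rewrite qformZ; ring.
    by move=> i j; ring.
  rewrite h3 h4 in h2.
  have : rsum (fun i => Rabs (f i)) ^ 2 <= S ^ 2 by apply: pow_incr.
  nra.
have b1 := bound (fun i => Re (ch i)) (fun i => re_le_Cmod _).
have {}b1 := b1 (fun c => eq_trans (esym (Re_csum _)) (f_equal Re (neutral c))).
have im_le i : Rabs (Im (ch i)) <= Cmod (ch i).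
  by apply: Rle_trans (Rmax_Cmod _); apply: Rmax_r.
have Im_csum (F : 'I_N -> C) : Im (csum F) = rsum (fun i => Im (F i)).
  exact: (big_morph Im).
have b2 := bound (fun i => Im (ch i)) im_le.
have {}b2 := b2 (fun c => eq_trans (esym (Im_csum _)) (f_equal Im (neutral c))).
(* [ch i * chc j + chc i * ch j] is real: it is twice the sum of the product of the real parts and
   the product of the imaginary parts. *)
have e1 : qform kt (fun i => Re (ch i)) + qform kt (fun i => Im (ch i)) =
  Re (csum (fun i => csum (fun j => (ch i * chc j + chc i * ch j) * log_poly m (uu i j))%C)).
  rewrite Re_csum /qform -rsumD; apply: eq_rsum => i.
  rewrite Re_csum -rsumD; apply: eq_rsum => j; rewrite !chE /kt.
  case: (ch i) => a b; case: (ch j) => a' b'; case: (log_poly m (uu i j)) => p p'.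
  by rewrite /Re /Im /=; ring.
have e2 : csum (fun i => csum (fun j => (ch i * chc j + chc i * ch j) * log_poly m (uu i j)))%C =
  csum (fun c => RtoC (rsum (fun k : 'I_K => tt c ^ k.+1 / INR k.+1 *
    (Cmod (s c k) ^ 2 + Cmod (q c k) ^ 2))%R) +
    csum (fun b => csum (fun k : 'I_K => csum (fun l : 'I_K =>
      gcoef w sq c b k.+1 l.+1 * (s c k * q b l + q c k * s b l)))))%C.
  rewrite csum_pair; apply: eq_csum => c.
  rewrite (eq_csum (G := fun j : 'I_N => csum (fun b => csum (fun j' : 'I_N =>
    (ch (c, j) * chc (b, j') + chc (c, j) * ch (b, j')) * log_poly m (uu (c, j) (b, j'))))))%C;
    last by move=> j; rewrite csum_pair.
  rewrite csum_exchange {1}/csum (bigD1 c) //=; congr Cplus.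
    rewrite -(self_block s q Km mN); apply: eq_csum => j; apply: eq_csum => j'.
    by rewrite /uu /= eqxx.
  rewrite [RHS]/csum [RHS](bigD1 c) //=.
  rewrite [X in _ = (X + _)%C](_ : _ = RtoC 0) ?Cplus_0_l.
    apply: eq_bigr => b /eqP cb; have cb' : c <> b by move=> e; apply: cb.
    rewrite -(cross_block sep s q Km mN cb').
    apply: eq_csum => j; apply: eq_csum => j'.
    by rewrite /uu /=; case: eqP.
  rewrite (eq_csum (G := fun=> RtoC 0)) ?csum0 // => k.
  rewrite (eq_csum (G := fun=> RtoC 0)) ?csum0 // => l.
  by rewrite /gcoef eqxx; ring.
rewrite e2 csumD csum_RtoC re_plus in e1.
have e3 : Re (csum (fun c => csum (fun b => csum (fun k : 'I_K => csum (fun l : 'I_K =>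
      gcoef w sq c b k.+1 l.+1 * (s c k * q b l + q c k * s b l))))))%C =
   2 * Re (csum (fun c => csum (fun b => csum (fun k : 'I_K => csum (fun l : 'I_K =>
      gcoef w sq c b k.+1 l.+1 * (s c k * q b l))))))%C.
  set X := (X in Re X = _); set Y := (X in 2 * Re X).
  have -> : X = (Y + Y)%C; last by rewrite re_plus; ring.
  have {2}-> : Y = csum (fun c => csum (fun b => csum (fun k : 'I_K => csum (fun l : 'I_K =>
      gcoef w sq c b k.+1 l.+1 * (q c k * s b l)))))%C.
    rewrite /Y csum_exchange; apply: eq_csum => c; apply: eq_csum => b.
    rewrite csum_exchange; apply: eq_csum => k; apply: eq_csum => l.
    by rewrite (gcoef_sym sep); ring.
  rewrite /X /Y; do 2 (rewrite -csumD; apply: eq_csum => ?).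
  do 2 (rewrite -csumD; apply: eq_csum => ?); ring.
rewrite e3 in e1.
(* The diagonal terms are nonnegative, so the factors t^k left by the regularization may be replaced
   by 1; no limit in eps is taken. *)
have e4 : rsum (fun c => rsum (fun k : 'I_K => tt c ^ k.+1 / INR k.+1 *
    (Cmod (s c k) ^ 2 + Cmod (q c k) ^ 2))) <=
  rsum (fun c => rsum (fun k : 'I_K => (Cmod (s c k) ^ 2 + Cmod (q c k) ^ 2) / INR k.+1)).
  apply: rsum_le => c; apply: rsum_le => k; rewrite /Rdiv.
  have hk : 0 < / INR k.+1 by apply: Rinv_0_lt_compat; apply: lt_0_INR; lia.
  have ht : tt c ^ k.+1 <= 1 by rewrite -(pow1 k.+1); apply: pow_incr; have := htt c; lra.
  have h1 := pow2_ge_0 (Cmod (s c k)); have h2 := pow2_ge_0 (Cmod (q c k)).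
  set x := _ ^ 2 + _; have hx : 0 <= x / INR k.+1 by apply: Rmult_le_pos; rewrite /x; lra.
  by rewrite /Rdiv in hx; nra.
have Re_RtoC x : Re (RtoC x) = x by [].
rewrite Re_RtoC in e1; rewrite /energy.
apply: Rle_trans (Rle_trans _ _ _ _ (Rplus_le_compat _ _ _ _ b1 b2)) _; first lra.
by apply: Rle_trans (Req_le _ _ e1) _; lra.
Qed.

End GrunskyInequality.

(** * Geometrically convergent series *)

Lemma Cmod_le_abs (z : C) : Cmod z <= Rabs (Re z) + Rabs (Im z).
Proof.
have h1 := Rabs_pos (Re z); have h2 := Rabs_pos (Im z).
apply: Rsqr_incr_0_var; last lra.
have := Cmod2_alt z; rewrite /Rsqr -(pow2_abs (Re z)) -(pow2_abs (Im z)); nra.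
Qed.

Lemma im_le_Cmod (z : C) : Rabs (Im z) <= Cmod z.
Proof. by apply: Rle_trans (Rmax_Cmod _); apply: Rmax_r. Qed.

Lemma Im_csum (T : finType) (F : T -> C) : Im (csum F) = rsum (fun i => Im (F i)).
Proof. exact: (big_morph Im). Qed.

Lemma rsum_geo_le theta N : 0 <= theta < 1 ->
  rsum (fun n : 'I_N => theta ^ n) <= / (1 - theta).
Proof.
move=> ht; have e : rsum (fun n : 'I_N => theta ^ n) * (1 - theta) = 1 - theta ^ N.
  elim: N => [|N IH]; first by rewrite rsum_ord0 /=; ring.
  by rewrite (rsumS N (fun n => theta ^ n)) Rmult_plus_distr_r IH /=; ring.
apply: (Rmult_le_reg_r (1 - theta)); first lra.
rewrite e Rinv_l; last lra.
have : 0 <= theta ^ N by apply: pow_le; lra.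
lra.
Qed.

Lemma Series_tail (f : nat -> R) theta c N : 0 <= theta < 1 ->
  (forall n, Rabs (f n) <= c * theta ^ n) ->
  Rabs (Series f - rsum (fun n : 'I_N => f n)) <= c * (theta ^ N / (1 - theta)).
Proof.
move=> ht h.
have gs : ex_series (fun n => c * theta ^ n).
  by apply: ex_series_scal_l; apply: ex_series_geom; rewrite Rabs_pos_eq; lra.
have exs : ex_series f by apply: (ex_series_le (V := R_CompleteNormedModule)) gs => n; apply: h.
case: N => [|N].
  rewrite rsum_ord0 Rminus_0_r; apply: Rle_trans (Series_Rabs _ _) _.
    by apply: (ex_series_le (V := R_CompleteNormedModule)) gs => n; rewrite /norm /= /abs /= Rabs_Rabsolu; apply: h.
  apply: Rle_trans (Series_le _ (fun n => c * theta ^ n) _ gs) _.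
    by move=> n; split; [apply: Rabs_pos | apply: h].
  by rewrite Series_scal_l Series_geom ?Rabs_pos_eq; lra.
rewrite (Series_incr_n f N.+1) //; last lia.
rewrite (_ : sum_f_R0 f (Nat.pred N.+1) = rsum (fun n : 'I_N.+1 => f n)); last first.
  by rewrite -sum_n_Reals sum_n_rsum.
rewrite (_ : forall x y, x + y - x = y); last by move=> *; ring.
have gs' : ex_series (fun n => c * theta ^ N.+1 * theta ^ n).
  by apply: ex_series_scal_l; apply: ex_series_geom; rewrite Rabs_pos_eq; lra.
have h' n : Rabs (f (N.+1 + n)%coq_nat) <= c * theta ^ N.+1 * theta ^ n.
  by have := h (N.+1 + n)%coq_nat; rewrite pow_add Rmult_assoc.
apply: Rle_trans (Series_Rabs _ _) _.
  by apply: (ex_series_le (V := R_CompleteNormedModule)) gs' => n; rewrite /norm /= /abs /= Rabs_Rabsolu; apply: h'.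
apply: Rle_trans (Series_le _ (fun n => c * theta ^ N.+1 * theta ^ n) _ gs') _.
  by move=> n; split; [apply: Rabs_pos | apply: h'].
by rewrite Series_scal_l Series_geom ?Rabs_pos_eq; lra.
Qed.

(** A total function; it is the sum of the series as soon as a bound [geo] with ratio below 1
    holds. *)
Definition cser (f : nat -> C) : C :=
  (Series (fun n => Re (f n)), Series (fun n => Im (f n))).

Definition geo (theta c : R) (f : nat -> C) : Prop :=
  forall n, Cmod (f n) <= c * theta ^ n.

Lemma cser_tail theta c f N : 0 <= theta < 1 -> geo theta c f ->
  Cmod (cser f - csum (fun n : 'I_N => f n)) <= 2 * c * (theta ^ N / (1 - theta)).
Proof.
move=> ht h; apply: Rle_trans (Cmod_le_abs _) _.
have -> : 2 * c * (theta ^ N / (1 - theta)) =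
  c * (theta ^ N / (1 - theta)) + c * (theta ^ N / (1 - theta)) by ring.
apply: Rplus_le_compat.
  rewrite Re_minus Re_csum; apply: (Series_tail (f := fun n => Re (f n))) => // n.
  exact: Rle_trans (re_le_Cmod _) (h n).
rewrite (_ : Im (_ - _)%C = Im (cser f) - Im (csum (fun n : 'I_N => f n))) // Im_csum.
apply: (Series_tail (f := fun n => Im (f n))) => // n.
exact: Rle_trans (im_le_Cmod _) (h n).
Qed.

Lemma eq_of_geo theta c x y : 0 <= theta < 1 ->
  (forall N : nat, Cmod (x - y) <= c * theta ^ N) -> x = y.
Proof.
move=> ht h; have e : Cmod (x - y) <= 0.
  apply: Rnot_lt_le => h0.
  have [N hN] := geo_small c ht (ltac:(lra) : 0 < Cmod (x - y) / 2).
  by have := hN N (le_n N); have := h N; lra.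
have e' : (x - y)%C = RtoC 0.
  by apply: Cmod_eq_0; apply: Rle_antisym => //; apply: Cmod_ge_0.
by have -> : x = (x - y + y)%C by [ring]; rewrite e' Cplus_0_l.
Qed.

(* The constants absorb the first few terms, so a bound by some [c * theta ^ N]
   for all [N] identifies the sum. *)
Lemma cser_unique theta c c' f s : 0 <= theta < 1 -> geo theta c f ->
  (forall N, Cmod (csum (fun n : 'I_N => f n) - s) <= c' * theta ^ N) ->
  cser f = s.
Proof.
move=> ht hf hs; apply: (@eq_of_geo theta (2 * c / (1 - theta) + c')) => // N.
have -> : (cser f - s = (cser f - csum (fun n : 'I_N => f n)) +
   (csum (fun n : 'I_N => f n) - s))%C by ring.
apply: Rle_trans (Cmod_triangle _ _) _.
have := cser_tail N ht hf; have := hs N.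
have -> : 2 * c * (theta ^ N / (1 - theta)) = 2 * c / (1 - theta) * theta ^ N.
  by field; lra.
lra.
Qed.

Lemma geo_ge0 theta c f : geo theta c f -> 0 <= c.
Proof. by move=> h; have := h 0%nat; rewrite /= Rmult_1_r; apply: Rle_trans (Cmod_ge_0 _). Qed.

Lemma cser_bound theta c f : 0 <= theta < 1 -> geo theta c f ->
  Cmod (cser f) <= 2 * c / (1 - theta).
Proof.
move=> ht h; have := cser_tail 0 ht h; rewrite csum_ord0 /=.
have -> : (cser f - 0 = cser f)%C by ring.
by move=> h'; apply: Rle_trans h' _; apply: Req_le; field; lra.
Qed.

Lemma eq_cser f f' : (forall n, f n = f' n) -> cser f = cser f'.
Proof.
by move=> h; rewrite /cser; congr pair; apply: Series_ext => n; rewrite h.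
Qed.

Lemma geoD theta c c' f f' : geo theta c f -> geo theta c' f' ->
  geo theta (c + c') (fun n => f n + f' n)%C.
Proof.
move=> h h' n; apply: Rle_trans (Cmod_triangle _ _) _.
by have := h n; have := h' n; lra.
Qed.

Lemma geoZ theta c x f : geo theta c f -> geo theta (Cmod x * c) (fun n => x * f n)%C.
Proof.
move=> h n; rewrite Cmod_mult Rmult_assoc.
by apply: Rmult_le_compat_l; [apply: Cmod_ge_0 | apply: h].
Qed.

Lemma geo_csum (T : finType) theta (c : T -> R) (f : T -> nat -> C) :
  (forall a, geo theta (c a) (f a)) ->
  geo theta (rsum c) (fun n => csum (fun a => f a n)).
Proof.
move=> h n; apply: Rle_trans (Cmod_csum _) _; rewrite -rsumMr.
by apply: rsum_le => a; apply: h.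
Qed.

Lemma cser_csum (T : finType) theta c (f : T -> nat -> C) : 0 <= theta < 1 ->
  (forall a, geo theta c (f a)) ->
  cser (fun n => csum (fun a => f a n)) = csum (fun a => cser (f a)).
Proof.
move=> ht h; apply: (@cser_unique theta _
    (rsum (fun _ : T => 2 * c / (1 - theta))) _ _ ht).
  exact: (geo_csum (c := fun=> c) h).
move=> N; rewrite csum_exchange -csumB.
apply: Rle_trans (Cmod_csum _) _; rewrite -rsumMr; apply: rsum_le => a.
have := cser_tail N ht (h a).
rewrite -Cmod_opp => h1; have -> : (csum (fun i : 'I_N => f a i) - cser (f a) =
   - (cser (f a) - csum (fun i : 'I_N => f a i)))%C by ring.
by apply: Rle_trans h1 _; apply: Req_le; field; lra.
Qed.

Lemma cserZ theta c x f : 0 <= theta < 1 -> geo theta c f ->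
  cser (fun n => x * f n)%C = (x * cser f)%C.
Proof.
move=> ht h; apply: (@cser_unique theta _ (Cmod x * (2 * c / (1 - theta))) _ _ ht (geoZ x h)).
move=> N; rewrite csumMl.
have -> : (x * csum (fun i : 'I_N => f i) - x * cser f =
  - (x * (cser f - csum (fun i : 'I_N => f i))))%C by ring.
rewrite Cmod_opp Cmod_mult Rmult_assoc; apply: Rmult_le_compat_l; first exact: Cmod_ge_0.
by apply: Rle_trans (cser_tail N ht h) _; apply: Req_le; field; lra.
Qed.

Lemma cserD theta c c' f f' : 0 <= theta < 1 -> geo theta c f -> geo theta c' f' ->
  cser (fun n => f n + f' n)%C = (cser f + cser f')%C.
Proof.
move=> ht h h'; apply: (@cser_unique theta _ (2 * (c + c') / (1 - theta)) _ _ ht (geoD h h')).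
move=> N; rewrite csumD.
have -> : (csum (fun i : 'I_N => f i) + csum (fun i : 'I_N => f' i) - (cser f + cser f') =
  - ((cser f - csum (fun i : 'I_N => f i)) + (cser f' - csum (fun i : 'I_N => f' i))))%C by ring.
rewrite Cmod_opp; apply: Rle_trans (Cmod_triangle _ _) _.
have := cser_tail N ht h; have := cser_tail N ht h' => h1 h2.
have -> : 2 * (c + c') / (1 - theta) * theta ^ N = 2 * c * (theta ^ N / (1 - theta)) +
  2 * c' * (theta ^ N / (1 - theta)) by field; lra.
lra.
Qed.

Lemma cser_recl theta c f : 0 <= theta < 1 -> geo theta c f ->
  cser f = (f 0%nat + cser (fun n => f n.+1))%C.
Proof.
move=> ht h; have c0 := geo_ge0 h.
have hs : geo theta c (fun n => f n.+1).
  move=> n; apply: Rle_trans (h n.+1) _; rewrite /=.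
  have : 0 <= theta ^ n by apply: pow_le; lra.
  by move=> h0; apply: Rmult_le_compat_l => //; nra.
have key : cser (fun n => f n.+1) = (cser f - f 0%nat)%C.
  apply: (@cser_unique theta _ (2 * c / (1 - theta)) _ _ ht hs) => N.
  have := cser_tail N.+1 ht h; rewrite csum_recl -Cmod_opp => h1.
  have -> : (csum (fun n : 'I_N => f n.+1) - (cser f - f 0%nat) =
    - (cser f - (f 0%nat + csum (fun i : 'I_N => f i.+1))))%C by ring.
  apply: Rle_trans h1 _.
  have -> : 2 * c * (theta ^ N.+1 / (1 - theta)) = theta * (2 * c / (1 - theta) * theta ^ N).
    by rewrite /=; field; lra.
  have h2 : 0 <= 2 * c / (1 - theta) * theta ^ N.
    apply: Rmult_le_pos; last by apply: pow_le; lra.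
    by apply: Rdiv_le_0_compat; lra.
  nra.
by rewrite key; ring.
Qed.

Lemma Csub_split (x y z : C) : (x - z = (x - y) + (y - z))%C.
Proof. by ring. Qed.

(** Both iterated sums differ from the finite sum over the N by N square by O(theta^N). *)
Lemma cser_fubini theta c (f : nat -> nat -> C) : 0 <= theta < 1 ->
  (forall n m, Cmod (f n m) <= c * theta ^ n * theta ^ m) ->
  cser (fun n => cser (f n)) = cser (fun m => cser (fun n => f n m)).
Proof.
move=> ht h.
have main (F : nat -> nat -> C) : (forall n m, Cmod (F n m) <= c * theta ^ n * theta ^ m) ->
  forall N, Cmod (cser (fun n => cser (F n)) -
     csum (fun n : 'I_N => csum (fun m : 'I_N => F n m))) <=
   (2 * (2 * c / (1 - theta)) / (1 - theta) + 2 * c / (1 - theta) / (1 - theta)) * theta ^ N.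
  move=> hF N.
  have hr n : geo theta (c * theta ^ n) (F n) by move=> m; apply: hF.
  have hg : geo theta (2 * c / (1 - theta)) (fun n => cser (F n)).
    move=> n; apply: Rle_trans (cser_bound ht (hr n)) _; apply: Req_le; field; lra.
  rewrite (Csub_split _ (csum (fun n : 'I_N => cser (F n)))) -csumB.
  apply: Rle_trans (Cmod_triangle _ _) _; rewrite Rmult_plus_distr_r.
  apply: Rplus_le_compat.
    by apply: Rle_trans (cser_tail N ht hg) _; apply: Req_le; field; lra.
  apply: Rle_trans (Cmod_csum _) _.
  apply: Rle_trans (rsum_le (G := fun n : 'I_N => 2 * c / (1 - theta) * theta ^ N * theta ^ n) _) _.
    by move=> n; apply: Rle_trans (cser_tail N ht (hr n)) _; apply: Req_le; field; lra.
  rewrite rsumMl; have := rsum_geo_le N ht; have c0 := geo_ge0 (hr 0%nat).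
  rewrite /= Rmult_1_r in c0 => h1.
  have -> : 2 * c / (1 - theta) / (1 - theta) * theta ^ N =
    2 * c / (1 - theta) * theta ^ N * / (1 - theta) by field; lra.
  apply: Rmult_le_compat_l => //; apply: Rmult_le_pos; last by apply: pow_le; lra.
  by apply: Rdiv_le_0_compat; lra.
set K := (2 * (2 * c / (1 - theta)) / (1 - theta) + 2 * c / (1 - theta) / (1 - theta)) in main.
apply: (@eq_of_geo theta (2 * K)) => // N.
have h1 := main f h N.
have h' m n : Cmod (f n m) <= c * theta ^ m * theta ^ n.
  by apply: Rle_trans (h n m) _; apply: Req_le; ring.
have h2 := main (fun m n => f n m) h' N.
rewrite csum_exchange in h2; rewrite -Cmod_opp in h2.
set X := cser _ in h1 *; set Y := cser _ in h2 *; set Z := csum _ in h1 h2.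
have -> : (X - Y = (X - Z) + - (Y - Z))%C by ring.
apply: Rle_trans (Cmod_triangle _ _) _; lra.
Qed.

Lemma is_series_cser theta c f : 0 <= theta < 1 -> geo theta c f ->
  is_series (K := C_AbsRing) (V := C_NormedModule) f (cser f).
Proof.
move=> ht h; apply/filterlim_locally => eps.
have [N hN] := geo_small (2 * c / (1 - theta)) ht (ltac:(case: eps => /= ? ?; lra) : 0 < eps / 2).
exists N => n hn; rewrite sum_n_csum.
apply: C_NormedModule_mixin_compat1.
have := cser_tail n.+1 ht h; rewrite -Cmod_opp => h1.
have := hN n.+1 ltac:(lia) => h2.
have -> : minus (csum (fun i : 'I_n.+1 => f i)) (cser f) =
  (- (cser f - csum (fun i : 'I_n.+1 => f i)))%C.
  by rewrite /minus /plus /opp /=; ring.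
have e : 2 * c * (theta ^ n.+1 / (1 - theta)) = 2 * c / (1 - theta) * theta ^ n.+1.
  by field; lra.
have e0 := cond_pos eps; rewrite e in h1; apply: Rle_lt_trans h1 _.
by apply: Rle_lt_trans h2 _; lra.
Qed.

Lemma ex_series_geo theta c f : 0 <= theta < 1 -> geo theta c f ->
  ex_series (fun n => Cmod (f n)).
Proof.
move=> ht h; apply: (ex_series_le (V := R_CompleteNormedModule) _ (fun n => c * theta ^ n)).
  by move=> n; rewrite /norm /= /abs /= Rabs_pos_eq; [apply: h | apply: Cmod_ge_0].
by apply: ex_series_scal_l; apply: ex_series_geom; rewrite Rabs_pos_eq; lra.
Qed.

Lemma cser_delta (f : nat -> C) n0 :
  (forall n, n <> n0 -> f n = RtoC 0) -> cser f = f n0.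
Proof.
move=> h; have hh : 0 <= / 2 < 1 by lra.
have c0 := Cmod_ge_0 (f n0).
have p n : 0 < 2 ^ n by apply: pow_lt; lra.
have hp n : 2 ^ n * (/ 2) ^ n = 1.
  by rewrite -Rpow_mult_distr Rinv_r ?pow1; lra.
have q n : 0 < (/ 2) ^ n by apply: pow_lt; lra.
(* A series with one nonzero term decays at any rate; the ratio 1/2 is arbitrary, and 2^n0
   compensates for the position of the term. *)
apply: (@cser_unique (/ 2) (Cmod (f n0) * 2 ^ n0) (Cmod (f n0) * 2 ^ n0) _ _ hh).
  move=> n; case: (Nat.eq_dec n n0) => [->|ne].
    by rewrite Rmult_assoc hp; lra.
  rewrite h // Cmod_0; apply: Rmult_le_pos; last exact: Rlt_le.
  by apply: Rmult_le_pos => //; apply: Rlt_le.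
move=> N; case: (leqP N n0) => hN.
  rewrite (eq_csum (G := fun=> RtoC 0)); last first.
    by move=> i; apply: h; have := ltn_ord i; lia.
  rewrite csum0 (_ : 0 - f n0 = - f n0)%C; last by ring.
  rewrite Cmod_opp Rmult_assoc -{1}(Rmult_1_r (Cmod (f n0))).
  apply: Rmult_le_compat_l => //.
  have -> : 2 ^ n0 = 2 ^ N * 2 ^ (n0 - N) by rewrite -pow_add; congr pow; lia.
  have -> : 2 ^ N * 2 ^ (n0 - N) * (/ 2) ^ N = 2 ^ N * (/ 2) ^ N * 2 ^ (n0 - N) by ring.
  by rewrite hp Rmult_1_l; apply: pow_R1_Rle; lra.
rewrite (csum_delta (i := Ordinal hN)).
  rewrite (_ : f _ - f n0 = 0)%C /= ?Cmod_0; last by ring.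
  by apply: Rmult_le_pos; [apply: Rmult_le_pos => // | ]; apply: Rlt_le.
by move=> j /eqP hj; apply: h => e; apply: hj; apply: val_inj.
Qed.

Section IndexSums.
Variable g : nat.
Notation LT := ('I_g * bool)%type.
Implicit Types u v : vec g.

Definition isum u : C := cser (fun n => csum (fun a : LT => u (a, n))).

Definition nletters : R := rsum (fun _ : LT => 1).

Lemma nletters_ge0 : 0 <= nletters.
Proof. by apply: rsum_ge0 => _; lra. Qed.

Lemma eq_isum u v : (forall i, u i = v i) -> isum u = isum v.
Proof. by move=> h; apply: eq_cser => n; apply: eq_csum => a. Qed.

Definition geov (theta c : R) u : Prop := forall i, Cmod (u i) <= c * theta ^ i.2.

Lemma geov_geo theta c u : geov theta c u ->
  geo theta (nletters * c) (fun n => csum (fun a : LT => u (a, n))).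
Proof.
move=> h n; apply: Rle_trans (Cmod_csum _) _.
rewrite Rmult_assoc /nletters -rsumMr; apply: rsum_le => a; rewrite Rmult_1_l.
exact: (h (a, n)).
Qed.

Lemma isum_bound theta c u : 0 <= theta < 1 -> geov theta c u ->
  Cmod (isum u) <= 2 * (nletters * c) / (1 - theta).
Proof. by move=> ht h; apply: cser_bound ht (geov_geo h). Qed.

Lemma isum_is_sum theta c u : 0 <= theta < 1 -> geov theta c u -> is_sum u (isum u).
Proof.
move=> ht h; split; last exact: is_series_cser ht (geov_geo h).
by move=> a; apply: (ex_series_geo (f := fun n => u (a, n)) ht) => n; apply: (h (a, n)).
Qed.

Lemma isumZ theta c x u : 0 <= theta < 1 -> geov theta c u ->
  isum (fun i => x * u i)%C = (x * isum u)%C.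
Proof.
move=> ht h; rewrite /isum -(cserZ _ ht (geov_geo h)).
by apply: eq_cser => n; rewrite csumMl.
Qed.

Lemma isumD theta c c' u v : 0 <= theta < 1 -> geov theta c u -> geov theta c' v ->
  isum (fun i => u i + v i)%C = (isum u + isum v)%C.
Proof.
move=> ht h h'; rewrite /isum -(cserD ht (geov_geo h) (geov_geo h')).
by apply: eq_cser => n; rewrite csumD.
Qed.

Lemma isum_delta (i : index g) u : (forall j, j <> i -> u j = RtoC 0) -> isum u = u i.
Proof.
case: i => a n h; rewrite /isum (cser_delta (n0 := n)).
  by apply: csum_delta => b /eqP hb; apply: h => -[].
by move=> m hm; rewrite (eq_csum (G := fun=> RtoC 0)) ?csum0 // => b; apply: h => -[].
Qed.

Lemma cser_isum_exchange theta c (f : nat -> vec g) : 0 <= theta < 1 ->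
  (forall n i, Cmod (f n i) <= c * theta ^ n * theta ^ i.2) ->
  cser (fun n => isum (f n)) = isum (fun i => cser (fun n => f n i)).
Proof.
move=> ht h; rewrite /isum.
rewrite (@cser_fubini theta (nletters * c) _ ht).
  apply: eq_cser => m; rewrite (cser_csum (c := c * theta ^ m) ht) //.
  by move=> a n; have := h n (a, m) => /= h1; apply: Rle_trans h1 _; apply: Req_le; ring.
move=> n m; have hn : geov theta (c * theta ^ n) (f n) by move=> i; apply: h.
by apply: Rle_trans (geov_geo hn m) _; apply: Req_le; ring.
Qed.

Lemma isum_fubini theta c (f : index g -> vec g) : 0 <= theta < 1 ->
  (forall i j, Cmod (f i j) <= c * theta ^ i.2 * theta ^ j.2) ->
  isum (fun i => isum (f i)) = isum (fun j => isum (fun i => f i j)).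
Proof.
move=> ht h; rewrite {1}/isum.
pose F n j := csum (fun a : LT => f (a, n) j).
rewrite (eq_cser (f' := fun n => isum (F n))).
  rewrite (@cser_isum_exchange theta (nletters * c) _ ht) // => n j.
  apply: Rle_trans (Cmod_csum _) _.
  rewrite !Rmult_assoc /nletters -rsumMr; apply: rsum_le => a; rewrite Rmult_1_l -Rmult_assoc.
  exact: (h (a, n)).
move=> n; rewrite /isum /F.
rewrite -(cser_csum (c := nletters * (c * theta ^ n)) ht).
  by apply: eq_cser => m; rewrite csum_exchange.
by move=> a; apply: (geov_geo (u := f (a, n))) => j; apply: (h (a, n)).
Qed.

Lemma geov_mono theta theta' c u : 0 <= theta <= theta' -> geov theta c u -> geov theta' c u.
Proof.
move=> ht h i; apply: Rle_trans (h i) _.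
have c0 : 0 <= c by have := h (i.1, 0%nat); rewrite /= Rmult_1_r; apply: Rle_trans (Cmod_ge_0 _).
by apply: Rmult_le_compat_l => //; apply: pow_incr.
Qed.

Definition decays theta u : Prop := exists c, geov theta c u.

Lemma decaysD theta u v : decays theta u -> decays theta v ->
  decays theta (fun i => u i + v i)%C.
Proof.
move=> [c h] [c' h']; exists (c + c') => i.
by apply: Rle_trans (Cmod_triangle _ _) _; have := h i; have := h' i; lra.
Qed.

Lemma decaysZ theta x u : decays theta u -> decays theta (fun i => x * u i)%C.
Proof.
move=> [c h]; exists (Cmod x * c) => i; rewrite Cmod_mult Rmult_assoc.
by apply: Rmult_le_compat_l; [apply: Cmod_ge_0 | apply: h].
Qed.

Lemma decays_delta theta (i : index g) u : 0 < theta ->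
  (forall j, j <> i -> u j = RtoC 0) -> decays theta u.
Proof.
move=> ht h; have p n : 0 < theta ^ n by apply: pow_lt.
exists (Cmod (u i) / theta ^ i.2) => j.
have h0 := Cmod_ge_0 (u i).
have q : 0 <= Cmod (u i) / theta ^ i.2 by apply: Rdiv_le_0_compat.
case: (eqVneq j i) => [->|/eqP ne].
  by apply: Req_le; field; have := p i.2; lra.
by rewrite h // Cmod_0; apply: Rmult_le_pos => //; apply: Rlt_le.
Qed.

Lemma decays_ext theta u v : (forall i, u i = v i) -> decays theta u -> decays theta v.
Proof. by move=> h [c hc]; exists c => i; rewrite -h. Qed.

Lemma decays_is_sum theta u : 0 <= theta < 1 -> decays theta u -> is_sum u (isum u).
Proof. by move=> ht [c h]; apply: isum_is_sum ht h. Qed.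

Lemma decays_isumD theta u v : 0 <= theta < 1 -> decays theta u -> decays theta v ->
  isum (fun i => u i + v i)%C = (isum u + isum v)%C.
Proof. by move=> ht [c h] [c' h']; apply: isumD ht h h'. Qed.

Lemma decays_isumZ theta x u : 0 <= theta < 1 -> decays theta u ->
  isum (fun i => x * u i)%C = (x * isum u)%C.
Proof. by move=> ht [c h]; apply: isumZ ht h. Qed.

End IndexSums.

(** * The Neumann series of a Grunsky matrix *)

Section Neumann.
Variable g : nat.
Notation LT := ('I_g * bool)%type.
Notation trunc N := (LT * 'I_N)%type.

Definition emb N (i : trunc N) : index g := (i.1, nat_of_ord i.2).

Lemma emb_inj N : injective (@emb N).
Proof. by case=> a n [b m] [-> /val_inj ->]. Qed.

(** Operator norm at most 1 on l^2, expressed through the finite square sections; this is the form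
    in which the energy inequality delivers it. *)
Definition contraction (B : mat g) : Prop :=
  forall N (q : vec g),
    rsum (fun i : trunc N => Cmod (csum (fun j : trunc N => B (emb i) (emb j) * q (emb j))%C) ^ 2)
    <= rsum (fun j : trunc N => Cmod (q (emb j)) ^ 2).

Definition l2_bounded (b : R) (q : vec g) : Prop :=
  forall N, rsum (fun j : trunc N => Cmod (q (emb j)) ^ 2) <= b ^ 2.

Lemma psum_pair N (u : vec g) :
  csum (fun n : 'I_N => csum (fun a : LT => u (a, nat_of_ord n))) =
  csum (fun j : trunc N => u (emb j)).
Proof. by rewrite csum_exchange [RHS]csum_pair. Qed.

Lemma emb_surj (i : index g) : exists N (j : trunc N), emb j = i.
Proof. by case: i => a n; exists n.+1, (a, ord_max). Qed.

Lemma sqr_le_of_pow2 x b : 0 <= b -> x ^ 2 <= b ^ 2 -> x <= b.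
Proof. by move=> b0 h; apply: Rsqr_incr_0_var => //; rewrite /Rsqr; nra. Qed.

Lemma l2_bounded_pt b q i : 0 <= b -> l2_bounded b q -> Cmod (q i) <= b.
Proof.
move=> b0 h; have [N [j <-]] := emb_surj i.
apply: sqr_le_of_pow2 => //; apply: Rle_trans (h N).
apply: (rsum_ge (F := fun j : trunc N => Cmod (q (emb j)) ^ 2)) => k; exact: pow2_ge_0.
Qed.

Lemma contraction_entry B i j : contraction B -> Cmod (B i j) <= 1.
Proof.
move=> h; pose N := (maxn i.2 j.2).+1.
have hi : (i.2 < N)%nat by rewrite ltnS leq_maxl.
have hj : (j.2 < N)%nat by rewrite ltnS leq_maxr.
pose i' : trunc N := (i.1, Ordinal hi); pose j' : trunc N := (j.1, Ordinal hj).
have ei : emb i' = i by rewrite /emb /= -surjective_pairing.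
have ej : emb j' = j by rewrite /emb /= -surjective_pairing.
pose q : vec g := fun k => if k == j then RtoC 1 else RtoC 0.
have := h N q.
have -> : rsum (fun j0 : trunc N => Cmod (q (emb j0)) ^ 2) = 1.
  rewrite /rsum (bigD1 j') //= big1 => [|k /eqP hk]; rewrite /q.
    by rewrite ej eqxx Cmod_1; ring.
  rewrite ifF ?Cmod_0; first by ring.
  by apply/eqP; rewrite -ej => /emb_inj.
move=> h1; apply: sqr_le_of_pow2; first lra.
rewrite pow1; apply: Rle_trans h1.
apply: Rle_trans (@rsum_ge _ (fun i : trunc N =>
   Cmod (csum (fun j : trunc N => B (emb i) (emb j) * q (emb j))%C) ^ 2) i'
   (fun k => pow2_ge_0 _)).
rewrite (csum_delta (i := j')) /q ei.
  by rewrite ej eqxx Cmult_1_r; apply: Rle_refl.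
move=> k /eqP hk; rewrite ifF ?Cmult_0_r //.
by apply/eqP; rewrite -ej => /emb_inj.
Qed.

Lemma rsum_trunc_mono M N (f : index g -> R) : (M <= N)%nat -> (forall i, 0 <= f i) ->
  rsum (fun j : trunc M => f (emb j)) <= rsum (fun j : trunc N => f (emb j)).
Proof.
move=> hMN h; rewrite rsum_pair [X in _ <= X]rsum_pair; apply: rsum_le => a; rewrite /emb /=.
elim: N hMN => [|N IH]; first by rewrite leqn0 => /eqP ->; apply: Rle_refl.
rewrite leq_eqVlt => /orP[/eqP -> |hM]; first exact: Rle_refl.
apply: Rle_trans (IH hM) _; rewrite (rsumS N (fun n => f (a, n))).
rewrite -{1}(Rplus_0_r (rsum _)); apply: Rplus_le_compat_l; exact: h.
Qed.

(** For fixed N the first rows are compared with the section of size M >= N, which the contraction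
    bounds. The truncation error is [eta * theta ^ M], and M tends to infinity. *)
Lemma contraction_isum B b theta c q : contraction B -> 0 <= b -> 0 <= theta < 1 ->
  geov theta c q -> l2_bounded b q ->
  l2_bounded b (fun i => isum (fun k => B i k * q k)%C).
Proof.
move=> hB b0 ht hq hl N.
have hgeo i : geov theta c (fun k => B i k * q k)%C.
  move=> k; rewrite Cmod_mult; apply: Rle_trans (hq k).
  rewrite -{2}(Rmult_1_l (Cmod (q k))); apply: Rmult_le_compat_r; first exact: Cmod_ge_0.
  exact: contraction_entry.
have c0 : 0 <= nletters g * c by apply: geo_ge0 (geov_geo hq).
pose eta := 2 * (nletters g * c) / (1 - theta).
have eta0 : 0 <= eta by apply: Rdiv_le_0_compat; lra.
pose y i := isum (fun k => B i k * q k)%C.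
pose S M i := csum (fun j : trunc M => B i (emb j) * q (emb j))%C.
have tail M i : Cmod (y i - S M i) <= eta * theta ^ M.
  have := cser_tail M ht (geov_geo (hgeo i)).
  rewrite (psum_pair M (fun k => B i k * q k)%C) -/(S M i) -/(isum _) -/(y i) => h.
  by apply: Rle_trans h _; apply: Req_le; rewrite /eta; field; lra.
pose E := rsum (fun i : trunc N => 1).
have E0 : 0 <= E by apply: rsum_ge0 => _; lra.
have key M : (N <= M)%nat ->
  rsum (fun i : trunc N => Cmod (y (emb i)) ^ 2) <= b ^ 2 + E * ((2 * b + eta) * eta) * theta ^ M.
  move=> hM.
  have hS : rsum (fun i : trunc M => Cmod (S M (emb i)) ^ 2) <= b ^ 2.
    exact: Rle_trans (hB M q) (hl M).
  have hSN := @rsum_trunc_mono N M (fun i => Cmod (S M i) ^ 2) hM (fun i => pow2_ge_0 _).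
  apply: Rle_trans (rsum_le (G := fun i : trunc N => Cmod (S M (emb i)) ^ 2 +
     1 * ((2 * b + eta) * eta * theta ^ M)) _) _; last first.
    rewrite rsumD rsumMr; apply: Rplus_le_compat; first exact: Rle_trans hSN hS.
    by rewrite [X in _ <= X]Rmult_assoc; apply: Rle_refl.
  move=> i; have hi := tail M (emb i).
  have p : 0 <= theta ^ M <= 1.
    by split; [apply: pow_le; lra | rewrite -(pow1 M); apply: pow_incr; lra].
  have h1 : Cmod (y (emb i)) <= Cmod (S M (emb i)) + eta * theta ^ M.
    have := Cmod_sub_ge (y (emb i)) (S M (emb i)); lra.
  have h2 : Cmod (S M (emb i)) <= b.
    apply: sqr_le_of_pow2 => //; apply: Rle_trans _ hS; apply: Rle_trans _ hSN.
    apply: (rsum_ge (F := fun i : trunc N => Cmod (S M (emb i)) ^ 2)) => k; exact: pow2_ge_0.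
  have h3 := Cmod_ge_0 (y (emb i)); have h4 := Cmod_ge_0 (S M (emb i)).
  have h5 : Cmod (y (emb i)) ^ 2 <= (Cmod (S M (emb i)) + eta * theta ^ M) ^ 2.
    by apply: pow_incr; lra.
  apply: Rle_trans h5 _.
  have h6 : 0 <= eta * theta ^ M <= eta by nra.
  have h7 : Cmod (S M (emb i)) * (eta * theta ^ M) <= b * (eta * theta ^ M).
    by apply: Rmult_le_compat_r; lra.
  have h8 : (eta * theta ^ M) * (eta * theta ^ M) <= eta * (eta * theta ^ M).
    by apply: Rmult_le_compat_r; lra.
  nra.
apply: Rnot_lt_le => hneg'.
have hneg : b ^ 2 < rsum (fun i : trunc N => Cmod (y (emb i)) ^ 2) := hneg'.
have [M0 hM0] := geo_small (E * ((2 * b + eta) * eta)) ht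
  (ltac:(lra) : 0 < (rsum (fun i : trunc N => Cmod (y (emb i)) ^ 2) - b ^ 2) / 2).
have := hM0 (M0 + N)%nat ltac:(lia); have := key (M0 + N)%nat ltac:(lia); lra.
Qed.

Variables (theta : R) (B A : mat g).
Hypothesis theta01 : 0 < theta < 1.
Hypothesis Bcontr : contraction B.
Hypothesis AE : forall i j,
  A i j = (RtoC (theta ^ i.2.+1) * B i j * RtoC (theta ^ j.2.+1))%C.

(* The power A^(n+1) is [theta^(i+1)] times [wpow n]. *)
Fixpoint wpow (n : nat) : mat g :=
  match n with
  | 0%nat => fun i j => (B i j * RtoC (theta ^ j.2.+1))%C
  | m.+1 => fun i j => isum (fun k => B i k * (RtoC (theta ^ k.2.+1 * theta ^ k.2.+1) * wpow m k j))%C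
  end.

Definition mpow (n : nat) : mat g :=
  match n with
  | 0%nat => @idm g
  | m.+1 => fun i j => (RtoC (theta ^ i.2.+1) * wpow m i j)%C
  end.

Let t0 : 0 <= theta < 1. Proof. lra. Qed.
Let tp n : 0 < theta ^ n. Proof. by apply: pow_lt; lra. Qed.
Let tp1 n : theta ^ n <= 1.
Proof. by rewrite -(pow1 n); apply: pow_incr; lra. Qed.

Lemma wpow_step_geov b m j : 0 <= b -> l2_bounded b (fun i => wpow m i j) ->
  geov theta b (fun k => RtoC (theta ^ k.2.+1 * theta ^ k.2.+1) * wpow m k j)%C.
Proof.
move=> b0 h k; rewrite Cmod_mult Cmod_R Rabs_pos_eq; last by apply: Rlt_le; apply: Rmult_lt_0_compat.
have h1 := l2_bounded_pt k b0 h; have h2 := Cmod_ge_0 (wpow m k j).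
rewrite Rmult_comm; apply: Rmult_le_compat => //.
  by apply: Rmult_le_pos; apply: Rlt_le.
have := tp k.2; have := tp1 k.2.+1; rewrite /=.
move: (theta ^ k.2) => x h3 h4; have h5 : theta * x <= x by nra.
by have : (theta * x) * (theta * x) <= 1 * (theta * x); [apply: Rmult_le_compat_r; nra | lra].
Qed.

(** With D the diagonal matrix of the theta^(k+1), this is column j of (B D^2)^n B D. The entries of
    D^2 are at most theta^2, so each factor B D^2 contributes theta^2 to the l^2 norm, and the last
    D contributes theta^(j+1). *)
Lemma wpow_l2 n j : l2_bounded (theta ^ (j.2.+1 + n * 2)) (fun i => wpow n i j).
Proof.
elim: n => [|m IH].
  move=> N; rewrite addn0 /=.
  have h : Cmod (B j j) <= 1 by apply: contraction_entry.
  pose N' := maxn N j.2.+1.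
  have hj : (j.2 < N')%nat by rewrite leq_maxr.
  pose j' : trunc N' := (j.1, Ordinal hj); have ej : emb j' = j by rewrite /emb /= -surjective_pairing.
  pose q : vec g := fun k => if k == j then RtoC (theta ^ j.2.+1) else RtoC 0.
  have h1 := Bcontr N' q.
  have e1 : rsum (fun k : trunc N' => Cmod (q (emb k)) ^ 2) = (theta * theta ^ j.2) ^ 2.
    rewrite /rsum (bigD1 j') //= big1 => [|k /eqP hk]; rewrite /q.
      by rewrite ej eqxx Cmod_R Rabs_pos_eq /=; [ring | have := tp j.2; nra].
    rewrite ifF ?Cmod_0; first by ring.
    by apply/eqP; rewrite -ej => /emb_inj.
  rewrite e1 in h1; rewrite /= in h1; apply: Rle_trans h1.
  apply: Rle_trans (@rsum_trunc_mono N N' (fun i => Cmod (B i j * RtoC (theta * theta ^ j.2)) ^ 2) (leq_maxl _ _) (fun i => pow2_ge_0 _)) _.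
  apply: Req_le; apply: eq_rsum => i; congr (Cmod _ ^ 2).
  rewrite (csum_delta (i := j')) => [|k /eqP hk]; first by rewrite /q ej eqxx.
  by rewrite /q ifF ?Cmult_0_r //; apply/eqP; rewrite -ej => /emb_inj.
set b := theta ^ (j.2.+1 + m * 2) in IH.
have b0 : 0 <= b by apply: Rlt_le; apply: tp.
have -> : theta ^ (j.2.+1 + m.+1 * 2) = b * theta ^ 2.
  by rewrite /b -pow_add; congr pow; lia.
apply: (contraction_isum (theta := theta) (c := b) Bcontr) => //.
- by apply: Rmult_le_pos => //; apply: Rlt_le; apply: tp.
- exact: wpow_step_geov.
move=> N; rewrite (_ : (b * theta ^ 2) ^ 2 = (theta ^ 2) ^ 2 * b ^ 2); last by ring.
apply: Rle_trans (Rmult_le_compat_l ((theta ^ 2) ^ 2) _ _ (pow2_ge_0 _) (IH N)).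
rewrite -rsumMl; apply: rsum_le => k.
rewrite Cmod_mult Cmod_R Rabs_pos_eq; last by apply: Rlt_le; apply: Rmult_lt_0_compat.
rewrite Rpow_mult_distr; apply: Rmult_le_compat_r; first exact: pow2_ge_0.
apply: pow_incr; split; first by apply: Rmult_le_pos; apply: Rlt_le.
rewrite /=; have := tp (emb k).2; have := tp1 (emb k).2; move: (theta ^ _) => x h1 h2.
have h3 : x * x <= 1 by nra.
have -> : theta * x * (theta * x) = theta * theta * (x * x) by ring.
by have h4 : 0 < theta * theta by [nra]; nra.
Qed.

Lemma wpow_bound n i j : Cmod (wpow n i j) <= theta ^ (j.2.+1 + n * 2).
Proof.
apply: (@l2_bounded_pt _ (fun i => wpow n i j)); last exact: wpow_l2.
by apply: Rlt_le; apply: tp.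
Qed.

Lemma mpow_bound n i j :
  Cmod (mpow n.+1 i j) <= theta ^ i.2 * theta ^ j.2 * theta ^ n.
Proof.
rewrite /mpow Cmod_mult Cmod_R Rabs_pos_eq; last exact: Rlt_le.
have h := wpow_bound n i j; have h0 := Cmod_ge_0 (wpow n i j).
rewrite Rmult_assoc; apply: Rmult_le_compat => //; first exact: Rlt_le.
  by rewrite /=; have := tp i.2; nra.
apply: Rle_trans h _; rewrite -pow_add.
have -> : (j.2.+1 + n * 2)%nat = (j.2 + n + (n.+1))%coq_nat by lia.
rewrite (pow_add _ (j.2 + n)%coq_nat); have := tp (j.2 + n)%coq_nat; have := tp1 n.+1; nra.
Qed.

Lemma A_bound i j : Cmod (A i j) <= theta ^ i.2 * theta ^ j.2.
Proof.
have h := mpow_bound 0 i j; rewrite /= !Rmult_1_r in h; apply: Rle_trans h.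
by apply: Req_le; rewrite AE -Cmult_assoc.
Qed.

Lemma A_bound_r i j : Cmod (A i j) <= 1 * theta ^ j.2.
Proof.
apply: Rle_trans (A_bound i j) _; apply: Rmult_le_compat_r; last exact: tp1.
exact: Rlt_le.
Qed.

Lemma mpow1 i j : mpow 1 i j = A i j.
Proof. by rewrite AE /= Cmult_assoc. Qed.

Lemma idm_eq (i : index g) : @idm g i i = RtoC 1.
Proof. by rewrite /idm eqxx. Qed.

Lemma idm_neq (i j : index g) : i <> j -> @idm g i j = RtoC 0.
Proof. by move=> /eqP /negbTE h; rewrite /idm h. Qed.

Lemma decays_le1 (i : index g) (u : vec g) :
  (forall k, Cmod (u k) <= 1) -> decays theta (fun k => A i k * u k)%C.
Proof.
move=> h; exists 1 => k; rewrite Cmod_mult.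
have h1 := A_bound_r i k; have := h k; have := Cmod_ge_0 (A i k); have := Cmod_ge_0 (u k).
nra.
Qed.

Lemma mpow_le1 n k j : Cmod (mpow n.+1 k j) <= 1.
Proof.
apply: Rle_trans (mpow_bound n k j) _.
have := tp k.2; have := tp1 k.2; have := tp j.2; have := tp1 j.2; have := tp n; have := tp1 n.
move: (theta ^ k.2) (theta ^ j.2) (theta ^ n) => x y z *.
have : x * y <= 1 by nra.
by have : 0 < x * y by [nra]; nra.
Qed.

Lemma mpow_decays n i j : decays theta (fun k => A i k * mpow n k j)%C.
Proof.
case: n => [|n]; last by apply: decays_le1 => k; apply: mpow_le1.
apply: (decays_delta (i := j)); first lra.
by move=> k hk; rewrite /mpow idm_neq // Cmult_0_r.
Qed.

Lemma mpowS n i j : mpow n.+1 i j = isum (fun k => A i k * mpow n k j)%C.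
Proof.
case: n => [|n].
  rewrite mpow1 (isum_delta (i := j)) /mpow ?idm_eq ?Cmult_1_r // => k hk.
  by rewrite idm_neq // Cmult_0_r.
rewrite {1}/mpow {1}/wpow -/wpow.
rewrite -(isumZ (theta := theta) (c := theta ^ (j.2.+1 + n * 2))) //; last first.
  move=> k; rewrite Cmod_mult; have h1 := contraction_entry i k Bcontr.
  have b0 : 0 <= theta ^ (j.2.+1 + n * 2) by apply: Rlt_le; apply: tp.
  have h2 := @wpow_step_geov _ n j b0 (@wpow_l2 n j) k.
  have := Cmod_ge_0 (B i k); move: h2; set y := Cmod (_ * wpow n k j)%C.
  have : 0 <= y by apply: Cmod_ge_0.
  by move=> *; nra.
apply: eq_isum => k; rewrite AE /mpow RtoC_mult; ring.
Qed.

Lemma mpow_is_powers : is_powers A mpow.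
Proof.
split=> // n i j; rewrite mpowS.
exact: decays_is_sum (mpow_decays n i j).
Qed.

(** The powers are built by multiplication on the left; multiplication on the right, from which N (I
    - A) = I follows, is associativity of the infinite products, that is, Fubini. *)
Lemma mpowSr n i j : mpow n.+2 i j = isum (fun k => mpow n.+1 i k * A k j)%C.
Proof.
elim: n i j => [|n IH] i j.
  by rewrite mpowS; apply: eq_isum => k; rewrite !mpow1.
have hA k l : Cmod (mpow n.+1 k l * A l j) <= 1 * theta ^ l.2.
  rewrite Cmod_mult; have := mpow_le1 n k l; have := A_bound l j; have := tp1 j.2.
  have := Cmod_ge_0 (mpow n.+1 k l); have := Cmod_ge_0 (A l j); have := tp l.2; have := tp j.2.
  move: (theta ^ l.2) (theta ^ j.2) => x y *; have : x * y <= x by nra.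
  by nra.
rewrite mpowS (eq_isum (v := fun k => isum (fun l => A i k * (mpow n.+1 k l * A l j)))%C); last first.
  by move=> k; rewrite IH (isumZ (theta := theta) (c := 1)).
rewrite (isum_fubini (theta := theta) (c := 1)) //; last first.
  move=> k l; rewrite Cmod_mult; apply: Rmult_le_compat; try exact: Cmod_ge_0.
    exact: A_bound_r.
  by have := hA k l; rewrite Rmult_1_l.
apply: eq_isum => l; rewrite mpowS Cmult_comm.
rewrite -(decays_isumZ _ t0 (mpow_decays n.+1 i l)).
by apply: eq_isum => k; ring.
Qed.

(** The identity is kept apart because only the positive powers decay in both indices. *)
Definition msum : mat g := fun i j => cser (fun n => mpow n.+1 i j).

Definition minv : mat g := fun i j => (@idm g i j + msum i j)%C.

Lemma mpow_geo i j : geo theta (theta ^ i.2 * theta ^ j.2) (fun n => mpow n.+1 i j).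
Proof. by move=> n; apply: mpow_bound. Qed.

Definition mconst : R := 2 / (1 - theta).

Lemma mconst_ge0 : 0 <= mconst.
Proof. by apply: Rdiv_le_0_compat; lra. Qed.

Lemma msum_bound i j : Cmod (msum i j) <= mconst * theta ^ i.2 * theta ^ j.2.
Proof.
apply: Rle_trans (cser_bound t0 (mpow_geo i j)) _.
by apply: Req_le; rewrite /mconst; field; lra.
Qed.

Lemma msum_bound_r i j : Cmod (msum i j) <= mconst * theta ^ j.2.
Proof.
apply: Rle_trans (msum_bound i j) _; have := mconst_ge0; have := tp1 i.2; have := tp i.2; have := tp j.2.
move=> h1 h2 h3 h4; apply: Rmult_le_compat_r; first lra.
nra.
Qed.

Lemma msum_bound_l i j : Cmod (msum i j) <= mconst * theta ^ i.2.
Proof.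
apply: Rle_trans (msum_bound i j) _; have := mconst_ge0; have := tp1 j.2; have := tp i.2; have := tp j.2.
move=> h1 h2 h3 h4; have : 0 <= mconst * theta ^ i.2 by nra.
nra.
Qed.

Lemma neumann_sum : is_neumann_sum A minv.
Proof.
exists mpow; split; first exact: mpow_is_powers.
move=> i j.
(* The 1 accounts for the identity at n = 0, the 1/theta for the shift in [mpow_bound], where the
   power n + 1 comes with theta^n. *)
have hg : geo theta (1 + / theta) (fun n => mpow n i j).
  have ti : 0 < / theta by apply: Rinv_0_lt_compat; lra.
  case=> [|n].
    rewrite /= Rmult_1_r /idm; case: ifP => _; rewrite ?Cmod_1 ?Cmod_0; lra.
  apply: Rle_trans (mpow_bound n i j) _.
  rewrite (_ : (1 + / theta) * theta ^ n.+1 = theta ^ n.+1 + theta ^ n); last by rewrite /=; field; lra.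
  have := tp i.2; have := tp1 i.2; have := tp j.2; have := tp1 j.2; have := tp n; have := tp n.+1.
  move: (theta ^ i.2) (theta ^ j.2) (theta ^ n) (theta ^ n.+1) => x y z z' *.
  by have : x * y <= 1 by [nra]; nra.
rewrite /minv /msum -(@cser_recl theta _ (fun n => mpow n i j) t0 hg).
exact: is_series_cser t0 hg.
Qed.

Lemma msum_recl i j : cser (fun n => mpow n.+2 i j) = (msum i j - A i j)%C.
Proof. by rewrite /msum (cser_recl t0 (mpow_geo i j)) mpow1; ring. Qed.

Lemma A_msum_geov i j : geov theta mconst (fun k => A i k * msum k j)%C.
Proof.
move=> k; rewrite Cmod_mult (Rmult_comm mconst).
have := A_bound_r i k; have := msum_bound_l k j; have := mconst_ge0; have := tp1 k.2; have := tp k.2.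
have := Cmod_ge_0 (A i k); have := Cmod_ge_0 (msum k j).
move: (theta ^ k.2) => x h1 h2 h3 h4 h5 h6 h7.
apply: Rmult_le_compat => //; first lra.
nra.
Qed.

Lemma msum_A_geov i j : geov theta mconst (fun k => msum i k * A k j)%C.
Proof.
move=> k; rewrite Cmod_mult.
have := A_bound k j; have := msum_bound_r i k; have := mconst_ge0; have := tp1 k.2; have := tp k.2.
have := tp1 j.2; have := tp j.2.
have := Cmod_ge_0 (A k j); have := Cmod_ge_0 (msum i k).
move: (theta ^ k.2) (theta ^ j.2) => x y h1 h2 h3 h4 h5 h6 h7 h8 h9.
have h10 : Cmod (A k j) <= 1 by nra.
have h11 : 0 <= mconst * x by nra.
nra.
Qed.

Lemma A_msum i j : isum (fun k => A i k * msum k j)%C = (msum i j - A i j)%C.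
Proof.
rewrite -msum_recl.
rewrite (eq_isum (v := fun k => cser (fun n => A i k * mpow n.+1 k j)))%C; last first.
  by move=> k; rewrite (cserZ _ t0 (mpow_geo k j)).
rewrite -(cser_isum_exchange (theta := theta) (c := 1)) //.
  by apply: eq_cser => n; rewrite -mpowS.
move=> n k; rewrite Cmod_mult Rmult_assoc Rmult_1_l.
have := A_bound_r i k; have := mpow_bound n k j.
have := tp1 k.2; have := tp k.2; have := tp1 j.2; have := tp j.2; have := tp n.
have := Cmod_ge_0 (A i k); have := Cmod_ge_0 (mpow n.+1 k j).
move: (theta ^ k.2) (theta ^ j.2) (theta ^ n) => x y z h1 h2 h3 h4 h5 h6 h7 h8 h9.
rewrite Rmult_comm; apply: Rmult_le_compat => //; last lra.
have : x * y <= 1 by nra.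
nra.
Qed.

Lemma msum_A i j : isum (fun k => msum i k * A k j)%C = (msum i j - A i j)%C.
Proof.
rewrite -msum_recl.
rewrite (eq_isum (v := fun k => cser (fun n => A k j * mpow n.+1 i k)))%C; last first.
  by move=> k; rewrite (cserZ _ t0 (mpow_geo i k)) Cmult_comm.
rewrite -(cser_isum_exchange (theta := theta) (c := 1)) //.
  by apply: eq_cser => n; rewrite mpowSr; apply: eq_isum => k; ring.
move=> n k; rewrite Cmod_mult Rmult_assoc Rmult_1_l.
have := A_bound k j; have := mpow_bound n i k.
have := tp1 k.2; have := tp k.2; have := tp1 j.2; have := tp j.2; have := tp n.
have := tp1 i.2; have := tp i.2.
have := Cmod_ge_0 (A k j); have := Cmod_ge_0 (mpow n.+1 i k).
move: (theta ^ k.2) (theta ^ j.2) (theta ^ n) (theta ^ i.2) => x y z t h1 h2 h3 h4 h5 h6 h7 h8 h9 h10 h11.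
rewrite Rmult_comm; apply: Rmult_le_compat => //.
  have : t * x <= 1 by nra.
  nra.
nra.
Qed.

Lemma minv_inverse : is_inverse (subm (@idm g) A) minv.
Proof.
have tpos : 0 < theta by lra.
split=> i j.
  have d1 : forall k, k <> i -> (@idm g i k * minv k j)%C = RtoC 0.
    by move=> k hk; rewrite idm_neq ?Cmult_0_l //; apply: nesym.
  have d2 : forall k, k <> j -> ((- A i k) * @idm g k j)%C = RtoC 0.
    by move=> k hk; rewrite idm_neq ?Cmult_0_r.
  have D1 := decays_delta tpos d1; have D2 := decays_delta tpos d2.
  have D3 : decays theta (fun k => - (1) * (A i k * msum k j))%C.
    by apply: decaysZ; exists mconst; apply: A_msum_geov.
  have e : isum (fun k => @idm g i k * minv k j + (- A i k) * @idm g k j +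
      - (1) * (A i k * msum k j))%C = @idm g i j.
    rewrite (decays_isumD t0 (decaysD D1 D2) D3) (decays_isumD t0 D1 D2).
    rewrite (isum_delta d1) (isum_delta d2) (isumZ _ t0 (A_msum_geov i j)) A_msum !idm_eq /minv.
    by ring.
  have ee k : (@idm g i k * minv k j + (- A i k) * @idm g k j + - (1) * (A i k * msum k j) =
      subm (@idm g) A i k * minv k j)%C by rewrite /subm /minv; ring.
  rewrite -e (eq_isum ee); apply: (decays_is_sum t0); apply: decays_ext ee _.
  exact: decaysD (decaysD D1 D2) D3.
have d1 : forall k, k <> i -> (@idm g i k * (@idm g k j - A k j))%C = RtoC 0.
  by move=> k hk; rewrite idm_neq ?Cmult_0_l //; apply: nesym.
have d2 : forall k, k <> j -> (msum i k * @idm g k j)%C = RtoC 0.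
  by move=> k hk; rewrite idm_neq ?Cmult_0_r.
have D1 := decays_delta tpos d1; have D2 := decays_delta tpos d2.
have D3 : decays theta (fun k => - (1) * (msum i k * A k j))%C.
  by apply: decaysZ; exists mconst; apply: msum_A_geov.
have e : isum (fun k => @idm g i k * (@idm g k j - A k j) + msum i k * @idm g k j +
    - (1) * (msum i k * A k j))%C = @idm g i j.
  rewrite (decays_isumD t0 (decaysD D1 D2) D3) (decays_isumD t0 D1 D2).
  rewrite (isum_delta d1) (isum_delta d2) (isumZ _ t0 (msum_A_geov i j)) msum_A !idm_eq.
  by ring.
have ee k : (@idm g i k * (@idm g k j - A k j) + msum i k * @idm g k j +
    - (1) * (msum i k * A k j) = minv i k * subm (@idm g) A k j)%C.
  by rewrite /subm /minv; ring.
rewrite -e (eq_isum ee); apply: (decays_is_sum t0); apply: decays_ext ee _.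
exact: decaysD (decaysD D1 D2) D3.
Qed.

Section Solve.
(** Vectors keep a ratio of their own: the decay of R(y) deteriorates as y approaches a circle,
    whatever the ratio [theta] of the matrix. *)
Variables (theta' : R) (Y : vec g).
Hypothesis tt' : theta <= theta' < 1.
Hypothesis Ydec : decays theta' Y.

Let t0' : 0 <= theta' < 1. Proof. lra. Qed.

Lemma decays_mul_bounded (c : R) (f : vec g) : (forall k, Cmod (f k) <= c) ->
  decays theta' (fun k => f k * Y k)%C.
Proof.
case: Ydec => c' h hf; exists (c * c') => k; rewrite Cmod_mult Rmult_assoc.
by apply: Rmult_le_compat => //; apply: Cmod_ge_0.
Qed.

Lemma msum_le i k : Cmod (msum i k) <= mconst.
Proof.
apply: Rle_trans (msum_bound_r i k) _.
by have := mconst_ge0; have := tp1 k.2; have := tp k.2; nra.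
Qed.

Lemma minv_mulmv : is_mulmv minv Y (fun i => isum (fun k => minv i k * Y k)%C).
Proof.
move=> i; apply: (decays_is_sum t0'); apply: (@decays_mul_bounded (1 + mconst)) => k.
apply: Rle_trans (Cmod_triangle _ _) _; apply: Rplus_le_compat; last exact: msum_le.
by rewrite /idm; case: ifP => _; rewrite ?Cmod_1 ?Cmod_0; lra.
Qed.

Lemma minv_mulE i : isum (fun k => minv i k * Y k)%C = (Y i + isum (fun k => msum i k * Y k))%C.
Proof.
have d1 : forall k, k <> i -> (@idm g i k * Y k)%C = RtoC 0.
  by move=> k hk; rewrite idm_neq ?Cmult_0_l //; apply: nesym.
have D1 := decays_delta (ltac:(lra) : 0 < theta') d1.
have D2 := decays_mul_bounded (msum_le i).
have -> : Y i = (@idm g i i * Y i)%C by rewrite idm_eq Cmult_1_l.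
rewrite -(isum_delta d1) -(decays_isumD t0' D1 D2); apply: eq_isum => k.
by rewrite /minv; ring.
Qed.

Lemma minv_mul_bound : exists c, geov theta' c (fun i => isum (fun k => minv i k * Y k)%C).
Proof.
case: (Ydec) => c h; exists (c + 2 * (nletters g * (mconst * c)) / (1 - theta')) => i.
rewrite minv_mulE; apply: Rle_trans (Cmod_triangle _ _) _; rewrite Rmult_plus_distr_r.
apply: Rplus_le_compat => //.
have hg : geov theta' (mconst * theta ^ i.2 * c) (fun k => msum i k * Y k)%C.
  move=> k; rewrite Cmod_mult Rmult_assoc; apply: Rmult_le_compat => //; try exact: Cmod_ge_0.
  exact: msum_bound_l.
apply: Rle_trans (isum_bound t0' hg) _.
have c0 : 0 <= c by have := h (i.1, 0%nat); rewrite /= Rmult_1_r; apply: Rle_trans (Cmod_ge_0 _).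
have h1 : theta ^ i.2 <= theta' ^ i.2 by apply: pow_incr; lra.
have -> : 2 * (nletters g * (mconst * theta ^ i.2 * c)) / (1 - theta') =
   2 * (nletters g * (mconst * c)) / (1 - theta') * theta ^ i.2 by field; lra.
apply: Rmult_le_compat_l => //.
apply: Rdiv_le_0_compat; last lra.
have := nletters_ge0 g; have := mconst_ge0 => ? ?.
by apply: Rmult_le_pos; [lra | apply: Rmult_le_pos => //; apply: Rmult_le_pos].
Qed.

End Solve.

(** Since Y = A X - X, applying [minv] = I + [msum] and using [msum] A = [msum] - A makes everything
    cancel except - X. The decay of X justifies the reassociation. *)
Lemma minv_solve theta' (X Y : vec g) : theta <= theta' < 1 ->
  decays theta' X -> decays theta' Y ->
  (forall i, X i = - Y i + isum (fun k => A i k * X k))%C ->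
  forall i, isum (fun k => minv i k * Y k)%C = (- X i)%C.
Proof.
move=> tt' hX hY hXY i; have t0' : 0 <= theta' < 1 by lra.
have Ale k l : Cmod (A k l) <= 1.
  by have := A_bound_r k l; have := tp1 l.2; have := tp l.2; nra.
rewrite (minv_mulE tt' hY).
have YE k : Y k = (isum (fun l => A k l * X l) + - (1) * X k)%C.
  transitivity (isum (fun l => A k l * X l) + - (1) * (- Y k + isum (fun l => A k l * X l)))%C.
    by ring.
  by rewrite -hXY.
case: (hX) => c hc.
have c0 : 0 <= c by have := hc (i.1, 0%nat); rewrite /= Rmult_1_r; apply: Rle_trans (Cmod_ge_0 _).
have hAX k : geov theta' (1 * c) (fun l => A k l * X l)%C.
  move=> l; rewrite Cmod_mult Rmult_assoc; apply: Rmult_le_compat => //; exact: Cmod_ge_0.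
have m0 := mconst_ge0.
have D3 k l : Cmod (msum i k * (A k l * X l)) <= mconst * c * theta' ^ k.2 * theta' ^ l.2.
  rewrite Cmod_mult.
  have -> : mconst * c * theta' ^ k.2 * theta' ^ l.2 = (mconst * theta' ^ k.2) * (1 * c * theta' ^ l.2) by ring.
  apply: Rmult_le_compat; try exact: Cmod_ge_0; last exact: hAX.
  apply: Rle_trans (msum_bound_r i k) _; apply: Rmult_le_compat_l => //.
  by apply: pow_incr; lra.
rewrite (eq_isum (v := fun k => isum (fun l => msum i k * (A k l * X l)) +
   - (1) * (msum i k * X k))%C); last first.
  by move=> k; rewrite YE (isumZ _ t0' (hAX k)); ring.
have D1 : decays theta' (fun k => isum (fun l => msum i k * (A k l * X l)))%C.
  exists (2 * (nletters g * (mconst * c)) / (1 - theta')) => k.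
  apply: Rle_trans (isum_bound t0' (D3 k)) _.
  by apply: Req_le; field; lra.
have D2 : decays theta' (fun k => msum i k * X k)%C.
  exact: (decays_mul_bounded hX (msum_le i)).
rewrite (decays_isumD t0' D1 (decaysZ _ D2)) (decays_isumZ _ t0' D2).
rewrite (isum_fubini t0' D3).
have D4 : decays theta' (fun l => A i l * X l)%C by exists (1 * c).
rewrite (eq_isum (v := fun l => msum i l * X l + - (1) * (A i l * X l))%C).
  rewrite (decays_isumD t0' D2 (decaysZ _ D4)) (decays_isumZ _ t0' D4) YE; ring.
move=> l; transitivity (X l * isum (fun k => msum i k * A k l))%C.
  by rewrite -(isumZ _ t0 (msum_A_geov i l)); apply: eq_isum => k; ring.
by rewrite msum_A; ring.
Qed.

End Neumann.

(** * The matrix A of the theorem as a rescaled contraction *)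

Section ContractionA.
Variable g : nat.
Notation LT := ('I_g * bool)%type.
Notation trunc N := (LT * 'I_N)%type.

Lemma negK : involutive (@neg g).
Proof. by case=> i b; rewrite /neg /= negbK. Qed.

Lemma rsum_neg (F : LT -> R) : rsum (fun a => F (neg a)) = rsum F.
Proof. by rewrite [RHS]/rsum (reindex_inj (inv_inj negK)). Qed.

Definition sqf (sq : 'I_g -> C) (a : LT) : C := sq a.1.

(** The factor (k+l-1)! / (sqrt (k l) (k-1)! (l-1)!) equals sqrt (k l) (k+l-1)! / (k! l!). The row
    letter is negated, so the zero blocks a = -b of A are the diagonal blocks of [gcoef]. *)
Lemma Acoef_gcoef (w : letter g -> C) (sq : 'I_g -> C) (a b : LT) k l :
  Acoef w sq a b k.+1 l.+1 =
  (gcoef w (sqf sq) (neg a) b k.+1 l.+1 *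
    (RtoC (sqrt (INR k.+1)) * RtoC (sqrt (INR l.+1))))%C.
Proof.
rewrite /Acoef /gcoef (_ : (neg a == b) = (a == neg b)); last first.
  by rewrite -{1}(negK b) (inj_eq (inv_inj negK)).
case: eqP => _; first by ring.
rewrite /sqf -[(neg a).1]/(a.1).
have pk : 0 < INR k.+1 by apply: lt_0_INR; lia.
have pl : 0 < INR l.+1 by apply: lt_0_INR; lia.
have -> : (k.+1 + l.+1 - 1 = (k.+1 + l.+1).-1)%nat by lia.
rewrite !subSS !subn0 /log_coef !factS !mult_INR sqrt_mult; try lra.
set D := (_ ^ (k.+1 + l.+1))%C; set S := (_ ^ k.+1 * _ ^ l.+1)%C.
have -> : (((- (1)) ^ k.+1)%C = RtoC ((-1) ^ k.+1)).
  by rewrite RtoC_pow; congr Cpow; apply: injective_projections => /=; ring.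
rewrite (_ : (_ * (_ * S / D) * _ = RtoC ((-1) ^ k.+1 * (INR ((k.+1 + l.+1).-1)`! /
   (INR k.+1 * INR k`! * (INR l.+1 * INR l`!))) * (sqrt (INR k.+1) * sqrt (INR l.+1))) * (S / D))%C);
  last by rewrite !RtoC_mult /Cdiv; ring.
congr (RtoC _ * _)%C.
have sk : sqrt (INR k.+1) * sqrt (INR k.+1) = INR k.+1 by apply: sqrt_sqrt; lra.
have sl : sqrt (INR l.+1) * sqrt (INR l.+1) = INR l.+1 by apply: sqrt_sqrt; lra.
have sk0 : 0 < sqrt (INR k.+1) by apply: sqrt_lt_R0.
have sl0 : 0 < sqrt (INR l.+1) by apply: sqrt_lt_R0.
have fk := @INR_fact_neq0 k; have fl := @INR_fact_neq0 l.
rewrite -{2}sk -{2}sl.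
move: sk0 sl0 fk fl; move: (sqrt (INR k.+1)) (sqrt (INR l.+1)) (INR k`!) (INR l`!) (INR _`!) ((-1) ^ k.+1).
by move=> x y p q r s hx hy hp hq; field; repeat split; lra.
Qed.

(** The energy inequality is used with t = q and s = - conj (A q), both weighted by sqrt k to cancel
    the 1/k of the energy, the letters of s being negated. It then reads |A q|^2 + |q|^2 - 2 |A q|^2
    >= 0. *)
Lemma Amat_contraction (w : letter g -> C) (sq : 'I_g -> C) :
  (forall i, sq i <> RtoC 0) ->
  (forall a b : letter g, a <> b -> Cmod (sq a.1) + Cmod (sq b.1) < Cmod (w a - w b)) ->
  contraction (Amat w sq).
Proof.
move=> sq0 sep N q.
pose B : mat g := Amat w sq.
pose y (a : LT) (n : nat) := csum (fun j : trunc N => B (a, n) (emb j) * q (emb j))%C.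
pose s c k := (RtoC (sqrt (INR k.+1)) * - Cconj (y (neg c) k))%C.
pose t b l := (RtoC (sqrt (INR l.+1)) * q (b, l))%C.
have := @grunsky_energy _ w (sqf sq) (fun a => sq0 a.1) sep N s t.
have nrm k (z : C) : Cmod (RtoC (sqrt (INR k.+1)) * z) ^ 2 = INR k.+1 * Cmod z ^ 2.
  rewrite Cmod_mult Cmod_R Rabs_pos_eq; last exact: sqrt_pos.
  have := sqrt_sqrt (INR k.+1) (pos_INR _); nra.
have -> : csum (fun c : LT => csum (fun b : LT => csum (fun k : 'I_N => csum (fun l : 'I_N =>
     gcoef w (sqf sq) c b k.+1 l.+1 * (s c k * t b l)))))%C =
   RtoC (- rsum (fun c => rsum (fun k : 'I_N => Cmod (y (neg c) k) ^ 2))).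
  rewrite (_ : - rsum _ = rsum (fun c => rsum (fun k : 'I_N => - Cmod (y (neg c) k) ^ 2))); last first.
    rewrite -(Rmult_1_l (rsum _)) Ropp_mult_distr_l -rsumMl; apply: eq_rsum => c.
    by rewrite -rsumMl; apply: eq_rsum => k; ring.
  rewrite -csum_RtoC; apply: eq_csum => c; rewrite -csum_RtoC csum_exchange; apply: eq_csum => k.
  transitivity (- Cconj (y (neg c) k) * y (neg c) k)%C; last first.
    by rewrite RtoC_opp Cmod2_conj; ring.
  rewrite {2}/y [X in _ = (_ * X)%C]csum_pair -csumMl; apply: eq_csum => b; rewrite -csumMl; apply: eq_csum => l.
  rewrite /B /Amat -[Acoef _ _ _ _ _ _]/(Acoef w sq (neg c) b k.+1 l.+1).
  rewrite -[q (emb _)]/(q (b, nat_of_ord l)) Acoef_gcoef negK /s /t.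
  by set G := gcoef _ _ _ _ _ _; set Q := q _; set Y := Cconj _; ring.
have -> : rsum (fun c => rsum (fun k : 'I_N => (Cmod (s c k) ^ 2 + Cmod (t c k) ^ 2) / INR k.+1)) =
  rsum (fun c => rsum (fun k : 'I_N => Cmod (y (neg c) k) ^ 2)) +
  rsum (fun j : trunc N => Cmod (q (emb j)) ^ 2).
  rewrite [X in _ = _ + X]rsum_pair -rsumD; apply: eq_rsum => c; rewrite -rsumD; apply: eq_rsum => k.
  rewrite /s /t !nrm Cmod_opp Cmod_conj -[emb _]/(c, nat_of_ord k).
  have : INR k.+1 <> 0 by apply: not_0_INR.
  move: (INR k.+1) (Cmod (y _ _)) (Cmod (q _)) => x z z' hx; field; exact: hx.
rewrite (_ : Re (RtoC _) = - rsum (fun c => rsum (fun k : 'I_N => Cmod (y (neg c) k) ^ 2))) //.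
rewrite (rsum_neg (fun c => rsum (fun k : 'I_N => Cmod (y c k) ^ 2))) => h.
have aux a b : 0 <= a + b + 2 * - a -> a <= b by lra.
by rewrite rsum_pair; apply: aux h.
Qed.

Variables (w : letter g -> C) (rho sq : 'I_g -> C).
Hypotheses (hC : schottky_space w rho) (hsq : forall i : 'I_g, (sq i * sq i)%C = rho i).

Lemma sq_neq0 i : sq i <> RtoC 0.
Proof. by move=> e; have [h _] := hC; apply: (h i); rewrite -hsq e; ring. Qed.

Lemma radiusE a : radius rho a = Cmod (sq a.1).
Proof.
by rewrite /radius -hsq Cmod_mult sqrt_square //; apply: Cmod_ge_0.
Qed.

Lemma radius_gt0 a : 0 < radius rho a.
Proof. by rewrite radiusE; apply/Cmod_gt_0; apply: sq_neq0. Qed.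

Lemma separation : exists2 lam, 1 < lam & forall a b : LT, a <> b ->
  lam * (radius rho a + radius rho b) < Cmod (w a - w b).
Proof.
pose f (ab : LT * LT) := if ab.1 == ab.2 then 1 else
  Cmod (w ab.1 - w ab.2) / (radius rho ab.1 + radius rho ab.2) - 1.
have f0 ab : 0 < f ab.
  rewrite /f; case: eqP => [_|h]; first lra.
  have := proj2 hC _ _ h => h1.
  have p1 := radius_gt0 ab.1; have p2 := radius_gt0 ab.2.
  suff : 1 < Cmod (w ab.1 - w ab.2) / (radius rho ab.1 + radius rho ab.2) by lra.
  by apply/Rlt_div_r; lra.
have [d d0 hd] := fin_pos_lower f0.
exists (1 + d / 2); first lra.
move=> a b h; have := hd (a, b); rewrite /f /=; case: eqP => // _ h1.
have p1 := radius_gt0 a; have p2 := radius_gt0 b.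
apply/Rlt_div_r; lra.
Qed.

(** Multiplying the radii by [lam] multiplies the entry of orders k, l by lam^(k+l) and leaves the
    discs disjoint, so B is the matrix of the larger discs and theta = 1 / lam. *)
Lemma Amat_scaled : exists theta B, [/\ 0 < theta < 1, contraction B &
  forall i j, Amat w sq i j = (RtoC (theta ^ i.2.+1) * B i j * RtoC (theta ^ j.2.+1))%C].
Proof.
have [lam lam1 hlam] := separation.
pose sq' i := (RtoC lam * sq i)%C.
have nz : RtoC lam <> RtoC 0 by move=> /RtoC_inj; lra.
exists (/ lam), (Amat w sq'); split.
- by split; [apply: Rinv_0_lt_compat; lra | rewrite -Rinv_1; apply: Rinv_lt_contravar; lra].
- apply: Amat_contraction => [i|a b h].
    by apply: Cmult_neq_0 => //; apply: sq_neq0.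
  by rewrite !Cmod_mult !Cmod_R Rabs_pos_eq -?radiusE; have := hlam _ _ h; lra.
move=> i j; rewrite /Amat /Acoef; case: eqP => _; first by ring.
rewrite /sq' !Cpow_mult_l !RtoC_pow RtoC_inv ?Cpow_inv //; last lra.
have := Cpow_nz _ i.2.+1 nz; have := Cpow_nz _ j.2.+1 nz.
move: (RtoC lam ^ i.2.+1)%C (RtoC lam ^ j.2.+1)%C => x y hy hx.
rewrite /Cdiv; move: (/ (_ ^ (i.2.+1 + j.2.+1)))%C => v.
by field.
Qed.

End ContractionA.

(** * Complex differentiability and the theorem of Goursat *)

Definition ccont (f : C -> C) (z : C) : Prop :=
  forall eps, 0 < eps -> exists2 del, 0 < del &
    forall z', Cmod (z' - z) < del -> Cmod (f z' - f z) < eps.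

(** Carathéodory's form of complex differentiability: [phi] is the difference quotient completed at
    z. Products, inverses and compositions then reduce to continuity, and [phi] itself is what the
    Cauchy formula integrates. *)
Definition cdiff (f : C -> C) (z : C) : Prop :=
  exists2 phi : C -> C, ccont phi z & forall z', f z' = (f z + phi z' * (z' - z))%C.

Lemma ccont_const c z : ccont (fun _ => c) z.
Proof.
move=> e e0; exists 1; first lra.
by move=> z' _; rewrite (_ : c - c = 0)%C ?Cmod_0 //; ring.
Qed.

Lemma ccont_id z : ccont (fun x => x) z.
Proof. by move=> e e0; exists e. Qed.

Lemma ccontD f h z : ccont f z -> ccont h z -> ccont (fun x => f x + h x)%C z.
Proof.
move=> cf ch e e0.
have [d1 d10 h1] := cf (e / 2) ltac:(lra); have [d2 d20 h2] := ch (e / 2) ltac:(lra).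
exists (Rmin d1 d2); first exact: Rmin_glb_lt.
move=> z' hz; have := h1 z' (Rlt_le_trans _ _ _ hz (Rmin_l _ _)).
have := h2 z' (Rlt_le_trans _ _ _ hz (Rmin_r _ _)) => a b.
rewrite (_ : f z' + h z' - (f z + h z) = (f z' - f z) + (h z' - h z))%C; last by ring.
by apply: Rle_lt_trans (Cmod_triangle _ _) _; lra.
Qed.

Lemma ccontM f h z : ccont f z -> ccont h z -> ccont (fun x => f x * h x)%C z.
Proof.
move=> cf ch e e0.
pose K := Cmod (f z) + Cmod (h z) + 1.
have pf := Cmod_ge_0 (f z); have ph := Cmod_ge_0 (h z).
pose e1 := Rmin 1 (e / (2 * K)).
have ek : 0 < e / (2 * K) by apply: Rdiv_lt_0_compat; rewrite /K; lra.
have e10 : 0 < e1 by apply: Rmin_glb_lt; lra.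
have [d1 d10 h1] := cf e1 e10; have [d2 d20 h2] := ch e1 e10.
exists (Rmin d1 d2); first exact: Rmin_glb_lt.
move=> z' hz; have {}h1 := h1 z' (Rlt_le_trans _ _ _ hz (Rmin_l _ _)).
have {}h2 := h2 z' (Rlt_le_trans _ _ _ hz (Rmin_r _ _)).
rewrite (_ : f z' * h z' - f z * h z =
  (f z' - f z) * (h z' - h z) + f z * (h z' - h z) + (f z' - f z) * h z)%C; last by ring.
apply: Rle_lt_trans (Cmod_triangle _ _) _.
apply: Rle_lt_trans (Rplus_le_compat_r _ _ _ (Cmod_triangle _ _)) _.
rewrite !Cmod_mult; move: h1 h2; set x := Cmod (f z' - f z); set y := Cmod (h z' - h z).
have x0 : 0 <= x by apply: Cmod_ge_0.
have y0 : 0 <= y by apply: Cmod_ge_0.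
move=> h1 h2; have l1 : e1 <= 1 by apply: Rmin_l.
have l2 : e1 * K <= e / 2.
  have -> : e / 2 = e / (2 * K) * K by field; rewrite /K; lra.
  by apply: Rmult_le_compat_r; [rewrite /K; lra | apply: Rmin_r].
rewrite /K in l2; nra.
Qed.

Lemma ccontV f z : ccont f z -> f z <> RtoC 0 -> ccont (fun x => / f x)%C z.
Proof.
move=> cf nz e e0; have p : 0 < Cmod (f z) by apply/Cmod_gt_0.
pose e1 := Rmin (Cmod (f z) / 2) (e * Cmod (f z) ^ 2 / 2).
have p2 : 0 < Cmod (f z) ^ 2 by apply: pow_lt.
have e10 : 0 < e1 by apply: Rmin_glb_lt; nra.
have [d d0 h] := cf e1 e10; exists d => // z' /h hz.
have l1 : e1 <= Cmod (f z) / 2 by apply: Rmin_l.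
have l2 : e1 <= e * Cmod (f z) ^ 2 / 2 by apply: Rmin_r.
have q : Cmod (f z) / 2 < Cmod (f z').
  have := Cmod_sub_ge (f z) (f z' ); have -> : (f z - f z' = - (f z' - f z))%C by ring.
  by rewrite Cmod_opp; lra.
have nz' : f z' <> RtoC 0 by apply/Cmod_gt_0; lra.
rewrite (_ : / f z' - / f z = - ((f z' - f z) / (f z' * f z)))%C; last by field.
rewrite Cmod_opp Cmod_div; last by apply: Cmult_neq_0.
rewrite Cmod_mult; apply/Rlt_div_l; first by nra.
have : e * (Cmod (f z') * Cmod (f z)) > e * (Cmod (f z) / 2 * Cmod (f z)) by nra.
rewrite /= in l2; nra.
Qed.

Lemma ccont_comp f h z : ccont h z -> ccont f (h z) -> ccont (fun x => f (h x)) z.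
Proof.
move=> ch cf e e0; have [d1 d10 h1] := cf e e0; have [d2 d20 h2] := ch d1 d10.
by exists d2 => // z' /h2 /h1.
Qed.

Lemma ccont_ext f h z : (forall x, f x = h x) -> ccont f z -> ccont h z.
Proof.
by move=> e cf eps e0; have [d d0 hd] := cf eps e0; exists d => // z' /hd; rewrite !e.
Qed.

Lemma ccont_local f h z r : 0 < r -> (forall x, Cmod (x - z) < r -> f x = h x) ->
  ccont f z -> ccont h z.
Proof.
move=> r0 e cf eps e0; have [d d0 hd] := cf eps e0; exists (Rmin d r); first exact: Rmin_glb_lt.
move=> z' hz; have hr := Rlt_le_trans _ _ _ hz (Rmin_r _ _).
rewrite -(e z') // -(e z); last by rewrite (_ : z - z = 0)%C ?Cmod_0 //; ring.
by apply: hd; apply: Rlt_le_trans hz (Rmin_l _ _).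
Qed.

Lemma cdiff_ccont f z : cdiff f z -> ccont f z.
Proof.
move=> [phi cp e]; apply: (@ccont_ext (fun x => f z + phi x * (x + - z))%C).
  by move=> x; rewrite [RHS]e.
apply: ccontD; first exact: ccont_const.
by apply: ccontM => //; apply: ccontD; [apply: ccont_id | apply: ccont_const].
Qed.

(* A difference quotient is completed at z by the derivative. *)
Lemma cdiff_of_quotient f z d :
  (forall eps, 0 < eps -> exists2 del, 0 < del & forall z', Cmod (z' - z) < del ->
     Cmod (f z' - f z - d * (z' - z)) <= eps * Cmod (z' - z)) -> cdiff f z.
Proof.
move=> h; exists (fun x => if Ceq_dec x z then d else (f x - f z) / (x - z))%C; last first.
  move=> x; case: (Ceq_dec x z) => [e|ne] /=; first by rewrite e; ring.
  field => e; apply: ne; have -> : x = (x - z + z)%C by ring.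
  by rewrite e; ring.
move=> e e0; have [del d0 hd] := h (e / 2) ltac:(lra); exists del => // x /hd hx.
case: (Ceq_dec z z) => [e1|e1] //=; case: (Ceq_dec x z) => [e2|ne] /=.
  by rewrite (_ : d - d = 0)%C ?Cmod_0 //; ring.
have nz : (x - z)%C <> RtoC 0.
  by move=> e'; apply: ne; have -> : x = (x - z + z)%C by [ring]; rewrite e'; ring.
rewrite (_ : (f x - f z) / (x - z) - d = (f x - f z - d * (x - z)) / (x - z))%C; last by field.
have p : 0 < Cmod (x - z) by apply/Cmod_gt_0.
rewrite Cmod_div //; apply/Rlt_div_l => //; nra.
Qed.

Lemma cdiff_estimate f z : cdiff f z -> exists d,
  forall eps, 0 < eps -> exists2 del, 0 < del & forall z', Cmod (z' - z) < del ->
     Cmod (f z' - f z - d * (z' - z)) <= eps * Cmod (z' - z).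
Proof.
move=> [phi cp e]; exists (phi z) => eps e0; have [del d0 hd] := cp eps e0.
exists del => // x /hd hx; rewrite e.
rewrite (_ : f z + phi x * (x - z) - f z - phi z * (x - z) = (phi x - phi z) * (x - z))%C; last by ring.
by rewrite Cmod_mult; apply: Rmult_le_compat_r; [apply: Cmod_ge_0 | lra].
Qed.

Lemma cdiff_local f h z r : 0 < r -> (forall x, Cmod (x - z) < r -> f x = h x) ->
  cdiff f z -> cdiff h z.
Proof.
move=> r0 e /cdiff_estimate[d hd]; apply: (@cdiff_of_quotient _ _ d) => eps e0.
have [del d0 hdel] := hd eps e0; exists (Rmin del r); first exact: Rmin_glb_lt.
move=> x hx; rewrite -(e x); last exact: Rlt_le_trans hx (Rmin_r _ _).
rewrite -(e z); last by rewrite (_ : z - z = 0)%C ?Cmod_0 //; ring.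
by apply: hdel; apply: Rlt_le_trans hx (Rmin_l _ _).
Qed.

Lemma cdiff_ext f h z : (forall x, f x = h x) -> cdiff f z -> cdiff h z.
Proof. by move=> e; apply: (@cdiff_local f h z 1); [lra | move=> x _]. Qed.

Lemma cdiff_const c z : cdiff (fun _ => c) z.
Proof. by exists (fun=> RtoC 0); [apply: ccont_const | move=> z'; ring]. Qed.

Lemma cdiff_id z : cdiff (fun x => x) z.
Proof. by exists (fun=> RtoC 1); [apply: ccont_const | move=> z'; ring]. Qed.

Lemma cdiffD f h z : cdiff f z -> cdiff h z -> cdiff (fun x => f x + h x)%C z.
Proof.
move=> [p cp ep] [q cq eq]; exists (fun x => p x + q x)%C; first exact: ccontD.
by move=> x; rewrite (ep x) (eq x); ring.
Qed.

Lemma cdiffM f h z : cdiff f z -> cdiff h z -> cdiff (fun x => f x * h x)%C z.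
Proof.
move=> df dh; have ch := cdiff_ccont dh; case: df dh => [p cp ep] [q cq eq].
exists (fun x => p x * h x + f z * q x)%C.
  by apply: ccontD; apply: ccontM => //; apply: ccont_const.
by move=> x; rewrite (ep x) {1}(eq x); rewrite {1}(eq x); ring.
Qed.

Lemma cdiffV f z : cdiff f z -> f z <> RtoC 0 -> cdiff (fun x => / f x)%C z.
Proof.
move=> df nz; have cf := cdiff_ccont df; have p : 0 < Cmod (f z) by apply/Cmod_gt_0.
have [d d0 hd] := cf _ p; case: (df) => [q cq eq].
have nz' x : Cmod (x - z) < d -> f x <> RtoC 0.
  move=> /hd h e; move: h; rewrite e (_ : 0 - f z = - f z)%C; last by ring.
  by rewrite Cmod_opp; lra.
have e0 x : Cmod (x - z) < d -> (/ f x = / f z + - q x / (f x * f z) * (x - z))%C.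
  move=> hx; have n1 := nz' x hx.
  have e1 : (f x - f z = q x * (x - z))%C by rewrite (eq x); ring.
  have -> : (/ f z + - q x / (f x * f z) * (x - z) = / f z - q x * (x - z) / (f x * f z))%C.
    by field.
  by rewrite -e1; field.
apply: (@cdiff_local (fun x => / f z + - q x / (f x * f z) * (x - z))%C _ _ d) => //.
  by move=> x /e0.
exists (fun x => - q x / (f x * f z))%C; last by move=> x; ring.
apply: ccontM.
  apply: (@ccont_ext (fun x => - (1) * q x)%C) => [x|]; first by ring.
  by apply: ccontM => //; apply: ccont_const.
apply: ccontV; last exact: Cmult_neq_0.
by apply: ccontM => //; apply: ccont_const.
Qed.

Lemma cdiff_comp f h z : cdiff h z -> cdiff f (h z) -> cdiff (fun x => f (h x)) z.
Proof.
move=> dh [p cp ep]; have ch := cdiff_ccont dh; case: dh => [q cq eq].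
exists (fun x => p (h x) * q x)%C; first by apply: ccontM => //; apply: ccont_comp.
by move=> x; rewrite ep {2}(eq x); ring.
Qed.

Lemma cdiffZ c f z : cdiff f z -> cdiff (fun x => c * f x)%C z.
Proof. by move=> h; apply: cdiffM => //; apply: cdiff_const. Qed.

Lemma cdiffN f z : cdiff f z -> cdiff (fun x => - f x)%C z.
Proof.
by move=> h; apply: cdiff_ext (cdiffZ (- (1)) h) => x; ring.
Qed.

Lemma cdiffB f h z : cdiff f z -> cdiff h z -> cdiff (fun x => f x - h x)%C z.
Proof. by move=> df dh; apply: cdiffD => //; apply: cdiffN. Qed.

Lemma cdiff_pow f z n : cdiff f z -> cdiff (fun x => f x ^ n)%C z.
Proof.
move=> h; elim: n => [|n IH]; first exact: cdiff_const.
exact: cdiffM.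
Qed.

Lemma cdiff_sub w z : cdiff (fun x => x - w)%C z.
Proof. by apply: cdiffB; [apply: cdiff_id | apply: cdiff_const]. Qed.

Lemma cdiff_csum (T : finType) (f : T -> C -> C) z :
  (forall a, cdiff (f a) z) -> cdiff (fun x => csum (fun a => f a x)) z.
Proof.
move=> h; rewrite /csum; elim: (index_enum T) => [|a s IH].
  by apply: (@cdiff_ext (fun _ => RtoC 0)) => [x|]; [rewrite big_nil | apply: cdiff_const].
apply: (@cdiff_ext (fun x => f a x + \big[Cplus/RtoC 0]_(b <- s) f b x)%C) => [x|].
  by rewrite big_cons.
exact: cdiffD.
Qed.

Definition rcont (h : R -> C) (t : R) : Prop :=
  forall eps, 0 < eps -> exists2 del, 0 < del &
    forall t', Rabs (t' - t) < del -> Cmod (h t' - h t) < eps.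

Definition rcont_on (h : R -> C) (a b : R) : Prop := forall t, a <= t <= b -> rcont h t.

Definition CInt (h : R -> C) (a b : R) : C :=
  (RInt (fun t => Re (h t)) a b, RInt (fun t => Im (h t)) a b).

Lemma rcont_Re h t : rcont h t -> continuous (fun t => Re (h t)) t.
Proof.
move=> ch; apply/filterlim_locally => eps; have [d d0 hd] := ch eps (cond_pos eps).
exists (mkposreal d d0) => y hy; apply: Rle_lt_trans (hd y hy).
exact: re_le_Cmod (h y - h t)%C.
Qed.

Lemma rcont_Im h t : rcont h t -> continuous (fun t => Im (h t)) t.
Proof.
move=> ch; apply/filterlim_locally => eps; have [d d0 hd] := ch eps (cond_pos eps).
exists (mkposreal d d0) => y hy; apply: Rle_lt_trans (hd y hy).
exact: im_le_Cmod (h y - h t)%C.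
Qed.

Lemma ex_RInt_Re h a b : a <= b -> rcont_on h a b -> ex_RInt (fun t => Re (h t)) a b.
Proof.
move=> ab ch; apply: (ex_RInt_continuous (V := R_CompleteNormedModule)) => t.
by rewrite Rmin_left // Rmax_right // => ht; apply: rcont_Re; apply: ch.
Qed.

Lemma ex_RInt_Im h a b : a <= b -> rcont_on h a b -> ex_RInt (fun t => Im (h t)) a b.
Proof.
move=> ab ch; apply: (ex_RInt_continuous (V := R_CompleteNormedModule)) => t.
by rewrite Rmin_left // Rmax_right // => ht; apply: rcont_Im; apply: ch.
Qed.

Lemma eq_CInt h k a b : a <= b -> (forall t, a <= t <= b -> h t = k t) -> CInt h a b = CInt k a b.
Proof.
move=> ab e; rewrite /CInt; congr pair; apply: RInt_ext => t;
by rewrite Rmin_left // Rmax_right // => ht; rewrite e //; lra.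
Qed.

Lemma CInt_bound h a b M : a <= b -> rcont_on h a b ->
  (forall t, a <= t <= b -> Cmod (h t) <= M) -> Cmod (CInt h a b) <= 2 * M * (b - a).
Proof.
move=> ab ch hM; apply: Rle_trans (Cmod_le_abs _) _.
have -> : 2 * M * (b - a) = (b - a) * M + (b - a) * M by ring.
apply: Rplus_le_compat; apply: abs_RInt_le_const => //.
- exact: ex_RInt_Re.
- by move=> t ht; apply: Rle_trans (re_le_Cmod _) (hM t ht).
- exact: ex_RInt_Im.
- by move=> t ht; apply: Rle_trans (im_le_Cmod _) (hM t ht).
Qed.

Lemma CIntD h k a b : a <= b -> rcont_on h a b -> rcont_on k a b ->
  CInt (fun t => h t + k t)%C a b = (CInt h a b + CInt k a b)%C.
Proof.
move=> ab ch ck; apply: injective_projections.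
- exact: (RInt_plus (V := R_CompleteNormedModule) _ _ a b (ex_RInt_Re ab ch) (ex_RInt_Re ab ck)).
- exact: (RInt_plus (V := R_CompleteNormedModule) _ _ a b (ex_RInt_Im ab ch) (ex_RInt_Im ab ck)).
Qed.

Lemma CIntZ c h a b : a <= b -> rcont_on h a b ->
  CInt (fun t => c * h t)%C a b = (c * CInt h a b)%C.
Proof.
move=> ab ch; have hr := ex_RInt_Re ab ch; have hi := ex_RInt_Im ab ch.
case: c => p q; apply: injective_projections.
  have := RInt_minus (V := R_CompleteNormedModule) _ _ a b (ex_RInt_scal _ _ _ p hr) (ex_RInt_scal _ _ _ q hi).
  rewrite (RInt_scal (V := R_CompleteNormedModule) _ _ _ p hr).
  rewrite (RInt_scal (V := R_CompleteNormedModule) _ _ _ q hi) => e; exact: e.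
have := RInt_plus (V := R_CompleteNormedModule) _ _ a b (ex_RInt_scal _ _ _ p hi) (ex_RInt_scal _ _ _ q hr).
rewrite (RInt_scal (V := R_CompleteNormedModule) _ _ _ p hi).
rewrite (RInt_scal (V := R_CompleteNormedModule) _ _ _ q hr) => e; exact: e.
Qed.

Lemma rcont_on_sub h a b a' b' : a <= a' -> b' <= b -> rcont_on h a b -> rcont_on h a' b'.
Proof. by move=> ha hb ch t ht; apply: ch; lra. Qed.

Lemma CInt_Chasles h a m b : a <= m <= b -> rcont_on h a b ->
  CInt h a b = (CInt h a m + CInt h m b)%C.
Proof.
move=> [am mb] ch.
have c1 : rcont_on h a m by apply: rcont_on_sub ch; lra.
have c2 : rcont_on h m b by apply: rcont_on_sub ch; lra.
apply: injective_projections.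
- exact: esym (RInt_Chasles _ a m b (ex_RInt_Re am c1) (ex_RInt_Re mb c2)).
- exact: esym (RInt_Chasles _ a m b (ex_RInt_Im am c1) (ex_RInt_Im mb c2)).
Qed.

Local Ltac real_field := match goal with |- @eq _ ?x ?y => change (@eq R x y); field end.

Lemma RInt_affine al be a b :
  RInt (fun t => al + be * t) a b = al * (b - a) + be * (b ^ 2 - a ^ 2) / 2.
Proof.
apply: is_RInt_unique.
have -> : al * (b - a) + be * (b ^ 2 - a ^ 2) / 2 =
  minus ((fun t => al * t + be * t ^ 2 / 2) b) ((fun t => al * t + be * t ^ 2 / 2) a).
  by rewrite /minus /plus /opp /=; field.
apply: (is_RInt_derive (fun t => al * t + be * t ^ 2 / 2) (fun t => al + be * t)) => t _.
  by auto_derive => //; field.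
apply: continuous_plus; first exact: continuous_const.
by apply: continuous_mult; [apply: continuous_const | apply: continuous_id].
Qed.

Definition rect_int (f : C -> C) (a b c d : R) : C :=
  (CInt (fun x => f (x, c)) a b + Ci * CInt (fun y => f (b, y)) c d
   - CInt (fun x => f (x, d)) a b - Ci * CInt (fun y => f (a, y)) c d)%C.

Definition ccont_rect f a b c d : Prop :=
  forall x y, a <= x <= b -> c <= y <= d -> ccont f (x, y).

Lemma Cmod_re_part x x' y : Cmod ((x', y) - (x, y)) = Rabs (x' - x).
Proof.
have -> : ((x', y) - (x, y) = RtoC (x' - x))%C.
  by apply: injective_projections => /=; ring.
exact: Cmod_R.
Qed.

Lemma Cmod_im_part x y y' : Cmod ((x, y') - (x, y)) = Rabs (y' - y).
Proof.
have -> : ((x, y') - (x, y) = Ci * RtoC (y' - y))%C.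
  by apply: injective_projections => /=; ring.
by rewrite Cmod_mult Cmod_Ci Cmod_R Rmult_1_l.
Qed.

Lemma ccont_rcont_h f x y : ccont f (x, y) -> rcont (fun x => f (x, y)) x.
Proof.
move=> cf e e0; have [d d0 hd] := cf e e0; exists d => // t ht; apply: hd.
by rewrite Cmod_re_part.
Qed.

Lemma ccont_rcont_v f x y : ccont f (x, y) -> rcont (fun y => f (x, y)) y.
Proof.
move=> cf e e0; have [d d0 hd] := cf e e0; exists d => // t ht; apply: hd.
by rewrite Cmod_im_part.
Qed.

Lemma ccont_rect_h f a b c d y : ccont_rect f a b c d -> c <= y <= d ->
  rcont_on (fun x => f (x, y)) a b.
Proof. by move=> cf hy x hx; apply: (ccont_rcont_h (f := f)); apply: cf. Qed.

Lemma ccont_rect_v f a b c d x : ccont_rect f a b c d -> a <= x <= b ->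
  rcont_on (fun y => f (x, y)) c d.
Proof. by move=> cf hx y hy; apply: (ccont_rcont_v (f := f)); apply: cf. Qed.

(** The only case of Cauchy's theorem that is computed by hand; a differentiable function is
    compared with its affine part. *)
Lemma rect_int_affine A B z0 a b c d :
  rect_int (fun z => A + B * (z - z0))%C a b c d = RtoC 0.
Proof.
have h (y p q : R) : CInt (fun x => A + B * ((x, y) - z0))%C p q =
   ((A + B * ((0, y) - z0)) * RtoC (q - p) + B * RtoC ((q ^ 2 - p ^ 2) / 2))%C.
  rewrite /CInt; case: A => a1 a2; case: B => b1 b2; case: z0 => u v.
  apply: injective_projections.
    rewrite {1}/fst (RInt_ext _ (fun t => (a1 - b1 * u - b2 * (y - v)) + b1 * t)).
      by rewrite RInt_affine /=; real_field.
    by move=> t _; rewrite /Re /=; ring.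
  rewrite {1}/snd (RInt_ext _ (fun t => (a2 + b1 * (y - v) - b2 * u) + b2 * t)).
    by rewrite RInt_affine /=; real_field.
  by move=> t _; rewrite /Im /=; ring.
have v (x p q : R) : CInt (fun y => A + B * ((x, y) - z0))%C p q =
   ((A + B * ((x, 0) - z0)) * RtoC (q - p) + Ci * B * RtoC ((q ^ 2 - p ^ 2) / 2))%C.
  clear h; rewrite /CInt; case: A => a1 a2; case: B => b1 b2; case: z0 => u v.
  apply: injective_projections.
    rewrite {1}/fst (RInt_ext _ (fun t => (a1 + b1 * (x - u) + b2 * v) + (- b2) * t)).
      by rewrite RInt_affine /=; real_field.
    by move=> t _; rewrite /Re /=; ring.
  rewrite {1}/snd (RInt_ext _ (fun t => (a2 - b1 * v + b2 * (x - u)) + b1 * t)).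
    by rewrite RInt_affine /=; real_field.
  by move=> t _; rewrite /Im /=; ring.
rewrite /rect_int !h !v; clear h v; case: A => a1 a2; case: B => b1 b2; case: z0 => u w.
by apply: injective_projections => /=; field.
Qed.

Lemma rect_intD f h a b c d : a <= b -> c <= d ->
  ccont_rect f a b c d -> ccont_rect h a b c d ->
  rect_int (fun z => f z + h z)%C a b c d = (rect_int f a b c d + rect_int h a b c d)%C.
Proof.
move=> ab cd cf ch; rewrite /rect_int.
have lec : c <= c <= d by lra.
have led : c <= d <= d by lra.
have lea : a <= a <= b by lra.
have leb : a <= b <= b by lra.
rewrite (CIntD ab (ccont_rect_h cf lec) (ccont_rect_h ch lec)).
rewrite (CIntD ab (ccont_rect_h cf led) (ccont_rect_h ch led)).
rewrite (CIntD cd (ccont_rect_v cf lea) (ccont_rect_v ch lea)).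
rewrite (CIntD cd (ccont_rect_v cf leb) (ccont_rect_v ch leb)).
ring.
Qed.

Lemma rect_int_bound f a b c d M : a <= b -> c <= d -> ccont_rect f a b c d ->
  (forall x y, a <= x <= b -> c <= y <= d -> Cmod (f (x, y)) <= M) ->
  Cmod (rect_int f a b c d) <= 4 * M * ((b - a) + (d - c)).
Proof.
move=> ab cd cf hM.
have lec : c <= c <= d by lra.
have led : c <= d <= d by lra.
have lea : a <= a <= b by lra.
have leb : a <= b <= b by lra.
have h1 := CInt_bound ab (ccont_rect_h cf lec) (fun t ht => hM t c ht lec).
have h2 := CInt_bound ab (ccont_rect_h cf led) (fun t ht => hM t d ht led).
have h3 := CInt_bound cd (ccont_rect_v cf lea) (fun t ht => hM a t lea ht).
have h4 := CInt_bound cd (ccont_rect_v cf leb) (fun t ht => hM b t leb ht).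
rewrite /rect_int /Cminus.
apply: Rle_trans (Cmod_triangle _ _) _; rewrite Cmod_opp Cmod_mult Cmod_Ci Rmult_1_l.
have := Cmod_triangle (CInt (fun x => f (x, c)) a b + Ci * CInt (fun y => f (b, y)) c d)
  (- CInt (fun x => f (x, d)) a b).
have := Cmod_triangle (CInt (fun x => f (x, c)) a b) (Ci * CInt (fun y => f (b, y)) c d).
rewrite Cmod_opp Cmod_mult Cmod_Ci Rmult_1_l; lra.
Qed.

Lemma ccont_rect_sub f a b c d a' b' c' d' : a <= a' -> b' <= b -> c <= c' -> d' <= d ->
  ccont_rect f a b c d -> ccont_rect f a' b' c' d'.
Proof. by move=> ? ? ? ? cf x y hx hy; apply: cf; lra. Qed.

Lemma rect_int_split_h f a m b c d : a <= m <= b -> c <= d -> ccont_rect f a b c d ->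
  rect_int f a b c d = (rect_int f a m c d + rect_int f m b c d)%C.
Proof.
move=> hm cd cf; rewrite /rect_int.
have lec : c <= c <= d by lra.
have led : c <= d <= d by lra.
rewrite (CInt_Chasles hm (ccont_rect_h cf lec)) (CInt_Chasles hm (ccont_rect_h cf led)).
ring.
Qed.

Lemma rect_int_split_v f a b c m d : a <= b -> c <= m <= d -> ccont_rect f a b c d ->
  rect_int f a b c d = (rect_int f a b c m + rect_int f a b m d)%C.
Proof.
move=> ab hm cf; rewrite /rect_int.
have lea : a <= a <= b by lra.
have leb : a <= b <= b by lra.
rewrite (CInt_Chasles hm (ccont_rect_v cf lea)) (CInt_Chasles hm (ccont_rect_v cf leb)).
ring.
Qed.

(** The affine part integrates to zero, and the remainder is at most eps times the distance to (x0,
    y0), integrated over a perimeter of the same order. *)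
Lemma rect_int_small f x0 y0 eps : 0 < eps -> cdiff f (x0, y0) ->
  exists2 del, 0 < del & forall a b c d, a <= x0 <= b -> c <= y0 <= d ->
    b - a < del -> d - c < del -> ccont_rect f a b c d ->
    Cmod (rect_int f a b c d) <= 4 * eps * ((b - a) + (d - c)) ^ 2.
Proof.
move=> e0 /cdiff_estimate[D hD]; have [r r0 hr] := hD eps e0.
exists (r / 2); first lra.
move=> a b c d hx hy hab hcd cf.
pose aff z := (f (x0, y0) + D * (z - (x0, y0)))%C.
pose rem z := (f z + - (1) * aff z)%C.
have caff z : ccont aff z.
  apply: cdiff_ccont; apply: cdiffD; first exact: cdiff_const.
  by apply: cdiffZ; apply: cdiff_sub.
have crem : ccont_rect rem a b c d.
  move=> x y hx' hy'; apply: ccontD; first exact: cf.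
  by apply: ccontM; [apply: ccont_const | apply: caff].
have -> : rect_int f a b c d = (rect_int rem a b c d + rect_int aff a b c d)%C.
  have haff : ccont_rect aff a b c d by move=> x y _ _; apply: caff.
  rewrite -(rect_intD _ _ crem haff); [|lra|lra].
  by congr rect_int; apply: FunctionalExtensionality.functional_extensionality => z; rewrite /rem; ring.
rewrite rect_int_affine Cplus_0_r.
have -> : 4 * eps * (b - a + (d - c)) ^ 2 = 4 * (eps * (b - a + (d - c))) * (b - a + (d - c)) by ring.
apply: rect_int_bound => //; try lra.
move=> x y hx' hy'.
have hz : Cmod ((x, y) - (x0, y0)) <= b - a + (d - c).
  have -> : ((x, y) - (x0, y0) = ((x, y) - (x0, y)) + ((x0, y) - (x0, y0)))%C by ring.
  apply: Rle_trans (Cmod_triangle _ _) _; rewrite Cmod_re_part Cmod_im_part.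
  by apply: Rplus_le_compat; apply: Rabs_le; lra.
have := hr (x, y) ltac:(lra).
rewrite (_ : f (x, y) - f (x0, y0) - D * ((x, y) - (x0, y0)) = rem (x, y))%C; last by rewrite /rem /aff; ring.
by move=> h; apply: Rle_trans h _; apply: Rmult_le_compat_l; lra.
Qed.

Lemma rect_int_quarter f x y u v : 0 <= u -> 0 <= v ->
  ccont_rect f x (x + (u + u)) y (y + (v + v)) ->
  exists x' y', [/\ x' = x \/ x' = x + u, y' = y \/ y' = y + v &
    Cmod (rect_int f x (x + (u + u)) y (y + (v + v))) <=
    4 * Cmod (rect_int f x' (x' + u) y' (y' + v))].
Proof.
move=> u0 v0 cf.
have e : rect_int f x (x + (u + u)) y (y + (v + v)) =
  (rect_int f x (x + u) y (y + v) + rect_int f x (x + u) (y + v) (y + v + v) +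
   (rect_int f (x + u) (x + u + u) y (y + v) +
    rect_int f (x + u) (x + u + u) (y + v) (y + v + v)))%C.
  rewrite (@rect_int_split_h f x (x + u)) //; try lra.
  rewrite (@rect_int_split_v f x (x + u) y (y + v)); try lra; last first.
    by apply: ccont_rect_sub cf; lra.
  rewrite (@rect_int_split_v f (x + u) _ y (y + v)); try lra; last first.
    by apply: ccont_rect_sub cf; lra.
  by rewrite -!Rplus_assoc.
move: e; set J := rect_int f x _ y _; set J1 := rect_int f x (x + u) y (y + v).
set J2 := rect_int f x (x + u) (y + v) _; set J3 := rect_int f (x + u) _ y _.
set J4 := rect_int f (x + u) _ (y + v) _ => e.
have tri : Cmod J <= Cmod J1 + Cmod J2 + (Cmod J3 + Cmod J4).
  rewrite e; apply: Rle_trans (Cmod_triangle _ _) _.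
  by apply: Rplus_le_compat; apply: Cmod_triangle.
case: (Rle_dec (Cmod J) (4 * Cmod J1)) => [h|h1]; first by exists x, y; split; [left|left|].
case: (Rle_dec (Cmod J) (4 * Cmod J2)) => [h|h2]; first by exists x, (y + v); split; [left|right|].
case: (Rle_dec (Cmod J) (4 * Cmod J3)) => [h|h3]; first by exists (x + u), y; split; [right|left|].
exists (x + u), (y + v); split; [by right|by right|]; rewrite -/J4; lra.
Qed.

Lemma nested_point (x : nat -> R) (w : R) : 0 <= w ->
  (forall n, x n <= x n.+1) -> (forall n, x n.+1 + w / 2 ^ n.+1 <= x n + w / 2 ^ n) ->
  exists z, forall n, x n <= z <= x n + w / 2 ^ n.
Proof.
move=> w0 hx hy.
have wp n : 0 <= w / 2 ^ n by apply: Rdiv_le_0_compat => //; apply: pow_lt; lra.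
have mono n k : x n <= x (n + k)%nat.
  elim: k => [|k IH]; first by rewrite addn0; lra.
  by rewrite addnS; apply: Rle_trans IH (hx _).
have anti n k : x (n + k)%nat + w / 2 ^ (n + k) <= x n + w / 2 ^ n.
  elim: k => [|k IH]; first by rewrite addn0; lra.
  by rewrite addnS; apply: Rle_trans (hy _) IH.
have bnd m n : x m <= x n + w / 2 ^ n.
  case: (leqP m n) => h.
    by rewrite -(subnKC h); have := mono m (n - m)%nat; have := wp (m + (n - m))%nat; lra.
  by have := anti n (m - n)%nat; rewrite (subnKC (ltnW h)); have := wp m; lra.
have [||z [ub lub]] := completeness (fun r => exists n, r = x n).
- by exists (x 0%nat + w / 2 ^ 0) => r [n ->]; apply: bnd.
- by exists (x 0%nat); exists 0%nat.
exists z => n; split; first by apply: ub; exists n.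
by apply: lub => r [m ->]; apply: bnd.
Qed.

Section Goursat.
Variables (f : C -> C) (a b c d : R).
Hypotheses (ab : a <= b) (cd : c <= d).
Hypothesis df : forall x y, a <= x <= b -> c <= y <= d -> cdiff f (x, y).

Let W := b - a.
Let H := d - c.
Let size (l : R) n := l / 2 ^ n.

Let cell (n : nat) (p : R * R) : C :=
  rect_int f p.1 (p.1 + size W n) p.2 (p.2 + size H n).

Let inside (n : nat) (p : R * R) : Prop :=
  a <= p.1 /\ p.1 + size W n <= b /\ c <= p.2 /\ p.2 + size H n <= d.

Let child (n : nat) (p q : R * R) : Prop :=
  [/\ p.1 <= q.1, q.1 + size W n.+1 <= p.1 + size W n,
      p.2 <= q.2, q.2 + size H n.+1 <= p.2 + size H n &
      Cmod (cell n p) <= 4 * Cmod (cell n.+1 q)].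

Lemma bisection_child n p : inside n p -> exists q, inside n.+1 q /\ child n p q.
Proof.
move=> [h1 [h2 [h3 h4]]].
have W0 : 0 <= W by rewrite /W; lra.
have H0 : 0 <= H by rewrite /H; lra.
have p2 : 0 < 2 ^ n by apply: pow_lt; lra.
have half l : size l n = size l n.+1 + size l n.+1 by rewrite /size /=; field; lra.
have s0 l : 0 <= l -> 0 <= size l n.+1.
  by move=> l0; apply: Rdiv_le_0_compat => //; apply: pow_lt; lra.
rewrite !half in h2 h4.
have [||| x' [y' [hx hy hJ]]] := @rect_int_quarter f p.1 p.2 (size W n.+1) (size H n.+1).
- exact: s0.
- exact: s0.
- by move=> x y hx hy; apply: cdiff_ccont; apply: df; lra.
have := s0 W W0; have := s0 H H0 => q1 q2.
exists (x', y'); split; first by repeat split => /=; case: hx => ex; case: hy => ey; lra.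
split=> /=; rewrite ?half; try (by case: hx => ex; case: hy => ey; lra).
by rewrite /cell !half.
Qed.

Let start : {p | inside 0 p}.
Proof. by exists (a, c); rewrite /inside /size /W /H /=; repeat split; lra. Defined.

(** Dependent choice, the invariant [inside] travelling with the corner. [start] ends with
    [Defined], so that the first corner reduces to (a, c). *)
Let path : forall n, {p | inside n p} :=
  fix path n := match n with
  | 0%nat => start
  | m.+1 => let q := constructive_indefinite_description _ (bisection_child (proj2_sig (path m)))
            in exist _ (proj1_sig q) (proj1 (proj2_sig q))
  end.

Lemma bisection : exists p : nat -> R * R, p 0%nat = (a, c) /\
  forall n, inside n (p n) /\ child n (p n) (p n.+1).
Proof.
exists (fun n => proj1_sig (path n)); split=> // n; split; first exact: proj2_sig (path n).
exact: (proj2 (proj2_sig (constructive_indefinite_description _ (bisection_child (proj2_sig (path n)))))).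
Qed.

Lemma goursat : rect_int f a b c d = RtoC 0.
Proof.
have W0 : 0 <= W by rewrite /W; lra.
have H0 : 0 <= H by rewrite /H; lra.
have [p [p0 hp]] := bisection.
have hin n : inside n (p n) := proj1 (hp n).
have hch n := proj2 (hp n).
have [|z1 hz1] := @nested_point (fun n => (p n).1) W W0 (fun n => let: And5 h _ _ _ _ := hch n in h).
  by move=> n; case: (hch n).
have [|z2 hz2] := @nested_point (fun n => (p n).2) H H0 (fun n => let: And5 _ _ h _ _ := hch n in h).
  by move=> n; case: (hch n).
have p2 n : 0 < 2 ^ n by apply: pow_lt; lra.
have hJ n : Cmod (rect_int f a b c d) <= 4 ^ n * Cmod (cell n (p n)).
  elim: n => [|n IH].
    have eb : a + size W 0 = b by rewrite /size /W /=; field.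
    have ed : c + size H 0 = d by rewrite /size /H /=; field.
    have -> : cell 0 (p 0%nat) = rect_int f a b c d by rewrite /cell p0 /fst /snd eb ed.
    by rewrite [4 ^ 0]/= Rmult_1_l; apply: Rle_refl.
  case: (hch n) => _ _ _ _ h; apply: Rle_trans IH _; rewrite (_ : 4 ^ n.+1 = 4 * 4 ^ n) //.
  have : 0 < 4 ^ n by apply: pow_lt; lra.
  nra.
apply: Cmod_eq_0; apply: Rle_antisym; last exact: Cmod_ge_0.
apply: Rnot_lt_le => pos; set J := Cmod _ in pos.
pose D := W + H + 1; have D1 : 1 <= D by rewrite /D; lra.
(* The squared size of the n-th cell cancels the factor 4^n of [hJ], and there remains J <= 4 eps (W
   + H)^2 <= J / 2. The 1 in [D] covers degenerate rectangles. *)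
pose eps := J / (8 * D ^ 2).
have D2 : 0 < D ^ 2 by apply: pow_lt; lra.
have e0 : 0 < eps by apply: Rdiv_lt_0_compat; lra.
have z12 : a <= z1 <= b /\ c <= z2 <= d.
  have := hz1 0%nat; have := hz2 0%nat; rewrite p0 /= /W /H.
  by rewrite /Rdiv Rinv_1 !Rmult_1_r; lra.
have [del d0 hdel] := rect_int_small e0 (df (proj1 z12) (proj2 z12)).
have [n hn] := geo_small D (ltac:(lra) : 0 <= / 2 < 1) (ltac:(lra) : 0 < del / 2).
have {}hn := hn n (le_n n).
have hs l : 0 <= l < D -> size l n < del.
  move=> hl; rewrite /size; have -> : l / 2 ^ n = l * (/ 2) ^ n by rewrite pow_inv.
  have : 0 < (/ 2) ^ n by apply: pow_lt; lra.
  by move=> q; have : l * (/ 2) ^ n <= D * (/ 2) ^ n; [apply: Rmult_le_compat_r; lra | lra].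
have [i1 [i2 [i3 i4]]] := hin n.
have := hdel (p n).1 ((p n).1 + size W n) (p n).2 ((p n).2 + size H n) (hz1 n) (hz2 n).
have -> : (p n).1 + size W n - (p n).1 = size W n by ring.
have -> : (p n).2 + size H n - (p n).2 = size H n by ring.
move=> /(_ (hs W ltac:(rewrite /D; lra)) (hs H ltac:(rewrite /D; lra))).
have cf : ccont_rect f (p n).1 ((p n).1 + size W n) (p n).2 ((p n).2 + size H n).
  by move=> x y hx hy; apply: cdiff_ccont; apply: df; lra.
move=> /(_ cf); rewrite -/(cell n (p n)) => h1.
have h2 := hJ n; rewrite -/J in h2.
have e4 : 4 ^ n = 2 ^ n * 2 ^ n by rewrite -Rpow_mult_distr; congr pow; ring.
have e1 : 4 ^ n * (4 * eps * (size W n + size H n) ^ 2) = 4 * eps * (W + H) ^ 2.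
  by rewrite e4 /size; field; have := p2 n; lra.
have p4 : 0 < 4 ^ n by apply: pow_lt; lra.
have h3 : J <= 4 * eps * (W + H) ^ 2.
  by rewrite -e1; apply: Rle_trans h2 _; apply: Rmult_le_compat_l; lra.
have h4 : (W + H) ^ 2 <= D ^ 2 by apply: pow_incr; rewrite /D; lra.
have h5 : eps * D ^ 2 = J / 8 by rewrite /eps; field; lra.
nra.
Qed.

End Goursat.

(** * Circle means, Laurent series and the theorem of Liouville *)

Definition cexp (z : C) : C := (RtoC (exp (Re z)) * cis (Im z))%C.

Lemma cexpD y z : cexp (y + z) = (cexp y * cexp z)%C.
Proof.
rewrite /cexp re_plus (_ : Im (y + z) = Im y + Im z) // cis_add exp_plus RtoC_mult.
ring.
Qed.

Lemma Cmod_cexp z : Cmod (cexp z) = exp (Re z).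
Proof.
by rewrite /cexp Cmod_mult Cmod_cis Cmod_R Rmult_1_r Rabs_pos_eq //; apply: Rlt_le; apply: exp_pos.
Qed.

Lemma derivable_estimate f x l eps : derivable_pt_lim f x l -> 0 < eps ->
  exists2 del, 0 < del & forall h, Rabs h < del -> Rabs (f (x + h) - f x - l * h) <= eps * Rabs h.
Proof.
move=> hf e0; have [del hd] := hf eps e0; exists del; first exact: cond_pos.
move=> h hh; case: (Req_dec h 0) => [->|nz].
  by rewrite Rplus_0_r Rabs_R0 (_ : f x - f x - l * 0 = 0) ?Rabs_R0; lra.
have := hd h nz hh => h1.
have -> : f (x + h) - f x - l * h = ((f (x + h) - f x) / h - l) * h by field.
by rewrite Rabs_mult; apply: Rmult_le_compat_r; [apply: Rabs_pos | lra].
Qed.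

Lemma cexp_estimate0 eps : 0 < eps -> exists2 del, 0 < del &
  forall h, Cmod h < del -> Cmod (cexp h - 1 - h) <= eps * Cmod h.
Proof.
(* The two components together amount to at most 6 e |h|. The bound e <= 1 yields |exp x - 1| <= 2
   |x|, which with |h| < e / 2 makes the mixed term (exp x - 1) y small. *)
move=> e0; pose e := Rmin (eps / 6) 1.
have e6 : e <= eps / 6 by apply: Rmin_l.
have e1 : e <= 1 by apply: Rmin_r.
have ep : 0 < e by apply: Rmin_glb_lt; lra.
have [d1 d10 h1] := derivable_estimate (derivable_pt_lim_exp 0) ep.
have [d2 d20 h2] := derivable_estimate (derivable_pt_lim_cos 0) ep.
have [d3 d30 h3] := derivable_estimate (derivable_pt_lim_sin 0) ep.
have m1 := Rmin_l d1 d2; have m2 := Rmin_r d1 d2.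
set m12 := Rmin d1 d2 in m1 m2.
have m3 := Rmin_l m12 d3; have m4 := Rmin_r m12 d3; set m := Rmin m12 d3 in m3 m4.
have m5 := Rmin_l m (e / 2); have m6 := Rmin_r m (e / 2).
exists (Rmin m (e / 2)); first by repeat apply: Rmin_glb_lt; lra.
move=> h hh; have hx := re_le_Cmod h; have hy := im_le_Cmod h.
move: (h1 (Re h) ltac:(lra)) (h2 (Im h) ltac:(lra)) (h3 (Im h) ltac:(lra)).
rewrite !Rplus_0_l exp_0 cos_0 sin_0 Ropp_0 Rmult_0_l !Rmult_1_l.
have -> : (cexp h - 1 - h)%C =
  (exp (Re h) * (cos (Im h) - 1) + (exp (Re h) - 1 - Re h),
   exp (Re h) * (sin (Im h) - Im h) + (exp (Re h) - 1) * Im h).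
  by case: h {hh hx hy} => x y; apply: injective_projections; rewrite /Re /Im /=; ring.
move: (Re h) (Im h) hx hy => x y hx hy; set ex := exp x.
have ex0 : 0 < ex by apply: exp_pos.
rewrite !Rminus_0_r => q1 q2 q3.
have x0 := Rabs_pos x; have y0 := Rabs_pos y.
have a1 : Rabs (ex - 1) <= 2 * Rabs x.
  have -> : ex - 1 = (ex - 1 - x) + x by ring.
  by apply: Rle_trans (Rabs_triang _ _) _; nra.
have a2 : ex <= 2 by have := Rle_abs (ex - 1); lra.
apply: Rle_trans (Cmod_le_abs _) _; rewrite /Re /Im /=.
have b1 : Rabs (ex * (cos y - 1) + (ex - 1 - x)) <= 2 * e * Rabs y + e * Rabs x.
  apply: Rle_trans (Rabs_triang _ _) _; rewrite Rabs_mult (Rabs_pos_eq ex); last lra.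
  by have := Rabs_pos (cos y - 1); nra.
have b2 : Rabs (ex * (sin y - y) + (ex - 1) * y) <= 2 * e * Rabs y + e * Rabs y.
  apply: Rle_trans (Rabs_triang _ _) _; rewrite !Rabs_mult (Rabs_pos_eq ex); last lra.
  have h5 : Rabs (ex - 1) <= e by lra.
  by have := Rabs_pos (sin y - y); nra.
have := Cmod_ge_0 h; nra.
Qed.

Lemma cdiff_cexp z : cdiff cexp z.
Proof.
apply: (@cdiff_of_quotient _ _ (cexp z)) => eps e0.
have p : 0 < Cmod (cexp z) by rewrite Cmod_cexp; apply: exp_pos.
have [d d0 hd] := cexp_estimate0 (Rdiv_lt_0_compat _ _ e0 p); exists d => // x /hd h.
have -> : (cexp x - cexp z - cexp z * (x - z) = cexp z * (cexp (x - z) - 1 - (x - z)))%C.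
  have {1}-> : x = (z + (x - z))%C by ring.
  by rewrite cexpD; ring.
rewrite Cmod_mult; apply: Rle_trans (Rmult_le_compat_l _ _ _ (Rlt_le _ _ p) h) _.
by apply: Req_le; field; lra.
Qed.

Definition cpt (w : C) (r t : R) : C := (w + RtoC r * cis t)%C.

Definition ccirc (f : C -> C) (w : C) (r : R) : Prop := forall t, ccont f (cpt w r t).

(** This is the integral of f(z) dz / (2 pi i (z - w)) over the circle. Thus the Laurent coefficient
    of (z - w)^n is the mean of f(z) (z - w)^(-n), and a residue is the mean of f(z) (z - w). *)
Definition cmean (f : C -> C) (w : C) (r : R) : C :=
  (RtoC (/ (2 * PI)) * CInt (fun t => f (cpt w r t)) 0 (2 * PI))%C.

Lemma two_pi_gt0 : 0 < 2 * PI.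
Proof. by have := PI_RGT_0; lra. Qed.

Lemma Cmod_cpt w r t : 0 <= r -> Cmod (cpt w r t - w) = r.
Proof.
move=> r0; have -> : (cpt w r t - w = RtoC r * cis t)%C by rewrite /cpt; ring.
by rewrite Cmod_mult Cmod_cis Cmod_R Rabs_pos_eq; lra.
Qed.

Lemma rcont_cpt w r t : rcont (cpt w r) t.
Proof.
have h : ccont (fun z => w + RtoC r * cexp z)%C (0, t).
  apply: ccontD; first exact: ccont_const.
  by apply: ccontM; [apply: ccont_const | apply: cdiff_ccont; apply: cdiff_cexp].
move=> e e0; have [d d0 hd] := ccont_rcont_v h e0; exists d => // t' /hd.
by rewrite /cexp /Re /Im /= exp_0 !Cmult_1_l.
Qed.

Lemma ccirc_rcont f w r a b : ccirc f w r -> rcont_on (fun t => f (cpt w r t)) a b.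
Proof.
move=> cf t _ e e0; have [d d0 hd] := cf t e e0.
by have [d' d'0 hd'] := @rcont_cpt w r t d d0; exists d' => // t' /hd' /hd.
Qed.

Lemma cmeanD f h w r : ccirc f w r -> ccirc h w r ->
  cmean (fun z => f z + h z)%C w r = (cmean f w r + cmean h w r)%C.
Proof.
move=> cf ch; rewrite /cmean CIntD; first by ring.
- by have := two_pi_gt0; lra.
- exact: ccirc_rcont.
exact: ccirc_rcont.
Qed.

Lemma cmeanZ c f w r : ccirc f w r -> cmean (fun z => c * f z)%C w r = (c * cmean f w r)%C.
Proof.
move=> cf; rewrite /cmean CIntZ; first by ring.
- by have := two_pi_gt0; lra.
exact: ccirc_rcont.
Qed.

(** The factor 2 comes from estimating the real and imaginary parts separately. *)
Lemma cmean_bound f w r M : ccirc f w r ->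
  (forall t, 0 <= t <= 2 * PI -> Cmod (f (cpt w r t)) <= M) -> Cmod (cmean f w r) <= 2 * M.
Proof.
move=> cf hM; have p := two_pi_gt0.
rewrite /cmean Cmod_mult Cmod_R Rabs_pos_eq; last by apply: Rlt_le; apply: Rinv_0_lt_compat.
have := CInt_bound (Rlt_le _ _ p) (@ccirc_rcont f w r _ _ cf) hM.
rewrite Rminus_0_r => h; apply: (Rmult_le_reg_l (2 * PI)) => //.
by rewrite -Rmult_assoc Rinv_r; lra.
Qed.

Lemma eq_cmean f h w r : (forall t, f (cpt w r t) = h (cpt w r t)) -> cmean f w r = cmean h w r.
Proof.
move=> e; rewrite /cmean (@eq_CInt _ (fun t => h (cpt w r t))) //.
by have := two_pi_gt0; lra.
Qed.

Lemma cmean_const c w r : cmean (fun _ => c) w r = c.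
Proof.
rewrite /cmean /CInt !RInt_const /scal /= /mult /= Rminus_0_r.
have p := two_pi_gt0; case: c => x y; apply: injective_projections; rewrite /Re /Im /=; field; lra.
Qed.

Lemma ccircD f h w r : ccirc f w r -> ccirc h w r -> ccirc (fun z => f z + h z)%C w r.
Proof. by move=> cf ch t; apply: ccontD. Qed.

Lemma ccircM f h w r : ccirc f w r -> ccirc h w r -> ccirc (fun z => f z * h z)%C w r.
Proof. by move=> cf ch t; apply: ccontM. Qed.

Lemma ccirc_cst c w r : ccirc (fun _ => c) w r.
Proof. by move=> t; apply: ccont_const. Qed.

Lemma ccirc_cdiff f w r : 0 <= r -> (forall z, Cmod (z - w) = r -> cdiff f z) -> ccirc f w r.
Proof. by move=> r0 h t; apply: cdiff_ccont; apply: h; apply: Cmod_cpt. Qed.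

Definition polar (f : C -> C) (w z : C) : C := f (w + cexp z)%C.

Lemma polarE f w s t : polar f w (s, t) = f (cpt w (exp s) t).
Proof. by []. Qed.

Lemma exp_mono x y : x <= y -> exp x <= exp y.
Proof. by case=> [h|->]; [left; apply: exp_increasing | right]. Qed.

(** In the coordinate s + i t with z = w + exp (s + i t) the annulus is a rectangle. Its horizontal
    sides cancel by periodicity, so Goursat's theorem equates the integrals over the vertical
    ones. *)
Lemma cmean_annulus f w r1 r2 : 0 < r1 <= r2 ->
  (forall z, r1 <= Cmod (z - w) <= r2 -> cdiff f z) -> cmean f w r1 = cmean f w r2.
Proof.
move=> [r10 r12] df; have p := two_pi_gt0; have r20 : 0 < r2 by lra.
have l12 : ln r1 <= ln r2 by apply: ln_le.
have dp x y : ln r1 <= x <= ln r2 -> 0 <= y <= 2 * PI -> cdiff (polar f w) (x, y).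
  move=> hx _; apply: (cdiff_comp (f := f) (h := fun z => w + cexp z)%C).
    by apply: cdiffD; [apply: cdiff_const | apply: cdiff_cexp].
  apply: df; have -> : (w + cexp (x, y) - w = cexp (x, y))%C by ring.
  rewrite Cmod_cexp /Re /=; split.
    by rewrite -(exp_ln r1) //; apply: exp_mono; lra.
  by rewrite -(exp_ln r2) //; apply: exp_mono; lra.
have := goursat l12 (Rlt_le _ _ p) dp; rewrite /rect_int.
have -> : CInt (fun x => polar f w (x, 2 * PI)) (ln r1) (ln r2) =
   CInt (fun x => polar f w (x, 0)) (ln r1) (ln r2).
  apply: eq_CInt => // x _; rewrite !polarE /cpt.
  by have := cis_period 0 1; rewrite /= Rplus_0_l Rmult_1_r => ->.
have e s (r : R) : 0 < r -> s = ln r -> CInt (fun y => polar f w (s, y)) 0 (2 * PI) =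
   CInt (fun t => f (cpt w r t)) 0 (2 * PI).
  by move=> r0 ->; apply: eq_CInt => [|t _]; [lra | rewrite polarE exp_ln].
rewrite (e (ln r1) r1) // (e (ln r2) r2) // => h.
rewrite /cmean; congr Cmult.
set X := CInt (fun t => f (cpt w r1 t)) _ _ in h *; set Y := CInt (fun t => f (cpt w r2 t)) _ _ in h *.
set Z := CInt (fun x => polar f w (x, 0)) _ _ in h.
have -> : X = (Y + Ci * (Z + Ci * Y - Z - Ci * X))%C.
  have -> : (Y + Ci * (Z + Ci * Y - Z - Ci * X) = Y + (Ci * Ci) * (Y - X))%C by ring.
  have -> : (Ci * Ci = - (1))%C by apply: injective_projections => /=; ring.
  by ring.
by rewrite h; ring.
Qed.

Lemma ccirc_bounded f w r : ccirc f w r ->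
  exists2 B, 0 <= B & forall t, 0 <= t <= 2 * PI -> Cmod (f (cpt w r t)) <= B.
Proof.
move=> cf; have p := two_pi_gt0.
have [|t [ht _]] := continuity_ab_maj (fun t => Cmod (f (cpt w r t))) 0 (2 * PI) (Rlt_le _ _ p).
  move=> t ht; have ct := @ccirc_rcont f w r _ _ cf t ht.
  move=> e e0; have [d d0 hd] := ct e e0; exists d; split=> // t' [_ ht'].
  have h := hd t' ht'; rewrite /dist /=; rewrite /Rdist.
  apply: Rle_lt_trans h; apply: Rabs_le.
  have := Cmod_sub_ge (f (cpt w r t')) (f (cpt w r t)).
  have := Cmod_sub_ge (f (cpt w r t)) (f (cpt w r t')).
  have -> : (f (cpt w r t) - f (cpt w r t') = - (f (cpt w r t') - f (cpt w r t)))%C by ring.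
  rewrite Cmod_opp; lra.
by exists (Cmod (f (cpt w r t))) => //; apply: Cmod_ge_0.
Qed.

Lemma circle_uniform f w s0 eps : ccirc f w (exp s0) -> 0 < eps ->
  exists2 del, 0 < del & forall s x, Rabs (s - s0) < del -> 0 <= x <= 2 * PI ->
    Cmod (f (cpt w (exp s) x) - f (cpt w (exp s0) x)) <= eps.
Proof.
move=> cf e0.
have cp t : ccont (polar f w) (s0, t).
  apply: (ccont_comp (f := f) (h := fun z => w + cexp z)%C); last exact: cf.
  by apply: ccontD; [apply: ccont_const | apply: cdiff_ccont; apply: cdiff_cexp].
(* The factor 2 anticipates a displacement with a horizontal and a vertical part, each smaller than
   d. *)
have ex t : exists d : posreal, forall z, Cmod (z - (s0, t)) < 2 * d ->
    Cmod (polar f w z - polar f w (s0, t)) < eps / 2.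
  have [d d0 hd] := cp t (eps / 2) ltac:(lra).
  by exists (mkposreal (d / 2) ltac:(lra)) => z /= hz; apply: hd; lra.
pose delta t := proj1_sig (constructive_indefinite_description _ (ex t)).
have hdelta t := proj2_sig (constructive_indefinite_description _ (ex t)).
have [d hd] := compactness_value_1d 0 (2 * PI) delta.
exists d; first exact: cond_pos.
move=> s x hs hx; apply: Rnot_lt_le => hneg; apply: (hd x hx) => -[t [ht [h1 h2]]].
have hs' : Rabs (s - s0) < delta t by lra.
have k (s' : R) : Rabs (s' - s0) < delta t -> Cmod (polar f w (s', x) - polar f w (s0, t)) < eps / 2.
  move=> hh; apply: hdelta; rewrite -/(delta t).
  have -> : ((s', x) - (s0, t) = ((s', x) - (s0, x)) + ((s0, x) - (s0, t)))%C by ring.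
  by apply: Rle_lt_trans (Cmod_triangle _ _) _; rewrite Cmod_re_part Cmod_im_part; lra.
have k1 := k s hs'; have k2 := k s0; rewrite Rminus_diag Rabs_R0 in k2.
have {}k2 := k2 (cond_pos _).
rewrite -!polarE in hneg; move: hneg.
have -> : (polar f w (s, x) - polar f w (s0, x) =
  (polar f w (s, x) - polar f w (s0, t)) + - (polar f w (s0, x) - polar f w (s0, t)))%C by ring.
move=> hneg; have := Cmod_triangle (polar f w (s, x) - polar f w (s0, t))
  (- (polar f w (s0, x) - polar f w (s0, t))); rewrite Cmod_opp; lra.
Qed.

Lemma rcontD h k t : rcont h t -> rcont k t -> rcont (fun t => h t + k t)%C t.
Proof.
move=> ch ck e e0; have [d1 d10 h1] := ch (e / 2) ltac:(lra).
have [d2 d20 h2] := ck (e / 2) ltac:(lra).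
exists (Rmin d1 d2); first exact: Rmin_glb_lt.
move=> t' ht'; have := h1 t' (Rlt_le_trans _ _ _ ht' (Rmin_l _ _)).
have := h2 t' (Rlt_le_trans _ _ _ ht' (Rmin_r _ _)) => k1 k2.
have -> : (h t' + k t' - (h t + k t) = (h t' - h t) + (k t' - k t))%C by ring.
by apply: Rle_lt_trans (Cmod_triangle _ _) _; lra.
Qed.

Lemma Ceq_small (x y : C) : (forall e, 0 < e -> Cmod (x - y) <= e) -> x = y.
Proof.
move=> h; have e : (x - y)%C = RtoC 0.
  apply: Cmod_eq_0; apply: Rle_antisym; last exact: Cmod_ge_0.
  by apply: Rnot_lt_le => hn; have := h (Cmod (x - y) / 2) ltac:(lra); lra.
by have -> : x = (x - y + y)%C by [ring]; rewrite e Cplus_0_l.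
Qed.

Lemma cmean_closure f w s0 m : ccirc f w (exp s0) ->
  (forall del, 0 < del -> exists s, [/\ Rabs (s - s0) < del, ccirc f w (exp s) &
     cmean f w (exp s) = m]) -> cmean f w (exp s0) = m.
Proof.
move=> cf h; apply: Ceq_small => e e0; have p := two_pi_gt0.
have [d d0 hd] := circle_uniform cf (ltac:(lra) : 0 < e / 2).
have [s [hs cs <-]] := h d d0.
have c1 := @ccirc_rcont f w (exp s0) 0 (2 * PI) cf.
have c2 := @ccirc_rcont f w (exp s) 0 (2 * PI) cs.
have c3 : rcont_on (fun t => - (1) * f (cpt w (exp s0) t))%C 0 (2 * PI).
  apply: (@ccirc_rcont (fun z => - (1) * f z)%C).
  by apply: ccircM => //; apply: ccirc_cst.
have le2 : 0 <= 2 * PI by lra.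
have -> : (cmean f w (exp s0) - cmean f w (exp s) =
   - (RtoC (/ (2 * PI)) * CInt (fun t => f (cpt w (exp s) t) + - (1) * f (cpt w (exp s0) t)) 0 (2 * PI)))%C.
  by rewrite (CIntD le2 c2 c3) (CIntZ _ le2 c1) /cmean; ring.
rewrite Cmod_opp Cmod_mult Cmod_R Rabs_pos_eq; last by apply: Rlt_le; apply: Rinv_0_lt_compat.
have c4 : rcont_on (fun t => f (cpt w (exp s) t) + - (1) * f (cpt w (exp s0) t))%C 0 (2 * PI).
  by move=> t ht; apply: rcontD; [apply: c2 | apply: c3].
have := CInt_bound le2 c4 (M := e / 2).
have hb : forall t, 0 <= t <= 2 * PI ->
  Cmod (f (cpt w (exp s) t) + - (1) * f (cpt w (exp s0) t)) <= e / 2.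
  move=> t ht; have := hd s t hs ht.
  by rewrite (_ : (_ - _ = f (cpt w (exp s) t) + - (1) * f (cpt w (exp s0) t))%C) //; ring.
move=> /(_ hb); rewrite Rminus_0_r => h1.
apply: (Rmult_le_reg_l (2 * PI)) => //.
by rewrite -Rmult_assoc Rinv_r; lra.
Qed.

(** On the circle of radius r0 only continuity is known. The means are constant on either side of it
    and both sides tend to the mean on it. This is the situation of a completed difference quotient
    at its exceptional point. *)
Lemma cmean_annulus_exc f w r0 r1 r2 : 0 < r1 -> r1 < r0 < r2 ->
  (forall z, r1 <= Cmod (z - w) <= r2 -> ccont f z) ->
  (forall z, r1 <= Cmod (z - w) <= r2 -> Cmod (z - w) <> r0 -> cdiff f z) ->
  cmean f w r1 = cmean f w r2.
Proof.
move=> r10 [h1 h2] cf df.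
have r00 : 0 < r0 by lra.
have l1 : ln r1 < ln r0 by apply: ln_increasing.
have l2 : ln r0 < ln r2 by apply: ln_increasing; lra.
have cc r : r1 <= r <= r2 -> ccirc f w r.
  by move=> hr t; apply: cf; rewrite Cmod_cpt; lra.
have ex r : 0 < r -> exp (ln r) = r by apply: exp_ln.
transitivity (cmean f w (exp (ln r0))).
  symmetry; apply: cmean_closure; first by apply: cc; rewrite ex; lra.
  move=> d d0; exists (Rmax (ln r1) (ln r0 - d / 2)).
  have m1 := Rmax_l (ln r1) (ln r0 - d / 2); have m2 := Rmax_r (ln r1) (ln r0 - d / 2).
  have m3 : Rmax (ln r1) (ln r0 - d / 2) < ln r0 by apply: Rmax_lub_lt; lra.
  move: m1 m2 m3; set s := Rmax _ _ => m1 m2 m3.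
  have q1 : r1 <= exp s by rewrite -(ex r1) //; apply: exp_mono.
  have q2 : exp s < r0 by rewrite -(ex r0) //; apply: exp_increasing.
  split; first by apply: Rabs_def1; lra.
    by apply: cc; lra.
  symmetry; apply: cmean_annulus; first lra.
  by move=> z hz; apply: df; lra.
apply: cmean_closure; first by apply: cc; rewrite ex; lra.
move=> d d0; exists (Rmin (ln r2) (ln r0 + d / 2)).
have m1 := Rmin_l (ln r2) (ln r0 + d / 2); have m2 := Rmin_r (ln r2) (ln r0 + d / 2).
have m3 : ln r0 < Rmin (ln r2) (ln r0 + d / 2) by apply: Rmin_glb_lt; lra.
move: m1 m2 m3; set s := Rmin _ _ => m1 m2 m3.
have q1 : exp s <= r2 by rewrite -(ex r2); [apply: exp_mono | lra].
have q2 : r0 < exp s by rewrite -(ex r0) //; apply: exp_increasing.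
split; first by apply: Rabs_def1; lra.
  by apply: cc; lra.
apply: cmean_annulus; first lra.
by move=> z hz; apply: df; lra.
Qed.

Lemma cmean_disc f w r : 0 < r -> (forall z, Cmod (z - w) <= r -> cdiff f z) ->
  cmean f w r = f w.
Proof.
move=> r0 df; apply: Ceq_small => e e0.
have cw : ccont f w.
  by apply: cdiff_ccont; apply: df; rewrite (_ : w - w = 0)%C ?Cmod_0; [lra | ring].
have [d d0 hd] := cw (e / 2) ltac:(lra).
pose r' := Rmin r (d / 2).
have q1 : r' <= r by apply: Rmin_l.
have q2 : r' <= d / 2 by apply: Rmin_r.
have q3 : 0 < r' by apply: Rmin_glb_lt; lra.
rewrite -(@cmean_annulus f w r' r); [|lra|by move=> z hz; apply: df; lra].
have cf : ccirc f w r' by move=> t; apply: cdiff_ccont; apply: df; rewrite Cmod_cpt; lra.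
have -> : (cmean f w r' - f w = cmean (fun z => f z + (- f w)) w r')%C.
  by rewrite (cmeanD cf) ?cmean_const //; apply: ccirc_cst.
have -> : e = 2 * (e / 2) by field.
apply: cmean_bound; first by apply: ccircD => //; apply: ccirc_cst.
move=> t _; apply: Rlt_le; apply: (hd (cpt w r' t)); rewrite Cmod_cpt; lra.
Qed.

Lemma liouville E : (forall z, cdiff E z) ->
  (forall e, 0 < e -> exists rho, forall z, rho < Cmod z -> Cmod (E z) <= e) ->
  forall z, E z = RtoC 0.
Proof.
move=> dE hE z; apply: Ceq_small => e e0.
have [rho hr] := hE (e / 2) ltac:(lra).
pose r := Rmax rho 0 + Cmod z + 1.
have z0 := Cmod_ge_0 z; have m1 := Rmax_l rho 0; have m2 := Rmax_r rho 0.
have r0 : 0 < r by rewrite /r; lra.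
rewrite -(@cmean_disc E z r) //.
have -> : (cmean E z r - 0 = cmean E z r)%C by ring.
have -> : e = 2 * (e / 2) by field.
apply: cmean_bound; first by move=> t; apply: cdiff_ccont; apply: dE.
move=> t _; apply: hr.
have := Cmod_sub_ge (cpt z r t - z) (- z); rewrite Cmod_opp Cmod_cpt; last lra.
have -> : (cpt z r t - z - - z = cpt z r t)%C by ring.
by rewrite /r; lra.
Qed.

(** * The Cauchy formula on an annulus and the Laurent series *)

Lemma Csub_neq0 (x y : C) : x <> y -> (x - y)%C <> RtoC 0.
Proof. by move=> h e; apply: h; have -> : x = (x - y + y)%C by [ring]; rewrite e Cplus_0_l. Qed.

Lemma Cmod_sub_neq (z x w : C) : Cmod (z - w) <> Cmod (x - w) -> (z - x)%C <> RtoC 0.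
Proof. by move=> h; apply: Csub_neq0 => e; apply: h; rewrite e. Qed.

Lemma cdiff_div f h z : cdiff f z -> cdiff h z -> h z <> RtoC 0 -> cdiff (fun x => f x / h x)%C z.
Proof. by move=> df dh nz; apply: cdiffM => //; apply: cdiffV. Qed.

Lemma ccirc_kernel w x r : 0 <= r -> Cmod (x - w) <> r ->
  ccirc (fun z => (z - w) / (z - x))%C w r.
Proof.
move=> r0 hx; apply: ccirc_cdiff => // z hz.
apply: cdiff_div; try exact: cdiff_sub.
by apply: (@Cmod_sub_neq _ _ w); rewrite hz; apply: nesym.
Qed.

(** The mean being taken against dz / (z - w), the factor (z - w) / (z - x) turns it into a Cauchy
    integral. Its value is the winding number about x, zero for a circle that leaves x outside. *)
Lemma cmean_kernel_inner w x r : 0 < r < Cmod (x - w) ->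
  cmean (fun z => (z - w) / (z - x))%C w r = RtoC 0.
Proof.
move=> [r0 hr]; rewrite cmean_disc //.
  by rewrite /Cdiv; have -> : (w - w = 0)%C by [ring]; rewrite Cmult_0_l.
move=> z hz; apply: cdiff_div; try exact: cdiff_sub.
by apply: (@Cmod_sub_neq _ _ w); lra.
Qed.

Lemma cmean_kernel_outer w x r : 0 < r -> Cmod (x - w) < r ->
  cmean (fun z => (z - w) / (z - x))%C w r = RtoC 1.
Proof.
move=> r0 hr; have x0 := Cmod_ge_0 (x - w).
have dk z : Cmod (x - w) < Cmod (z - w) -> (z - x)%C <> RtoC 0.
  by move=> h; apply: (@Cmod_sub_neq _ _ w); lra.
apply: Ceq_small => e e0.
(* On this larger circle |(z - w) / (z - x) - 1| = |x - w| / |z - x| <= e / 2. *)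
pose R' := r + Cmod (x - w) + 2 * Cmod (x - w) / e.
have q : 0 <= 2 * Cmod (x - w) / e by apply: Rdiv_le_0_compat; lra.
rewrite (@cmean_annulus _ w r R'); last 2 first.
- by rewrite /R'; lra.
- by move=> z hz; apply: cdiff_div; try exact: cdiff_sub; apply: dk; lra.
have R0 : 0 <= R' by rewrite /R'; lra.
have cK : ccirc (fun z => (z - w) / (z - x))%C w R' by apply: ccirc_kernel => //; rewrite /R'; lra.
have -> : (cmean (fun z => (z - w) / (z - x)) w R' - 1 =
   cmean (fun z => (z - w) / (z - x) + - (1)) w R')%C.
  by rewrite (cmeanD cK) ?cmean_const //; apply: ccirc_cst.
have -> : e = 2 * (e / 2) by field.
apply: cmean_bound; first by apply: ccircD => //; apply: ccirc_cst.
move=> t _; have hz : Cmod (cpt w R' t - w) = R' by apply: Cmod_cpt.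
move: (cpt w R' t) hz => z hz.
have nz : (z - x)%C <> RtoC 0 by apply: dk; rewrite hz /R'; lra.
have -> : ((z - w) / (z - x) + - (1) = (x - w) / (z - x))%C by field.
rewrite Cmod_div //.
have hzx : R' - Cmod (x - w) <= Cmod (z - x).
  have := Cmod_sub_ge (z - w) (x - w); rewrite hz.
  by have -> : (z - w - (x - w) = z - x)%C by ring.
have p : 0 < Cmod (z - x) by rewrite /R' in hzx; lra.
apply/Rle_div_l => //.
have -> : Cmod (x - w) = e / 2 * (2 * Cmod (x - w) / e) by field; lra.
by apply: Rmult_le_compat_l; [lra | rewrite /R' in hzx; lra].
Qed.

(** The difference quotient [phi] of f at x is continuous at x and holomorphic elsewhere, so (z - w)
    phi(z) has the same mean on both circles. Splitting off the term with f(x), whose winding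
    numbers are 0 and 1, gives the formula. *)
Lemma cauchy_annulus f w x r1 r2 : 0 < r1 -> r1 < Cmod (x - w) < r2 ->
  (forall z, r1 <= Cmod (z - w) <= r2 -> cdiff f z) ->
  f x = (cmean (fun z => f z * ((z - w) / (z - x))) w r2 -
         cmean (fun z => f z * ((z - w) / (z - x))) w r1)%C.
Proof.
move=> r10 hx df; have [phi cphi ephi] := df x ltac:(lra).
have phiE z : (z - x)%C <> RtoC 0 -> phi z = ((f z - f x) / (z - x))%C.
  by move=> nz; rewrite (ephi z); field.
have dphi z : r1 <= Cmod (z - w) <= r2 -> z <> x -> cdiff phi z.
  move=> hz ne; have nz := Csub_neq0 ne; have p : 0 < Cmod (z - x) by apply/Cmod_gt_0.
  apply: (@cdiff_local (fun z => (f z - f x) / (z - x))%C _ _ (Cmod (z - x))) => //.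
    move=> u hu; rewrite phiE //; apply: Csub_neq0 => e; move: hu; rewrite e.
    by rewrite -Cmod_opp (_ : - (x - z) = z - x)%C; [lra | ring].
  by apply: cdiff_div => //; [apply: cdiffB; [exact: df | exact: cdiff_const] | exact: cdiff_sub].
pose h z := ((z - w) * phi z)%C.
have hE z : (z - x)%C <> RtoC 0 -> h z = (f z * ((z - w) / (z - x)) + - f x * ((z - w) / (z - x)))%C.
  by move=> nz; rewrite /h phiE //; field.
have mh : cmean h w r1 = cmean h w r2.
  apply: (@cmean_annulus_exc _ _ (Cmod (x - w))) => //.
    move=> z hz; apply: ccontM; first by apply: cdiff_ccont; apply: cdiff_sub.
    case: (Ceq_dec z x) => [->//|ne].
    by apply: cdiff_ccont; apply: dphi.
  move=> z hz ne; apply: cdiffM; first exact: cdiff_sub.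
  by apply: dphi => // e; apply: ne; rewrite e.
have split r : r1 <= r <= r2 -> r <> Cmod (x - w) -> cmean h w r =
   (cmean (fun z => f z * ((z - w) / (z - x))) w r + - f x * cmean (fun z => (z - w) / (z - x)) w r)%C.
  move=> hr nr; have cK := @ccirc_kernel w x r ltac:(lra) (nesym nr).
  have cf : ccirc f w r by apply: ccirc_cdiff => [|z hz]; [lra | apply: df; lra].
  rewrite -(cmeanZ _ cK) -cmeanD; last 2 first.
  - exact: ccircM.
  - by apply: ccircM => //; apply: ccirc_cst.
  apply: eq_cmean => t; apply: hE; apply: (@Cmod_sub_neq _ _ w); rewrite Cmod_cpt //; lra.
move: mh; rewrite !split; try lra.
rewrite (cmean_kernel_inner (r := r1)) ?(cmean_kernel_outer (r := r2)); try lra.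
rewrite Cmult_0_r Cplus_0_r Cmult_1_r => ->; ring.
Qed.

Lemma Cinv_one : (/ RtoC 1 = RtoC 1)%C.
Proof. by rewrite -RtoC_inv ?Rinv_1 //; lra. Qed.

Lemma ccirc_sub_pow w r n : ccirc (fun z => (z - w) ^ n)%C w r.
Proof. by move=> t; apply: cdiff_ccont; apply: cdiff_pow; apply: cdiff_sub. Qed.

Lemma cpt_neq0 w r t : 0 < r -> (cpt w r t - w)%C <> RtoC 0.
Proof. by move=> r0; apply/Cmod_gt_0; rewrite Cmod_cpt; lra. Qed.

Lemma ccirc_inv_pow w p r n : 0 < r -> Cmod (w - p) <> r -> ccirc (fun z => / (z - p) ^ n)%C w r.
Proof.
move=> r0 hp t; apply: cdiff_ccont; apply: cdiffV.
  by apply: cdiff_pow; apply: cdiff_sub.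
apply: Cpow_nz; apply: (@Cmod_sub_neq _ _ w); rewrite Cmod_cpt; last lra.
by move=> e; apply: hp; rewrite e -Cmod_opp; congr Cmod; ring.
Qed.

Lemma ccirc_inv_sub_pow w r n : 0 < r -> ccirc (fun z => / (z - w) ^ n)%C w r.
Proof.
move=> r0; apply: ccirc_inv_pow => //.
by rewrite (_ : w - w = 0)%C ?Cmod_0; [lra | ring].
Qed.

(** The geometric series of the Cauchy kernel is kept finite, with the exact remainder [rem N],
    whose mean is O(th^N). No interchange of a mean with an infinite sum occurs. *)
Lemma laurent_outer f w x r : 0 < r -> Cmod (x - w) < r -> ccirc f w r ->
  cmean (fun z => f z * ((z - w) / (z - x)))%C w r =
  cser (fun n => cmean (fun z => f z * / (z - w) ^ n) w r * (x - w) ^ n)%C.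
Proof.
move=> r0 hx cf; have x0 := Cmod_ge_0 (x - w).
pose th := Cmod (x - w) / r.
have ht : 0 <= th < 1.
  by split; [apply: Rdiv_le_0_compat | apply/Rlt_div_l; lra].
have [B B0 hB] := ccirc_bounded cf.
pose rem n z := (f z * (((x - w) ^ n * / (z - w) ^ n) * ((z - w) / (z - x))))%C.
have cK : ccirc (fun z => (z - w) / (z - x))%C w r by apply: ccirc_kernel; lra.
have crem n : ccirc (rem n) w r.
  apply: ccircM => //; apply: ccircM => //; apply: ccircM; first exact: ccirc_cst.
  exact: ccirc_inv_sub_pow.
have cterm n : ccirc (fun z => f z * / (z - w) ^ n)%C w r.
  by apply: ccircM => //; apply: ccirc_inv_sub_pow.
have step n : cmean (rem n) w r =
   (cmean (fun z => f z * / (z - w) ^ n) w r * (x - w) ^ n + cmean (rem n.+1) w r)%C.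
  rewrite Cmult_comm -(cmeanZ _ (cterm n)) -cmeanD //; last first.
    by apply: ccircM => //; apply: ccirc_cst.
  apply: eq_cmean => t; have nz := @cpt_neq0 w r t r0.
  have nx : (cpt w r t - x)%C <> RtoC 0 by apply: (@Cmod_sub_neq _ _ w); rewrite Cmod_cpt; lra.
  rewrite /rem; move: (cpt w r t) nz nx => z nz nx; rewrite !Cpow_S.
  have nn := Cpow_nz _ n nz; move: ((z - w) ^ n)%C nn => y nn.
  by field; split.
have sumE N : csum (fun n : 'I_N => cmean (fun z => f z * / (z - w) ^ n) w r * (x - w) ^ n)%C =
   (cmean (rem 0%nat) w r - cmean (rem N) w r)%C.
  elim: N => [|N IH]; first by rewrite csum_ord0; ring.
  rewrite (csumS N (fun n => cmean (fun z => f z * / (z - w) ^ n) w r * (x - w) ^ n)%C) IH.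
  by rewrite (step N); ring.
have thE n : Cmod (x - w) ^ n = th ^ n * r ^ n.
  by rewrite -Rpow_mult_distr; congr pow; rewrite /th; field; lra.
have rn n : 0 < r ^ n by apply: pow_lt.
have e0 : cmean (fun z => f z * ((z - w) / (z - x)))%C w r = cmean (rem 0%nat) w r.
  by apply: eq_cmean => t; rewrite /rem /= Cinv_one !Cmult_1_l.
symmetry; rewrite e0.
apply: (@cser_unique th (2 * B) (2 * (B * (r / (r - Cmod (x - w))))) _ _ ht).
  move=> n; rewrite Cmod_mult Cmod_pow thE.
  have h : Cmod (cmean (fun z => f z * / (z - w) ^ n)%C w r) <= 2 * (B * / r ^ n).
    apply: cmean_bound => // t ht'; rewrite Cmod_mult Cmod_inv; last first.
      by apply: Cpow_nz; apply: cpt_neq0.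
    rewrite Cmod_pow Cmod_cpt; last lra.
    by apply: Rmult_le_compat_r; [apply: Rlt_le; apply: Rinv_0_lt_compat | apply: hB].
  have -> : 2 * B * th ^ n = 2 * (B * / r ^ n) * (th ^ n * r ^ n).
    by field; have := rn n; lra.
  apply: Rmult_le_compat_r => //; apply: Rmult_le_pos; last exact: Rlt_le.
  by apply: pow_le; lra.
move=> N; rewrite sumE (_ : _ - _ - _ = - cmean (rem N) w r)%C; last by ring.
rewrite Cmod_opp Rmult_assoc; apply: cmean_bound => // t ht'.
have hz := @Cmod_cpt w r t ltac:(lra).
have nz := @cpt_neq0 w r t r0.
have nx : (cpt w r t - x)%C <> RtoC 0 by apply: (@Cmod_sub_neq _ _ w); rewrite Cmod_cpt; lra.
have hzx : r - Cmod (x - w) <= Cmod (cpt w r t - x).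
  have := Cmod_sub_ge (cpt w r t - w) (x - w); rewrite hz.
  by have -> : (cpt w r t - w - (x - w) = cpt w r t - x)%C by ring.
rewrite /rem !Cmod_mult (Cmod_inv _ nx) Cmod_inv ?Cmod_pow ?hz ?thE; last exact: Cpow_nz.
have fb := hB t ht'; have f0 := Cmod_ge_0 (f (cpt w r t)).
have tn : 0 <= th ^ N by apply: pow_le; lra.
have -> : th ^ N * r ^ N * / r ^ N * (r * / Cmod (cpt w r t - x)) = r / Cmod (cpt w r t - x) * th ^ N.
  by field; have := rn N; lra.
rewrite -Rmult_assoc; apply: Rmult_le_compat_r => //; apply: Rmult_le_compat => //.
  by apply: Rdiv_le_0_compat; lra.
apply: Rmult_le_compat_l; first lra.
by apply: Rinv_le_contravar; lra.
Qed.

(** The same scheme with the kernel expanded in powers of (z - w) / (x - w), whence the sign. *)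
Lemma laurent_inner f w x r : 0 < r < Cmod (x - w) -> ccirc f w r ->
  cmean (fun z => f z * ((z - w) / (z - x)))%C w r =
  (- cser (fun n => cmean (fun z => f z * (z - w) ^ n.+1) w r * / (x - w) ^ n.+1))%C.
Proof.
move=> [r0 hx] cf.
have x0 : (x - w)%C <> RtoC 0 by apply/Cmod_gt_0; lra.
pose th := r / Cmod (x - w).
have ht : 0 <= th < 1.
  by split; [apply: Rdiv_le_0_compat; lra | apply/Rlt_div_l; lra].
have [B B0 hB] := ccirc_bounded cf.
pose rem n z := (f z * (((z - w) ^ n * / (x - w) ^ n) * ((z - w) / (z - x))))%C.
have cK : ccirc (fun z => (z - w) / (z - x))%C w r by apply: ccirc_kernel; lra.
have crem n : ccirc (rem n) w r.
  apply: ccircM => //; apply: ccircM => //; apply: ccircM; last exact: ccirc_cst.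
  exact: ccirc_sub_pow.
have cterm n : ccirc (fun z => f z * (z - w) ^ n.+1)%C w r.
  by apply: ccircM => //; apply: ccirc_sub_pow.
have step n : cmean (rem n) w r =
   (- (cmean (fun z => f z * (z - w) ^ n.+1) w r * / (x - w) ^ n.+1) + cmean (rem n.+1) w r)%C.
  have -> : (- (cmean (fun z => f z * (z - w) ^ n.+1) w r * / (x - w) ^ n.+1) =
     - / (x - w) ^ n.+1 * cmean (fun z => f z * (z - w) ^ n.+1) w r)%C by ring.
  rewrite -(cmeanZ _ (cterm n)) -cmeanD //; last first.
    by apply: ccircM => //; apply: ccirc_cst.
  apply: eq_cmean => t.
  have nx : (cpt w r t - x)%C <> RtoC 0 by apply: (@Cmod_sub_neq _ _ w); rewrite Cmod_cpt; lra.
  rewrite /rem; move: (cpt w r t) nx => z nx; rewrite !Cpow_S.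
  have nn := Cpow_nz _ n x0; move: ((x - w) ^ n)%C nn => y nn.
  by field; repeat split.
have sumE N : csum (fun n : 'I_N => cmean (fun z => f z * (z - w) ^ n.+1) w r * / (x - w) ^ n.+1)%C =
   (- cmean (rem 0%nat) w r + cmean (rem N) w r)%C.
  elim: N => [|N IH]; first by rewrite csum_ord0; ring.
  rewrite (csumS N (fun n => cmean (fun z => f z * (z - w) ^ n.+1) w r * / (x - w) ^ n.+1)%C) IH.
  by rewrite (step N); ring.
have xn n : 0 < Cmod (x - w) ^ n by apply: pow_lt; lra.
have thE n : r ^ n = th ^ n * Cmod (x - w) ^ n.
  by rewrite -Rpow_mult_distr; congr pow; rewrite /th; field; lra.
have e0 : cmean (fun z => f z * ((z - w) / (z - x)))%C w r = cmean (rem 0%nat) w r.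
  by apply: eq_cmean => t; rewrite /rem /= Cinv_one !Cmult_1_l.
rewrite e0.
rewrite (@cser_unique th (2 * (B * th)) (2 * (B * (r / (Cmod (x - w) - r)))) _ (- cmean (rem 0%nat) w r)%C ht).
- by ring.
- move=> n; rewrite Cmod_mult Cmod_inv ?Cmod_pow; last exact: Cpow_nz.
  have h : Cmod (cmean (fun z => f z * (z - w) ^ n.+1)%C w r) <= 2 * (B * r ^ n.+1).
    apply: cmean_bound => // t ht'; rewrite Cmod_mult Cmod_pow Cmod_cpt; last lra.
    by apply: Rmult_le_compat_r; [apply: pow_le; lra | apply: hB].
  have -> : 2 * (B * th) * th ^ n = 2 * (B * r ^ n.+1) * / Cmod (x - w) ^ n.+1.
    by rewrite thE /=; field; have := xn n; lra.
  by apply: Rmult_le_compat_r => //; apply: Rlt_le; apply: Rinv_0_lt_compat.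
move=> N; rewrite sumE (_ : _ - _ = cmean (rem N) w r)%C; last by ring.
rewrite Rmult_assoc; apply: cmean_bound => // t ht'.
have hz := @Cmod_cpt w r t ltac:(lra).
have nx : (cpt w r t - x)%C <> RtoC 0 by apply: (@Cmod_sub_neq _ _ w); rewrite Cmod_cpt; lra.
have hzx : Cmod (x - w) - r <= Cmod (cpt w r t - x).
  have := Cmod_sub_ge (x - w) (cpt w r t - w); rewrite hz -(Cmod_opp (cpt w r t - x)).
  by have -> : (x - w - (cpt w r t - w) = - (cpt w r t - x))%C by ring.
rewrite /rem !Cmod_mult (Cmod_inv _ nx) Cmod_inv ?Cmod_pow ?hz ?thE; last exact: Cpow_nz.
have fb := hB t ht'; have f0 := Cmod_ge_0 (f (cpt w r t)).
have tn : 0 <= th ^ N by apply: pow_le; lra.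
have -> : th ^ N * Cmod (x - w) ^ N * / Cmod (x - w) ^ N * (r * / Cmod (cpt w r t - x)) =
   r / Cmod (cpt w r t - x) * th ^ N.
  by field; have := xn N; lra.
rewrite -Rmult_assoc; apply: Rmult_le_compat_r => //; apply: Rmult_le_compat => //.
  by apply: Rdiv_le_0_compat; lra.
apply: Rmult_le_compat_l; first lra.
by apply: Rinv_le_contravar; lra.
Qed.

Lemma laurent f w x r1 r2 : 0 < r1 -> r1 < Cmod (x - w) < r2 ->
  (forall z, r1 <= Cmod (z - w) <= r2 -> cdiff f z) ->
  f x = (cser (fun n => cmean (fun z => f z * / (z - w) ^ n) w r2 * (x - w) ^ n) +
         cser (fun n => cmean (fun z => f z * (z - w) ^ n.+1) w r1 * / (x - w) ^ n.+1))%C.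
Proof.
move=> r10 hx df.
have c2 : ccirc f w r2 by apply: ccirc_cdiff => [|z hz]; [lra | apply: df; lra].
have c1 : ccirc f w r1 by apply: ccirc_cdiff => [|z hz]; [lra | apply: df; lra].
rewrite (cauchy_annulus r10 hx df) laurent_outer ?laurent_inner //; try lra.
ring.
Qed.

(** * Power series, termwise means and moments of poles *)

Lemma pow_linear_bound rho sigma n : 0 < rho < sigma ->
  INR n * rho ^ n.-1 <= sigma ^ n / (sigma - rho).
Proof.
move=> h; have d : 0 < sigma - rho by lra.
apply: (proj1 (Rle_div_r (INR n * rho ^ n.-1) (sigma ^ n) _ d)).
elim: n => [|n IH]; first by rewrite /=; lra.
rewrite -pred_Sn S_INR.
have sn : 0 < sigma ^ n by apply: pow_lt; lra.
have rn : 0 < rho ^ n by apply: pow_lt; lra.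
have rs : rho ^ n <= sigma ^ n by apply: pow_incr; lra.
have e : INR n * rho ^ n = rho * (INR n * rho ^ n.-1).
  by case: (n) => [|m] /=; ring.
rewrite Rmult_plus_distr_r e Rmult_1_l /=.
nra.
Qed.

(** The polynomial growth in n of the Taylor remainder of z^n is absorbed by passing from rho to the
    larger radius sigma, so that the bound stays geometric and can be summed. *)
Lemma pow_second_order (z z' : C) rho sigma n : 0 < rho < sigma ->
  Cmod z <= rho -> Cmod z' <= rho ->
  Cmod (z' ^ n - z ^ n - RtoC (INR n) * z ^ n.-1 * (z' - z))%C <=
  sigma ^ n / (sigma - rho) ^ 2 * Cmod (z' - z) ^ 2.
Proof.
move=> h hz hz'; have d : 0 < sigma - rho by lra.
have d2 : 0 < (sigma - rho) ^ 2 by apply: pow_lt.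
elim: n => [|n IH].
  rewrite /= (_ : _ - _ - _ = 0)%C; last by ring.
  rewrite Cmod_0; apply: Rmult_le_pos; last exact: pow2_ge_0.
  by apply: Rdiv_le_0_compat; [lra | rewrite /= in d2].
have -> : (z' ^ n.+1 - z ^ n.+1 - RtoC (INR n.+1) * z ^ n.+1.-1 * (z' - z) =
  z' * (z' ^ n - z ^ n - RtoC (INR n) * z ^ n.-1 * (z' - z)) +
  RtoC (INR n) * z ^ n.-1 * (z' - z) ^ 2)%C.
  rewrite S_INR RtoC_plus -pred_Sn; case: (n) => [|m]; first by rewrite /=; ring.
  by rewrite -pred_Sn !Cpow_S; ring.
apply: Rle_trans (Cmod_triangle _ _) _; rewrite Cmod_mult (Cmod_mult (_ * _)%C) Cmod_pow Cmod_mult Cmod_pow Cmod_R.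
rewrite Rabs_pos_eq; last exact: pos_INR.
have hl := @pow_linear_bound rho sigma n h.
have z0 := Cmod_ge_0 z'; have D0 := pow2_ge_0 (Cmod (z' - z)).
have hzn : Cmod z ^ n.-1 <= rho ^ n.-1 by apply: pow_incr; split => //; apply: Cmod_ge_0.
have hn := pos_INR n.
have a1 : INR n * Cmod z ^ n.-1 * Cmod (z' - z) ^ 2 <= sigma ^ n / (sigma - rho) * Cmod (z' - z) ^ 2.
  apply: Rmult_le_compat_r => //; apply: Rle_trans hl.
  exact: Rmult_le_compat_l.
have a2 : Cmod z' * Cmod (z' ^ n - z ^ n - RtoC (INR n) * z ^ n.-1 * (z' - z)) <=
   rho * (sigma ^ n / (sigma - rho) ^ 2 * Cmod (z' - z) ^ 2).
  by apply: Rmult_le_compat => //; apply: Cmod_ge_0.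
apply: Rle_trans (Rplus_le_compat _ _ _ _ a2 a1) _; apply: Req_le.
by rewrite /=; field; lra.
Qed.

Lemma cser_pow_cdiff c B q z : 0 < q -> geo q B c -> q * Cmod z < 1 ->
  cdiff (fun z => cser (fun n => c n * z ^ n))%C z.
Proof.
move=> q0 hc hz; have z0 := Cmod_ge_0 z.
have hq : Cmod z < / q by apply: (Rmult_lt_reg_l q) => //; rewrite Rinv_r; lra.
(* rho and sigma divide the interval from |z| to the radius of convergence 1/q into thirds: z' may
   move up to rho, and sigma is the radius of [pow_second_order]. *)
pose rho := (Cmod z + (/ q - Cmod z) / 3).
pose sigma := (Cmod z + 2 * (/ q - Cmod z) / 3).
have hr : 0 < rho < sigma by rewrite /rho /sigma; lra.
have hs : sigma < / q by rewrite /sigma; lra.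
have qs : 0 <= q * sigma < 1.
  split; first by apply: Rmult_le_pos; lra.
  by rewrite -(Rinv_r q); [apply: Rmult_lt_compat_l | lra].
have B0 := geo_ge0 hc.
have gpow u : Cmod u <= rho -> geo (q * sigma) B (fun n => c n * u ^ n)%C.
  move=> hu n; rewrite Cmod_mult Cmod_pow Rpow_mult_distr -Rmult_assoc.
  apply: Rmult_le_compat; [exact: Cmod_ge_0 | by apply: pow_le; apply: Cmod_ge_0 | exact: hc |].
  by apply: pow_incr; split; [apply: Cmod_ge_0 | lra].
have gder : geo (q * sigma) (B * / (sigma - rho)) (fun n => c n * (RtoC (INR n) * z ^ n.-1))%C.
  move=> n; rewrite !Cmod_mult Cmod_pow Cmod_R Rabs_pos_eq; last exact: pos_INR.
  have -> : B * / (sigma - rho) * (q * sigma) ^ n = B * q ^ n * (sigma ^ n / (sigma - rho)).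
    by rewrite Rpow_mult_distr /Rdiv; ring.
  apply: Rmult_le_compat; [exact: Cmod_ge_0 | | exact: hc |].
    by apply: Rmult_le_pos; [exact: pos_INR | apply: pow_le].
  apply: Rle_trans (@pow_linear_bound rho sigma n hr).
  by apply: Rmult_le_compat_l; [exact: pos_INR | apply: pow_incr; rewrite /rho; lra].
pose D := cser (fun n => c n * (RtoC (INR n) * z ^ n.-1))%C.
apply: (@cdiff_of_quotient _ _ D) => eps e0.
pose K := 2 * (B * / (sigma - rho) ^ 2) / (1 - q * sigma).
have d2 : 0 < (sigma - rho) ^ 2 by apply: pow_lt; lra.
have K0 : 0 <= K.
  apply: Rdiv_le_0_compat; last lra.
  by apply: Rmult_le_pos; [lra | apply: Rmult_le_pos => //; apply: Rlt_le; apply: Rinv_0_lt_compat].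
exists (Rmin (rho - Cmod z) (eps / (K + 1))).
  by apply: Rmin_glb_lt; [rewrite /rho; lra | apply: Rdiv_lt_0_compat; lra].
move=> z' hz'.
have h1 := Rlt_le_trans _ _ _ hz' (Rmin_l _ _); have h2 := Rlt_le_trans _ _ _ hz' (Rmin_r _ _).
have hz'r : Cmod z' <= rho by have := Cmod_sub_ge z' z; lra.
have hzr : Cmod z <= rho by rewrite /rho; lra.
have e : (cser (fun n => c n * z' ^ n) - cser (fun n => c n * z ^ n) - D * (z' - z) =
  cser (fun n => c n * (z' ^ n - z ^ n - RtoC (INR n) * z ^ n.-1 * (z' - z))))%C.
  transitivity (cser (fun n => c n * z' ^ n) + - (1) * cser (fun n => c n * z ^ n) + (- (z' - z)) * D)%C.
    by ring.
  rewrite -(cserZ _ qs (gpow z hzr)) -(cserZ _ qs gder).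
  rewrite -(cserD qs (gpow z' hz'r) (geoZ _ (gpow z hzr))).
  rewrite -(cserD qs (geoD (gpow z' hz'r) (geoZ _ (gpow z hzr))) (geoZ _ gder)).
  by apply: eq_cser => n; ring.
rewrite e.
have gr : geo (q * sigma) (B * / (sigma - rho) ^ 2 * Cmod (z' - z) ^ 2)
   (fun n => c n * (z' ^ n - z ^ n - RtoC (INR n) * z ^ n.-1 * (z' - z)))%C.
  move=> n; rewrite Cmod_mult Rpow_mult_distr.
  have -> : B * / (sigma - rho) ^ 2 * Cmod (z' - z) ^ 2 * (q ^ n * sigma ^ n) =
    B * q ^ n * (sigma ^ n / (sigma - rho) ^ 2 * Cmod (z' - z) ^ 2) by rewrite /Rdiv; ring.
  apply: Rmult_le_compat; [exact: Cmod_ge_0 | exact: Cmod_ge_0 | exact: hc |].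
  exact: pow_second_order.
apply: Rle_trans (cser_bound qs gr) _.
have -> : 2 * (B * / (sigma - rho) ^ 2 * Cmod (z' - z) ^ 2) / (1 - q * sigma) =
   K * Cmod (z' - z) * Cmod (z' - z) by rewrite /K /=; field; lra.
apply: Rmult_le_compat_r; first exact: Cmod_ge_0.
have p := Cmod_ge_0 (z' - z).
have : (K + 1) * Cmod (z' - z) <= eps.
  have -> : eps = (K + 1) * (eps / (K + 1)) by field; lra.
  by apply: Rmult_le_compat_l; lra.
nra.
Qed.

Lemma ccirc_ext f h w r : (forall z, f z = h z) -> ccirc f w r -> ccirc h w r.
Proof. by move=> e cf t; apply: ccont_ext e (cf t). Qed.

Lemma cmean_csum (T : finType) w r (F : T -> C -> C) : (forall n, ccirc (F n) w r) ->
  ccirc (fun z => csum (fun n => F n z)) w r /\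
  cmean (fun z => csum (fun n => F n z)) w r = csum (fun n => cmean (F n) w r).
Proof.
move=> cF; rewrite /csum; elim: (index_enum T) => [|a s [cN IH]].
  split; first by apply: (ccirc_ext _ (@ccirc_cst (RtoC 0) w r)) => z; rewrite big_nil.
  by rewrite big_nil -[RHS](cmean_const (RtoC 0) w r); apply: eq_cmean => t; rewrite big_nil.
have e z : (F a z + \big[Cplus/RtoC 0]_(n <- s) F n z)%C = \big[Cplus/RtoC 0]_(n <- a :: s) F n z.
  by rewrite big_cons.
split; first exact: (ccirc_ext e (ccircD (cF a) cN)).
by rewrite big_cons -IH -(cmeanD (cF a) cN); apply: eq_cmean => t; rewrite -e.
Qed.

Lemma cmean_cser w r theta c (F : nat -> C -> C) : 0 <= theta < 1 ->
  (forall n, ccirc (F n) w r) -> ccirc (fun z => cser (fun n => F n z)) w r ->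
  (forall n t, Cmod (F n (cpt w r t)) <= c * theta ^ n) ->
  cmean (fun z => cser (fun n => F n z)) w r = cser (fun n => cmean (F n) w r).
Proof.
move=> ht cF cS hF; symmetry.
apply: (@cser_unique theta (2 * c) (2 * (2 * c / (1 - theta))) _ _ ht).
  by move=> n; rewrite Rmult_assoc; apply: cmean_bound => // t _; apply: hF.
move=> N; have [cN eN] := cmean_csum (fun n : 'I_N => cF n); rewrite -eN.
have cm : ccirc (fun z => - (1) * cser (fun n => F n z))%C w r by apply: ccircM => //; apply: ccirc_cst.
have -> : (cmean (fun z => csum (fun n : 'I_N => F n z)) w r - cmean (fun z => cser (fun n => F n z)) w r =
  cmean (fun z => csum (fun n : 'I_N => F n z) + - (1) * cser (fun n => F n z)) w r)%C.
  have aux (x y : C) : (x - y = x + - (1) * y)%C by ring.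
  by rewrite (cmeanD cN cm) (cmeanZ _ cS); apply: aux.
rewrite Rmult_assoc; apply: cmean_bound; first exact: ccircD.
move=> t _; have hg : geo theta c (fun n => F n (cpt w r t)) by move=> n; apply: hF.
have := cser_tail N ht hg; rewrite -Cmod_opp => h.
have -> : (csum (fun n : 'I_N => F n (cpt w r t)) + - (1) * cser (fun n => F n (cpt w r t)) =
  - (cser (fun n => F n (cpt w r t)) - csum (fun n : 'I_N => F n (cpt w r t))))%C by ring.
by apply: Rle_trans h _; apply: Req_le; field; lra.
Qed.

Lemma cmean_inv_pow w r n : 0 < r -> cmean (fun z => / (z - w) ^ n.+1)%C w r = RtoC 0.
Proof.
move=> r0; apply: Ceq_small => e e0.
pose R' := r + 1 + 2 / e.
have q : 0 < 2 / e by apply: Rdiv_lt_0_compat; lra.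
have R1 : 1 <= R' by rewrite /R'; lra.
rewrite (@cmean_annulus _ w r R'); last 2 first.
- by rewrite /R'; lra.
- move=> z hz; apply: cdiffV; first by apply: cdiff_pow; apply: cdiff_sub.
  by apply: Cpow_nz; apply/Cmod_gt_0; lra.
have -> : (cmean (fun z => / (z - w) ^ n.+1) w R' - 0 = cmean (fun z => / (z - w) ^ n.+1) w R')%C by ring.
have -> : e = 2 * (e / 2) by field.
apply: cmean_bound; first by apply: ccirc_inv_sub_pow; lra.
move=> t _; have nz := @cpt_neq0 w R' t ltac:(lra).
rewrite Cmod_inv; last exact: Cpow_nz.
rewrite Cmod_pow Cmod_cpt; last lra.
have : R' <= R' ^ n.+1.
  by rewrite /=; have := pow_R1_Rle R' n R1; nra.
move=> h; apply: Rle_trans (Rinv_le_contravar R' _ _ h) _; first lra.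
have -> : e / 2 = / (2 / e) by field; lra.
by apply: Rinv_le_contravar; rewrite // /R'; lra.
Qed.

(** These are the Taylor coefficients of (z - p)^(-l-1) at w. Dividing (z - p) - (z - w) = w - p by
    powers of both factors gives a recursion in l and m that is Pascal's rule. *)
Lemma pole_moment w p r m l : 0 < r < Cmod (w - p) ->
  cmean (fun z => / (z - p) ^ l.+1 * / (z - w) ^ m)%C w r =
  (RtoC (INR 'C(l + m, m)) * ((- (1)) ^ m / (w - p) ^ (l.+1 + m)))%C.
Proof.
move=> [r0 hp].
have nW : (w - p)%C <> RtoC 0 by apply/Cmod_gt_0; lra.
have np z : Cmod (z - w) <= r -> (z - p)%C <> RtoC 0.
  move=> hz; apply: (@Cmod_sub_neq _ _ w).
  by rewrite -(Cmod_opp (p - w)) (_ : - (p - w) = w - p)%C; [lra | ring].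
have cP l' m' : ccirc (fun z => / (z - p) ^ l' * / (z - w) ^ m')%C w r.
  by apply: ccircM; [apply: ccirc_inv_pow => //; lra | apply: ccirc_inv_sub_pow].
have rec l' m' : (cmean (fun z => / (z - p) ^ l'.+1 * / (z - w) ^ m'.+1) w r =
   (cmean (fun z => / (z - p) ^ l' * / (z - w) ^ m'.+1) w r -
    cmean (fun z => / (z - p) ^ l'.+1 * / (z - w) ^ m') w r) / (w - p))%C.
  have -> : cmean (fun z => / (z - p) ^ l' * / (z - w) ^ m'.+1)%C w r =
    (cmean (fun z => / (z - p) ^ l'.+1 * / (z - w) ^ m') w r +
     (w - p) * cmean (fun z => / (z - p) ^ l'.+1 * / (z - w) ^ m'.+1) w r)%C.
    rewrite -(cmeanZ _ (cP l'.+1 m'.+1)) -cmeanD //; last by apply: ccircM => //; apply: ccirc_cst.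
    apply: eq_cmean => t; have nz := @cpt_neq0 w r t r0.
    have nx : (cpt w r t - p)%C <> RtoC 0 by apply: np; rewrite Cmod_cpt; lra.
    move: (cpt w r t) nz nx => z nz nx; rewrite !Cpow_S.
    have n1 := Cpow_nz _ l' nx; have n2 := Cpow_nz _ m' nz.
    by move: ((z - p) ^ l')%C ((z - w) ^ m')%C n1 n2 => a b n1 n2; field; repeat split.
  by field.
have base m' : cmean (fun z => / (z - p) ^ 0 * / (z - w) ^ m'.+1)%C w r = RtoC 0.
  rewrite -(cmean_inv_pow w m' r0); apply: eq_cmean => t.
  by rewrite -[((_ - p) ^ 0)%C]/(RtoC 1) Cinv_one Cmult_1_l.
have zero l' : cmean (fun z => / (z - p) ^ l' * / (z - w) ^ 0)%C w r = (/ (w - p) ^ l')%C.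
  rewrite (@eq_cmean _ (fun z => / (z - p) ^ l')%C).
    rewrite cmean_disc // => z hz; apply: cdiffV; first by apply: cdiff_pow; apply: cdiff_sub.
    by apply: Cpow_nz; apply: np.
  by move=> t; rewrite -[((_ - w) ^ 0)%C]/(RtoC 1) Cinv_one Cmult_1_r.
elim: l m => [|l IHl] m.
  elim: m => [|m IHm].
    by rewrite zero !addn0 bin0 -[INR 1]/1 -[((- (1)) ^ 0)%C]/(RtoC 1) /Cdiv; ring.
  rewrite rec base IHm !add0n !binn addnS !Cpow_S.
  have n1 := Cpow_nz _ m nW.
  by move: n1; move: ((w - p) ^ m)%C => a n1; field.
elim: m => [|m IHm].
  by rewrite zero !addn0 bin0 -[INR 1]/1 -[((- (1)) ^ 0)%C]/(RtoC 1) /Cdiv; ring.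
rewrite rec IHl IHm [(l.+1 + m.+1)%nat]addSn binS RtoC_INR_add.
have -> : (l + m.+1 = l.+1 + m)%nat by lia.
have -> : (l.+2 + m = (l.+1 + m).+1)%nat by lia.
have -> : (l.+2 + m.+1 = (l.+1 + m).+2)%nat by lia.
move: (l.+1 + m)%nat => k; rewrite !Cpow_S; have n1 := Cpow_nz _ k nW.
by move: ((w - p) ^ k)%C n1 => a n1; field.
Qed.

(** * Means under inversion in a circle *)

Lemma polar_angle (z : C) : exists2 al, 0 <= al <= 2 * PI & z = (RtoC (Cmod z) * cis al)%C.
Proof.
have hp := PI_RGT_0.
case: (Ceq_dec z 0) => [->|nz].
  by exists 0; [lra | rewrite Cmod_0; ring].
have z0 : 0 < Cmod z by apply/Cmod_gt_0.
pose x := Re z / Cmod z; pose y := Im z / Cmod z.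
have xy : x ^ 2 + y ^ 2 = 1.
  rewrite /x /y; have -> : (Re z / Cmod z) ^ 2 + (Im z / Cmod z) ^ 2 = (Re z ^ 2 + Im z ^ 2) / Cmod z ^ 2.
    by field; lra.
  by rewrite -Cmod2_alt; field; lra.
have hx : -1 <= x <= 1 by split; nra.
have hc := cos_acos x hx; have hs := sin_acos x hx; have hb := acos_bound x.
have zE : z = (RtoC (Cmod z) * (x, y))%C.
  by apply: injective_projections; rewrite /x /y /Re /Im /=; field; lra.
case: (Rle_dec 0 y) => y0.
  exists (acos x); first lra.
  rewrite {1}zE; congr Cmult; rewrite /cis hc hs; congr pair.
  have -> : 1 - x² = y ^ 2 by rewrite /Rsqr; lra.
  by rewrite -Rsqr_pow2 sqrt_Rsqr.
exists (2 * PI - acos x); first lra.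
rewrite {1}zE; congr Cmult; rewrite /cis.
have -> : 2 * PI - acos x = - acos x + 2 * INR 1 * PI by rewrite /=; ring.
rewrite cos_period sin_period cos_neg sin_neg hc hs; congr pair.
have -> : 1 - x² = (- y) ^ 2 by rewrite /Rsqr; lra.
by rewrite -Rsqr_pow2 sqrt_Rsqr; lra.
Qed.

Lemma CInt_reflect h al : 0 <= al <= 2 * PI -> (forall t, rcont h t) ->
  (forall t, h (t + 2 * PI) = h t) ->
  CInt (fun t => h (al - t)) 0 (2 * PI) = CInt h 0 (2 * PI).
Proof.
move=> hal ch hper; have hp := PI_RGT_0.
have c a b : rcont_on h a b by move=> t _; apply: ch.
have lin (k : R -> R) a b : a <= b -> (forall t, continuous k t) ->
    RInt (fun t => k (al - t)) a b = RInt k (al - b) (al - a).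
  move=> ab ck; have ex u v : ex_RInt k u v.
    by apply: (ex_RInt_continuous (V := R_CompleteNormedModule)) => t _; apply: ck.
  have := RInt_comp_lin (V := R_CompleteNormedModule) k (-1) al a b (ex _ _).
  have -> : -1 * a + al = al - a by ring.
  have -> : -1 * b + al = al - b by ring.
  rewrite -(opp_RInt_swap (V := R_CompleteNormedModule) k (al - b) (al - a) (ex _ _)).
  rewrite RInt_scal; last first.
    apply: (ex_RInt_continuous (V := R_CompleteNormedModule)) => t _.
    apply: (continuous_comp (fun t => -1 * t + al) k); last exact: ck.
    by apply: (ex_derive_continuous (fun t => -1 * t + al)); auto_derive.
  rewrite /scal /= /mult /= /opp /= => e.
  rewrite (RInt_ext _ (fun y => k (-1 * y + al))); first by lra.
  by move=> t _; congr k; ring.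
have e1 : CInt (fun t => h (al - t)) 0 (2 * PI) = CInt h (al - 2 * PI) al.
  rewrite /CInt; congr pair.
    rewrite (lin (fun t => Re (h t))); first by rewrite Rminus_0_r.
      lra.
    by move=> t; apply: rcont_Re; apply: ch.
  rewrite (lin (fun t => Im (h t))); first by rewrite Rminus_0_r.
    lra.
  by move=> t; apply: rcont_Im; apply: ch.
have e2 : CInt h (al - 2 * PI) 0 = CInt h al (2 * PI).
  have sh (k : R -> R) : (forall t, continuous k t) -> (forall t, k (t + 2 * PI) = k t) ->
     RInt k (al - 2 * PI) 0 = RInt k al (2 * PI).
    move=> ck kp; have ex u v : ex_RInt k u v.
      by apply: (ex_RInt_continuous (V := R_CompleteNormedModule)) => t _; apply: ck.
    have := RInt_comp_lin (V := R_CompleteNormedModule) k 1 (2 * PI) (al - 2 * PI) 0 (ex _ _).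
    have -> : 1 * (al - 2 * PI) + 2 * PI = al by ring.
    have -> : 1 * 0 + 2 * PI = 2 * PI by ring.
    move=> <-; apply: RInt_ext => t _.
    by rewrite /scal /= /mult /= !Rmult_1_l kp.
  rewrite /CInt; congr pair; apply: sh => t; try by rewrite hper.
    by apply: rcont_Re; apply: ch.
  by apply: rcont_Im; apply: ch.
rewrite e1 (@CInt_Chasles h (al - 2 * PI) 0 al) //; last lra.
by rewrite e2 (@CInt_Chasles h 0 al (2 * PI)) //; ring.
Qed.

(** On the circle the map z -> w' + rho / (z - w) is t -> al - t in the angle, al being the argument
    of rho, and the mean over a full period does not see this reflection. *)
Lemma cmean_inversion f w w' r rho : 0 < r -> Cmod rho = r ^ 2 -> ccirc f w' r ->
  cmean (fun z => f (w' + rho / (z - w))%C) w r = cmean f w' r.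
Proof.
move=> r0 hrho cf; have [al hal e] := polar_angle rho.
rewrite /cmean; congr Cmult.
rewrite -(@CInt_reflect (fun t => f (cpt w' r t)) al hal).
- apply: eq_CInt; first by have := two_pi_gt0; lra.
  move=> t _; congr f; rewrite /cpt; congr Cplus.
  rewrite {1}e hrho.
  have nz : RtoC r <> RtoC 0 by move=> /RtoC_inj; lra.
  have nc : cis t <> RtoC 0 by move=> ec; have := Cmod_cis t; rewrite ec Cmod_0; lra.
  have -> : (w + RtoC r * cis t - w = RtoC r * cis t)%C by ring.
  have -> : cis al = (cis (al - t) * cis t)%C by rewrite -cis_add; congr cis; ring.
  by rewrite RtoC_pow /=; field.
- by move=> t; apply: (@ccirc_rcont f w' r t t cf); lra.
move=> t; congr f; rewrite /cpt; congr (_ + _ * _)%C.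
by have := cis_period t 1; rewrite /= Rmult_1_r.
Qed.

(** * Geometry of the Schottky group *)

Section Schottky.
Variables (g : nat) (w : letter g -> C) (rho sq : 'I_g -> C).
Hypotheses (hC : schottky_space w rho) (hsq : forall i : 'I_g, (sq i * sq i)%C = rho i).
Variable lam : R.
Hypothesis lam1 : 1 < lam.
Hypothesis hlam : forall a b : letter g, a <> b ->
  lam * (radius rho a + radius rho b) < Cmod (w a - w b).

Notation rad := (radius rho).
Let rad0 (a : letter g) : 0 < rad a. Proof. exact: radius_gt0 hC hsq a. Qed.

Lemma rad_neg a : rad (neg a) = rad a. Proof. by []. Qed.

Lemma rho_neq0 i : rho i <> RtoC 0. Proof. by case: hC. Qed.

Lemma Cmod_rho (a : letter g) : Cmod (rho a.1) = rad a ^ 2.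
Proof. by rewrite (radiusE hsq) -hsq Cmod_mult /=; ring. Qed.

Definition outer (a : letter g) (c : R) (p : sphere) : Prop :=
  if p is Some z then c < Cmod (z - w a) else True.

Definition inner (a : letter g) (c : R) (p : sphere) : Prop :=
  if p is Some z then Cmod (z - w a) < c else False.

Lemma gammaK a p : gamma w rho (neg a) (gamma w rho a p) = p.
Proof.
have r0 := @rho_neq0 a.1.
case: p => [z|] /=.
  case: (Ceq_dec z (w a)) => [e|ne] /=; first by rewrite negK e.
  have nz := Csub_neq0 ne.
  have nq : (rho a.1 / (z - w a))%C <> RtoC 0.
    move=> e; apply: r0; have -> : rho a.1 = (rho a.1 / (z - w a) * (z - w a))%C by field.
    by rewrite e Cmult_0_l.
  case: (Ceq_dec _ _) => [e|e'] /=.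
    exfalso; apply: nq; have -> : (rho a.1 / (z - w a) = (w (neg a) + rho a.1 / (z - w a)) - w (neg a))%C by ring.
    by rewrite e; ring.
  rewrite negK; apply: (f_equal Some).
  rewrite (_ : w (neg a) + rho a.1 / (z - w a) - w (neg a) = rho a.1 / (z - w a))%C; last by ring.
  by field; split.
by case: (Ceq_dec _ _).
Qed.

(** The distances of z to w_a and of its image to w_(-a) have product rad^2. *)
Lemma gamma_outer a mu p : 0 < mu -> outer a (rad a / mu) p ->
  inner (neg a) (mu * rad a) (gamma w rho a p).
Proof.
move=> mu0; have r0 := rad0 a; case: p => [z|] /=.
  move=> h; have q : 0 < rad a / mu by apply: Rdiv_lt_0_compat.
  case: (Ceq_dec z (w a)) => [e|ne] /=.
    by move: h; rewrite e (_ : w a - w a = 0)%C ?Cmod_0; [lra | ring].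
  rewrite (_ : _ + _ - _ = rho a.1 / (z - w a))%C; last by ring.
  rewrite Cmod_div; last exact: Csub_neq0.
  rewrite Cmod_rho; apply/Rlt_div_l; first lra.
  have -> : rad a ^ 2 = mu * rad a * (rad a / mu) by field; lra.
  by apply: Rmult_lt_compat_l => //; apply: Rmult_lt_0_compat.
move=> _; rewrite (_ : _ - _ = 0)%C ?Cmod_0; last by ring.
exact: Rmult_lt_0_compat.
Qed.

Lemma inner_outer a b p : a <> b -> inner b (lam * rad b) p -> outer a (lam * rad a) p.
Proof.
move=> ab; case: p => //= z h; have := hlam ab.
have -> : (w a - w b = (w a - z) + (z - w b))%C by ring.
have := Cmod_triangle (w a - z) (z - w b).
rewrite -(Cmod_opp (w a - z)) (_ : - (w a - z) = z - w a)%C; [lra | ring].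
Qed.

(** For mu > 1 the removed discs are shrunk, so the circles and annuli around them lie inside.
    Laurent expansions across the circles take place here. *)
Definition fund (mu : R) (p : sphere) : Prop := forall a, outer a (rad a / mu) p.

Fixpoint eval (s : seq (letter g)) (p : sphere) : sphere :=
  if s is a :: s' then gamma w rho a (eval s' p) else p.

Fixpoint reduced (s : seq (letter g)) : Prop :=
  if s is a :: s' then (if s' is b :: _ then a <> neg b else True) /\ reduced s' else True.

Lemma eval_reduced (T : sphere -> sphere) : schottky_group w rho T ->
  exists s, reduced s /\ forall p, T p = eval s p.
Proof.
elim=> [|a U _ [s [rs hs]]]; first by exists [::].
case: s rs hs => [|b s] rs hs.
  by exists [:: a]; split => // p; rewrite hs.
case: (eqVneq a (neg b)) => [e|/eqP ne].
  by exists s; split; [case: rs | move=> p; rewrite hs e /= gammaK].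
by exists (a :: b :: s); split => // p; rewrite hs.
Qed.

Lemma inner_mono a c c' p : c <= c' -> inner a c p -> inner a c' p.
Proof. by case: p => //= z h h'; lra. Qed.

Lemma inner_outer_absurd a c p : inner a c p -> outer a c p -> False.
Proof. by case: p => //= z; lra. Qed.

Lemma inv_lam_rad a : rad a / lam <= lam * rad a.
Proof.
have r0 := rad0 a; apply: (Rle_trans _ (rad a)); last nra.
by apply/Rle_div_l; nra.
Qed.

(** Ping-pong: the first letter lands in a disc enlarged by [lam], which still avoids the enlarged
    disc of any letter that may follow in a reduced word. From there every further letter lands in a
    disc shrunk by [lam]. *)
Lemma eval_fund s a p : reduced (a :: s) -> fund lam p ->
  inner (neg a) (lam * rad a) (eval (a :: s) p) /\
  (s <> [::] -> inner (neg a) (rad a / lam) (eval (a :: s) p)).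
Proof.
move=> rs hp; elim: s a rs => [|b s IH] a [ab rs].
  by split=> //; apply: gamma_outer; [lra | apply: hp].
have [h _] := IH b rs.
have k : inner (neg a) (rad a / lam) (eval (a :: b :: s) p).
  rewrite (_ : rad a / lam = / lam * rad a); last by rewrite /Rdiv; ring.
  apply: gamma_outer; first by apply: Rinv_0_lt_compat; lra.
  rewrite (_ : rad a / / lam = lam * rad a); last by field; lra.
  by apply: (inner_outer (b := neg b)).
by split=> // ; apply: inner_mono k; apply: inv_lam_rad.
Qed.

(* Words of length at least two move the enlarged fundamental region off
   itself. *)
Lemma group_fund T p : schottky_group w rho T -> fund lam p -> fund lam (T p) ->
  (forall q, T q = q) \/ exists a, forall q, T q = gamma w rho a q.
Proof.
move=> /eval_reduced[s [rs hs]] hp hT.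
case: s rs hs => [|a [|b s]] rs hs; first by left.
  by right; exists a.
have [_ /(_ ltac:(done)) h] := eval_fund rs hp.
by case: (@inner_outer_absurd _ _ _ h); rewrite -hs; apply: hT.
Qed.

Lemma group_comp T U : schottky_group w rho T -> schottky_group w rho U ->
  schottky_group w rho (fun p => T (U p)).
Proof.
move=> hT hU; elim: hT => [|a S _ IH]; first exact: hU.
exact: (schottky_comp a IH).
Qed.

Lemma group_gamma a : schottky_group w rho (gamma w rho a).
Proof. exact: (schottky_comp a (schottky_id w rho)). Qed.

Lemma group_inverse T : schottky_group w rho T ->
  exists U, schottky_group w rho U /\ forall p, U (T p) = p.
Proof.
elim=> [|a S _ [U [hU e]]]; first by exists (fun p => p); split=> //; apply: schottky_id.
exists (fun p => U (gamma w rho (neg a) p)); split.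
  by apply: group_comp => //; apply: group_gamma.
by move=> p; rewrite gammaK e.
Qed.

Lemma fund_open p : fund lam p -> exists2 eps, 0 < eps & forall q, sphere_ball p eps q -> fund lam q.
Proof.
case: p => [z|] hp.
  have h (a : 'I_g * bool) : 0 < Cmod (z - w a) - rad a / lam by have := hp a => /=; lra.
  have [d d0 hd] := fin_pos_lower h; exists d => // -[z'|] //= hz a /=.
  have := hd a; have := Cmod_sub_ge (z - w a) (z - z').
  have -> : (z - w a - (z - z') = z' - w a)%C by ring.
  by rewrite -(Cmod_opp (z - z')) (_ : - (z - z') = z' - z)%C; [lra | ring].
have h (a : 'I_g * bool) : 0 < / (Cmod (w a) + rad a / lam).
  apply: Rinv_0_lt_compat; have := Cmod_ge_0 (w a).
  have : 0 < rad a / lam by apply: Rdiv_lt_0_compat; [apply: rad0 | lra].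
  lra.
have [d d0 hd] := fin_pos_lower h; exists d => // -[z'|] //= hz a /=.
have q : Cmod (w a) + rad a / lam <= / d.
  rewrite -(Rinv_inv (Cmod (w a) + rad a / lam)); apply: Rinv_le_contravar => //.
have := Cmod_sub_ge z' (w a); lra.
Qed.

(** If T n z tends to p, then from some N on these points stay in the open set [fund lam], so T (N +
    n) composed with the inverse of T N is the identity or a letter by [group_fund]. Infinitely many
    distinct elements with finitely many possible values contradict the pigeonhole principle. *)
Lemma fund_regular p : fund lam p -> regular_set w rho p.
Proof.
move=> hp [z [T [hT hdist hlim]]].
have [eps e0 heps] := fund_open hp.
have [N hN] := hlim eps e0.
have hV n : fund lam (T (N + n)%nat z) by apply: heps; apply: hN; lia.
have [U [hU eU]] := group_inverse (hT (N + 0)%nat).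
have code n : exists o : option ('I_g * bool), forall q,
   T (N + n)%nat q = (if o is Some a then gamma w rho a (T (N + 0)%nat q) else T (N + 0)%nat q).
  have hS := group_comp (hT (N + n)%nat) hU.
  have := @group_fund (fun q => T (N + n)%nat (U q)) _ hS (hV 0%nat).
  rewrite eU => /(_ (hV n)) [h|[a h]].
    by exists None => q; rewrite -[RHS]h eU.
  by exists (Some a) => q; rewrite -[RHS]h eU.
pose c n := proj1_sig (constructive_indefinite_description _ (code n)).
have hc n := proj2_sig (constructive_indefinite_description _ (code n)).
pose K := #|{: option ('I_g * bool)}|.
have : ~~ injectiveb (fun i : 'I_K.+1 => c i).
  apply/negP => /injectiveP inj; have := leq_card _ inj.
  by rewrite card_ord -/K ltnn.
move=> /injectivePn[i [j ij e]].
have [|q] := hdist (N + i)%nat (N + j)%nat.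
  by move=> /eqP; rewrite eqn_add2l => /eqP /val_inj /eqP; rewrite (negbTE ij).
by apply; rewrite (hc i) (hc j) -/(c i) -/(c j) e.
Qed.

Section Point.
Variables (mu : R) (y : sphere).
Hypothesis hmu : 1 < mu <= lam.
Hypothesis hy : forall a, outer a (mu * rad a) y.

Lemma fund_mono p : fund mu p -> fund lam p.
Proof.
move=> h a; have := h a; case: p {h} => //= z h; apply: Rle_lt_trans h.
apply: Rmult_le_compat_l; first exact: Rlt_le.
by apply: Rinv_le_contravar; lra.
Qed.

Lemma fund_y : fund mu y.
Proof.
move=> a; have := hy a; have r0 := rad0 a; case: (y) => //= z h; apply: Rle_lt_trans h.
apply/Rle_div_l; first lra.
have h1 : 1 <= mu * mu by nra.
by have -> : mu * rad a * mu = rad a * (mu * mu) by [ring]; nra.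
Qed.

Lemma gamma_y a : inner (neg a) (rad a / mu) (gamma w rho a y).
Proof.
rewrite (_ : rad a / mu = / mu * rad a); last by rewrite /Rdiv; ring.
apply: gamma_outer; first by apply: Rinv_0_lt_compat; lra.
by rewrite (_ : rad a / / mu = mu * rad a); [apply: hy | field; lra].
Qed.

(** An element that moves y to another point of [fund mu] would be a letter, but letters send y
    closer than rad / mu to a centre, which [fund mu] excludes. This dictates the use of mu, adapted
    to y, in place of lam. *)
Lemma orbit_y x : fund mu x -> x <> y -> ~ same_orbit w rho y x.
Proof.
move=> hx xy [T [hT e]].
have := @group_fund T y hT (fund_mono fund_y).
rewrite e => /(_ (fund_mono hx)) [h|[a h]]; first by apply: xy; rewrite -e h.
apply: (@inner_outer_absurd (neg a) (rad a / mu) x); last exact: hx.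
by rewrite -e h; apply: gamma_y.
Qed.

Lemma orbit_to_y x : fund mu x -> x <> y -> ~ same_orbit w rho x y.
Proof.
move=> hx xy [T [hT e]]; have [U [hU eU]] := group_inverse hT.
by apply: (orbit_y hx xy); exists U; split=> //; rewrite -e eU.
Qed.

End Point.

Lemma exists_mu y : fundamental_region w rho y ->
  exists2 mu, 1 < mu <= lam & forall a, outer a (mu * rad a) y.
Proof.
case: y => [z|] h; last by exists lam; [lra | move=> a].
have k (a : 'I_g * bool) : 0 < Cmod (z - w a) / rad a - 1.
  have := h a; have r0 := rad0 a => h1.
  suff : 1 < Cmod (z - w a) / rad a by lra.
  by apply/Rlt_div_r; lra.
have [d d0 hd] := fin_pos_lower k; exists (Rmin lam (1 + d / 2)).
  by split; [apply: Rmin_glb_lt; lra | apply: Rmin_l].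
move=> a /=; have := hd a; have r0 := rad0 a => h1; have m := Rmin_r lam (1 + d / 2).
apply: (Rle_lt_trans _ ((1 + d / 2) * rad a)); first by apply: Rmult_le_compat_r; lra.
by apply/Rlt_div_r; lra.
Qed.

End Schottky.

(** * The bidifferential on the fundamental region *)

Lemma locally_C_prod (s t : C) (P : C * C -> Prop) :
  locally (T := prod_UniformSpace C_UniformSpace C_UniformSpace) (s, t) P ->
  exists2 d, 0 < d & forall s', Cmod (s' - s) < d -> P (s', t).
Proof.
move=> [d hd]; exists d; first exact: cond_pos.
move=> s' hs; apply: hd; split; last exact: ball_center.
exact: C_NormedModule_mixin_compat1.
Qed.

Lemma holomorphic2_cdiff h s t : holomorphic2_at h s t -> cdiff (fun s' => h s' t) s.
Proof.
move=> [l [lin hl]]; apply: (@cdiff_of_quotient _ _ (l (RtoC 1, RtoC 0))) => eps e0.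
have := hl (s, t) (fun P hP => hP) (mkposreal eps e0) => /locally_C_prod[d d0 hd].
exists d => // s' /hd /= h1.
have eN : norm (minus (s', t) (s, t) : prod_NormedModule C_AbsRing C_NormedModule C_NormedModule) = Cmod (s' - s).
  rewrite /norm /= /prod_norm /= /minus /plus /opp /= /prod_plus /prod_opp /=.
  rewrite (_ : norm (plus t (opp t)) = 0).
    by rewrite Rmult_0_l Rplus_0_r Rmult_1_r sqrt_square //; apply: Cmod_ge_0.
  by rewrite plus_opp_r norm_zero.
rewrite eN in h1; apply: Rle_trans h1; apply: Req_le.
have el : l (minus (s', t) (s, t)) = (l (RtoC 1, RtoC 0) * (s' - s))%C.
  have -> : minus (s', t) (s, t) =
     scal (s' - s)%C ((RtoC 1, RtoC 0) : prod_NormedModule C_AbsRing C_NormedModule C_NormedModule).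
    rewrite /minus /plus /opp /scal /= /prod_plus /prod_opp /prod_scal /=.
    rewrite /plus /opp /scal /= /mult /=; apply: injective_projections => /=; ring.
  by rewrite (linear_scal l lin) /scal /= /mult /= Cmult_comm.
by rewrite el.
Qed.

Lemma is_derive_of_estimate (f : C -> C) (s d : C) :
  (forall eps, 0 < eps -> exists2 del, 0 < del & forall s', Cmod (s' - s) < del ->
     Cmod (f s' - f s - d * (s' - s)) <= eps * Cmod (s' - s)) ->
  is_derive (K := C_AbsRing) (V := C_NormedModule) f s d.
Proof.
move=> h; split; first exact: is_linear_scal_l.
move=> x hx.
have <- : s = x by apply: (is_filter_lim_locally_unique (V := AbsRing_NormedModule C_AbsRing)).
move=> eps; have [del d0 hd] := h eps (cond_pos eps).
exists (mkposreal del d0) => s' hs'.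
have := hd s' hs' => h1.
rewrite /norm /= /minus /plus /opp /scal /= /mult /=.
have -> : (f s' + - f s + - ((s' + - s) * d) = f s' - f s - d * (s' - s))%C by ring.
exact: h1.
Qed.

Lemma cdiff_quotient_value (f : C -> C) (s : C) (phi : C -> C) :
  ccont phi s -> (forall z', f z' = (f s + phi z' * (z' - s))%C) ->
  is_derive (K := C_AbsRing) (V := C_NormedModule) f s (phi s).
Proof.
move=> cp e; apply: is_derive_of_estimate => eps e0.
have [d d0 hd] := cp eps e0; exists d => // z /hd hz.
rewrite e (_ : _ - _ - _ = (phi z - phi s) * (z - s))%C; last by ring.
by rewrite Cmod_mult; apply: Rmult_le_compat_r; [apply: Cmod_ge_0 | lra].
Qed.

Lemma derivative_id y : derivative_at (fun p => p) y (RtoC 1).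
Proof.
apply: is_derive_of_estimate => eps e0; exists 1; first lra.
move=> s' _.
have e s : coord y (param y s) = s.
  case: (y) => //=; case: (Ceq_dec s 0) => [e0'|ne] /=; first by [].
  by field.
rewrite !e (_ : _ - _ - _ = 0)%C; last by ring.
by rewrite Cmod_0; apply: Rmult_le_pos; [lra | apply: Cmod_ge_0].
Qed.

Lemma derivative_gamma g (w : letter g -> C) (rho : 'I_g -> C) a z : z <> w a ->
  derivative_at (gamma w rho a) (Some z) (- rho a.1 / (z - w a) ^ 2)%C.
Proof.
move=> ne; have nz := Csub_neq0 ne; have p : 0 < Cmod (z - w a) by apply/Cmod_gt_0.
rewrite /derivative_at /=; case: (Ceq_dec z (w a)) => // ne' /=.
pose phi s := (- rho a.1 / ((s - w a) * (z - w a)))%C.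
have -> : (- rho a.1 / ((z - w a) * ((z - w a) * 1)) = phi z)%C by rewrite /phi; field.
apply: (is_derive_ext_loc (fun s => (w (neg a) + rho a.1 / (z - w a)) + phi s * (s - z))%C).
  exists (mkposreal _ p) => s hs.
  have ns : s <> w a.
    move=> e; have := hs; rewrite /ball /= /AbsRing_ball /= /abs /= /minus /plus /opp /= e.
    by rewrite -Cmod_opp (_ : - (w a + - z) = z - w a)%C; [lra | ring].
  have n1 := Csub_neq0 ns; case: (Ceq_dec s (w a)) => // _ /=.
  by rewrite /phi; field; split.
have e : forall z', ((w (neg a) + rho a.1 / (z - w a)) + phi z' * (z' - z) =
  ((w (neg a) + rho a.1 / (z - w a)) + phi z * (z - z)) + phi z' * (z' - z))%C by move=> z'; ring.
apply: cdiff_quotient_value e.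
apply: ccontM; first exact: ccont_const.
apply: ccontV; last exact: Cmult_neq_0.
by apply: ccontM; [apply: cdiff_ccont; apply: cdiff_sub | apply: ccont_const].
Qed.

Section Omega.
Variables (g : nat) (w : letter g -> C) (rho sq : 'I_g -> C).
Hypotheses (hC : schottky_space w rho) (hsq : forall i : 'I_g, (sq i * sq i)%C = rho i).
Variables (lam mu : R) (y : sphere).
Hypothesis lam1 : 1 < lam.
Hypothesis hlam : forall a b : letter g, a <> b ->
  lam * (radius rho a + radius rho b) < Cmod (w a - w b).
Hypothesis hmu : 1 < mu <= lam.
Hypothesis hy : forall a, outer w a (mu * radius rho a) y.
Variable F : bidiff.
Hypothesis hF : normalized_bidiff w rho F.

Notation rad := (radius rho).
Notation V z := (fund w rho mu (Some z)).

Lemma fund_open_fin m z : fund w rho m (Some z) ->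
  exists2 d, 0 < d & forall z', Cmod (z' - z) < d -> fund w rho m (Some z').
Proof.
move=> hp; have h (a : 'I_g * bool) : 0 < Cmod (z - w a) - rad a / m by have := hp a => /=; lra.
have [d d0 hd] := fin_pos_lower h; exists d => // z' hz a /=.
have := hd a; have := Cmod_sub_ge (z - w a) (z - z').
have -> : (z - w a - (z - z') = z' - w a)%C by ring.
by rewrite -(Cmod_opp (z - z')) (_ : - (z - z') = z' - z)%C; [lra | ring].
Qed.

Let regular p : fund w rho mu p -> regular_set w rho p.
Proof. by move=> h; apply: (fund_regular hC hsq lam1 hlam); apply: (fund_mono hC hsq hmu h). Qed.

Let regular_y : regular_set w rho y.
Proof. by apply: regular; apply: (fund_y hC hsq hmu hy). Qed.

Let not_orbit x : fund w rho mu x -> x <> y -> ~ same_orbit w rho x y.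
Proof. exact: (orbit_to_y hC hsq lam1 hlam hmu hy). Qed.

Let not_orbit' x : fund w rho mu x -> x <> y -> ~ same_orbit w rho y x.
Proof. exact: (orbit_y hC hsq lam1 hlam hmu hy). Qed.

Lemma param_coord p : param p (coord p p) = p.
Proof. by case: p => //=; case: (Ceq_dec 0 0). Qed.

Lemma coord_change_coord p : coord_change p (coord p p) = RtoC 1.
Proof. by case: p => //=; case: (Ceq_dec 0 0). Qed.

Lemma F_cdiff z : V z -> Some z <> y -> cdiff (fun s => F (Some s) y) z.
Proof.
move=> hV ne; case: hF => -[_ _ h3 _] _.
have := h3 (Some z) y (regular hV) regular_y (not_orbit hV ne) => /holomorphic2_cdiff /=.
apply: cdiff_ext => s.
by rewrite /local_expr param_coord coord_change_coord /=; ring.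
Qed.

Lemma fund_None : fund w rho mu None. Proof. by []. Qed.

(** G is the form minus omega0, continued over y by the regular part h of the definition of F. K is
    the coefficient of the same difference in the coordinate s = 1/z at infinity; the factor - s^2
    is ds/dz. *)
Lemma regular_part : exists G : C -> C,
  [/\ forall z, V z -> Some z <> y -> F (Some z) y = (omega0 (Some z) y + G z)%C,
      forall z, V z -> cdiff G z
    & exists (K : C -> C) (d : R), [/\ 0 < d, ccont K (RtoC 0),
        forall s, s <> RtoC 0 -> Cmod s < d -> G (/ s)%C = (- (s * s) * K s)%C
      & y <> None -> F None y = (omega0 None y + K (RtoC 0))%C]].
Proof.
case: (hF) => -[_ _ h3 h4] _.
have [h [eps [e0 hh]]] := h4 y regular_y.
case: y hh (@F_cdiff) regular_y (@not_orbit None fund_None) (@not_orbit') => [y0|] hh dF ry no _ /=.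
- pose G z := if Ceq_dec z y0 then h y0 y0 else (F (Some z) (Some y0) - / ((z - y0) ^ 2))%C.
  have GE z : z <> y0 -> G z = (F (Some z) (Some y0) - / ((z - y0) ^ 2))%C.
    by move=> ne; rewrite /G; case: (Ceq_dec z y0).
  have Gh z : Cmod (z - y0) < eps -> h z y0 = G z.
    move=> hz; rewrite /G; case: (Ceq_dec z y0) => [e|ne] /=; first by rewrite e.
    have hy0 : Cmod (y0 - y0) < eps by rewrite (_ : y0 - y0 = 0)%C ?Cmod_0 //; ring.
    have [_ /(_ ne)] := hh z y0 hz hy0; rewrite /local_expr /= !Cmult_1_r => ->; ring.
  exists G; split.
  + move=> z hz ne; rewrite GE /=; first by ring.
    by move=> e; apply: ne; rewrite e.
  + move=> z hz; case: (Ceq_dec z y0) => [->|ne].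
      have hy0 : Cmod (y0 - y0) < eps by rewrite (_ : y0 - y0 = 0)%C ?Cmod_0 //; ring.
      have [/holomorphic2_cdiff dh _] := hh y0 y0 hy0 hy0.
      by apply: (cdiff_local e0 _ dh) => s hs; apply: Gh.
    have p : 0 < Cmod (z - y0) by apply/Cmod_gt_0; apply: Csub_neq0.
    apply: (@cdiff_local (fun z => F (Some z) (Some y0) - / ((z - y0) ^ 2))%C _ _ (Cmod (z - y0))) => //.
      move=> x hx; rewrite GE // => e; move: hx; rewrite e.
      by rewrite -Cmod_opp (_ : - (y0 - z) = z - y0)%C; [lra | ring].
    apply: cdiffB; first by apply: dF => // -[].
    apply: cdiffV; first by apply: cdiff_pow; apply: cdiff_sub.
    by apply: Cpow_nz; apply: Csub_neq0.
  have noN : None <> Some y0 by [].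
  have := h3 None (Some y0) (regular fund_None) ry (no noN) => /holomorphic2_cdiff /= dk.
  pose k s := local_expr F None (Some y0) s y0.
  pose d := (/ (Cmod y0 + 1)).
  have d0 : 0 < d by apply: Rinv_0_lt_compat; have := Cmod_ge_0 y0; lra.
  exists (fun s => k s + / ((1 - s * y0) ^ 2))%C, d; split => //.
  + apply: ccontD; first exact: (cdiff_ccont dk).
    apply: cdiff_ccont; apply: cdiffV.
      apply: cdiff_pow; apply: cdiffB; first exact: cdiff_const.
      by apply: cdiffM; [apply: cdiff_id | apply: cdiff_const].
    apply: Cpow_nz; rewrite (_ : 1 - 0 * y0 = 1)%C; last by ring.
    by move=> /RtoC_inj; lra.
  + move=> s s0 hs.
    have p := Cmod_ge_0 y0; have ps : 0 < Cmod s by apply/Cmod_gt_0.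
    have hsy : Cmod (s * y0) < 1.
      rewrite Cmod_mult; apply: (Rle_lt_trans _ (Cmod s * (Cmod y0 + 1))); first nra.
      have h1 := Rmult_lt_compat_r (Cmod y0 + 1) (Cmod s) d ltac:(lra) hs.
      by rewrite /d Rinv_l in h1; lra.
    have nz : (1 - s * y0)%C <> RtoC 0.
      by move=> e; have := Cmod_sub_ge 1 (s * y0); rewrite e Cmod_0 Cmod_1; lra.
    have ny : (/ s)%C <> y0.
      by move=> e; apply: nz; rewrite -e; field.
    rewrite GE // /k /local_expr /=; case: (Ceq_dec s 0) => // s0' /=.
    have n2 : (/ s - y0)%C <> RtoC 0 by apply: Csub_neq0.
    have -> : (/ s - y0 = (1 - s * y0) / s)%C by field.
    by field; split.
  move=> _; rewrite /k /local_expr /=; case: (Ceq_dec 0 0) => //= _.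
  have -> : (1 - 0 * y0 = 1)%C by ring.
  by rewrite !Cmult_1_r Cinv_one; ring.
(* Here y is infinity: omega0 is the constant -1 in z, its pole 1/s^2 appears only in the coordinate
   s, and K is the regular part h itself. *)
exists (fun z => F (Some z) None - - (1))%C; split.
+ by move=> z _ _; ring.
+ move=> z hz; apply: cdiffB; last exact: cdiff_const.
  exact: dF.
have h0 : Cmod (0 - 0) < eps by rewrite (_ : 0 - 0 = 0)%C ?Cmod_0 //; ring.
exists (fun s => h s (RtoC 0)), eps; split => //.
+ by have [/holomorphic2_cdiff /cdiff_ccont] := hh 0 0 h0 h0.
move=> s s0 hs.
have hs' : Cmod (s - 0) < eps by rewrite (_ : s - 0 = s)%C //; ring.
have [_ /(_ s0)] := hh s 0 hs' h0; rewrite /local_expr /=.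
case: (Ceq_dec s 0) => // s0' /=; case: (Ceq_dec 0 0) => //= _ e.
have e2 : h s 0 = (F (Some (/ s)) None * - / (s * s) * 1 - / ((s - 0) * ((s - 0) * 1)))%C.
  by rewrite e; ring.
have -> : (- (s * s) * h s 0 = - (s * s) * (F (Some (/ s)) None * - / (s * s) * 1 - / ((s - 0) * ((s - 0) * 1))))%C.
  by rewrite e2.
have -> : (s - 0 = s)%C by ring.
by field.
Qed.

Lemma gamma_circle a z : Cmod (z - w a) = rad a -> z <> w a.
Proof.
by move=> e ez; have := radius_gt0 hC hsq a; move: e; rewrite ez (_ : w a - w a = 0)%C ?Cmod_0; [lra | ring].
Qed.

Lemma circle_fund a z : Cmod (z - w a) = rad a -> V z.
Proof.
move=> e b /=; have r0 := radius_gt0 hC hsq b; have ra := radius_gt0 hC hsq a.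
case: (eqVneq (b : 'I_g * bool) a) => [->|/eqP ba].
  by rewrite e; apply/Rlt_div_l; [lra | nra].
have := hlam ba; have := Cmod_sub_ge (w b - w a) (z - w a).
have -> : (w b - w a - (z - w a) = - (z - w b))%C by ring.
rewrite Cmod_opp e => h1 h2.
apply: (Rlt_trans _ (rad b)); first by apply/Rlt_div_l; nra.
nra.
Qed.

Lemma circle_neq_y a z : Cmod (z - w a) = rad a -> Some z <> y.
Proof.
move=> e ez; have := hy a; rewrite -ez /= e; have := radius_gt0 hC hsq a; nra.
Qed.

Lemma gamma_image_circle a z : Cmod (z - w a) = rad a ->
  Cmod (w (neg a) + rho a.1 / (z - w a) - w (neg a)) = rad (neg a).
Proof.
move=> e; have nz := Csub_neq0 (gamma_circle e); have ra := radius_gt0 hC hsq a.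
rewrite (_ : _ - _ = rho a.1 / (z - w a))%C; last by ring.
rewrite Cmod_div // (Cmod_rho hsq) e rad_neg; field; lra.
Qed.

Lemma F_invariant a z : Cmod (z - w a) = rad a ->
  F (Some z) y = (F (Some (w (neg a) + rho a.1 / (z - w a))) y * (- rho a.1 / (z - w a) ^ 2))%C.
Proof.
move=> e; case: (hF) => -[h1 _ _ _] _.
have ne := gamma_circle e.
have := h1 _ _ (Some z) y _ _ (group_gamma w rho a) (schottky_id w rho) (regular (circle_fund e))
  regular_y (not_orbit (circle_fund e) (circle_neq_y e)) (derivative_gamma rho ne) (derivative_id y).
rewrite {1}/gamma; case: (Ceq_dec z (w a)) => [e'|ne']; first by case: (ne e').
by move=> /= <-; ring.
Qed.

Lemma F_ccirc a : ccirc (fun z => F (Some z) y) (w a) (rad a).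
Proof.
have ra := radius_gt0 hC hsq a.
apply: ccirc_cdiff; first lra.
by move=> z hz; apply: F_cdiff; [apply: circle_fund hz | apply: circle_neq_y hz].
Qed.

Lemma circleE a t : circle w rho a t = cpt (w a) (rad a) t.
Proof. by []. Qed.

(** On the circle dz = i (z - w) dt, so by symmetry of F the vanishing period of F(y, .) is, up to a
    nonzero constant, the mean of F(., y) (z - w), which is the residue. *)
Lemma residue_false (i : 'I_g) :
  cmean (fun z => F (Some z) y * (z - w (i, false)) ^ 1)%C (w (i, false)) (rad (i, false)) = RtoC 0.
Proof.
case: (hF) => -[_ h2 _ _] h5.
pose a : letter g := (i, false); have ra := radius_gt0 hC hsq a.
have hz t : Cmod (cpt (w a) (rad a) t - w a) = rad a by apply: Cmod_cpt; lra.
have /(h5 i y regular_y) hint : forall t, ~ same_orbit w rho y (Some (circle w rho (i, false) t)).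
  by move=> t; apply: not_orbit'; [apply: (circle_fund (hz t)) | apply: (circle_neq_y (hz t))].
have p := two_pi_gt0.
have cF : ccirc (fun z => F (Some z) y * (z - w a) ^ 1)%C (w a) (rad a).
  by apply: ccircM; [apply: F_ccirc | apply: ccirc_sub_pow].
have e t : (F y (Some (circle w rho a t)) * circle_velocity rho a t =
   Ci * (F (Some (cpt (w a) (rad a) t)) y * (cpt (w a) (rad a) t - w a) ^ 1))%C.
  rewrite circleE (h2 y (Some (cpt (w a) (rad a) t)) regular_y).
  - rewrite /circle_velocity Cpow_1_r.
    have -> : (cpt (w a) (rad a) t - w a = RtoC (rad a) * (cos t, sin t))%C by rewrite /cpt /cis; ring.
    by ring.
  - exact: regular (circle_fund (hz t)).
  by apply: not_orbit'; [apply: (circle_fund (hz t)) | apply: (circle_neq_y (hz t))].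
have hI : CInt (fun t => F y (Some (circle w rho a t)) * circle_velocity rho a t)%C 0 (2 * PI) = RtoC 0.
  apply: injective_projections.
    exact: is_RInt_unique (is_RInt_fct_extend_fst _ _ _ _ hint).
  exact: is_RInt_unique (is_RInt_fct_extend_snd _ _ _ _ hint).
rewrite (eq_CInt (Rlt_le _ _ p) (fun t _ => e t)) in hI.
rewrite (CIntZ _ (Rlt_le _ _ p) (@ccirc_rcont _ _ _ _ _ cF)) in hI.
have Ci2 : (Ci * Ci = - (1))%C by apply: injective_projections => /=; ring.
have I0 (I : C) : (Ci * I = 0)%C -> I = RtoC 0.
  move=> h; have -> : (I = - (Ci * Ci) * I)%C by rewrite Ci2; ring.
  by transitivity (- Ci * (Ci * I))%C; [ring | rewrite h; ring].
by rewrite /cmean -/a (I0 _ hI); ring.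
Qed.

(** The map gamma_a preserves F(z) dz and reverses the orientation of the circle. This carries the
    normalization from the circles with index -i to those with index i. *)
Lemma cmean_residue_neg a :
  cmean (fun z => F (Some z) y * (z - w a) ^ 1)%C (w a) (rad a) =
  (- cmean (fun z => F (Some z) y * (z - w (neg a)) ^ 1) (w (neg a)) (rad (neg a)))%C.
Proof.
have ra := radius_gt0 hC hsq a.
have cF : ccirc (fun z => F (Some z) y * (z - w (neg a)) ^ 1)%C (w (neg a)) (rad (neg a)).
  by apply: ccircM; [apply: F_ccirc | apply: ccirc_sub_pow].
rewrite -(@cmean_inversion _ (w a) (w (neg a)) (rad (neg a)) (rho a.1)) //; last first.
  by rewrite (Cmod_rho hsq).
have cG : ccirc (fun z => F (Some (w (neg a) + rho a.1 / (z - w a))) y *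
     (w (neg a) + rho a.1 / (z - w a) - w (neg a)) ^ 1)%C (w a) (rad (neg a)).
  move=> t; apply: (ccont_comp (f := fun u => (F (Some u) y * (u - w (neg a)) ^ 1)%C)
    (h := fun z => (w (neg a) + rho a.1 / (z - w a))%C)).
    apply: cdiff_ccont; apply: cdiffD; first exact: cdiff_const.
    apply: cdiff_div; [exact: cdiff_const | exact: cdiff_sub |].
    by apply: cpt_neq0; rewrite rad_neg.
  have hz : Cmod (cpt (w a) (rad (neg a)) t - w a) = rad a by rewrite Cmod_cpt // rad_neg; lra.
  have h := gamma_image_circle hz.
  apply: cdiff_ccont; apply: cdiffM; last by apply: cdiff_pow; apply: cdiff_sub.
  by apply: F_cdiff; [apply: circle_fund h | apply: circle_neq_y h].
rewrite rad_neg in cG *.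
have -> : (- cmean (fun z => F (Some (w (neg a) + rho a.1 / (z - w a))) y *
     (w (neg a) + rho a.1 / (z - w a) - w (neg a)) ^ 1) (w a) (rad a) =
   cmean (fun z => - (1) * (F (Some (w (neg a) + rho a.1 / (z - w a))) y *
     (w (neg a) + rho a.1 / (z - w a) - w (neg a)) ^ 1)) (w a) (rad a))%C.
  by rewrite (cmeanZ _ cG); ring.
apply: eq_cmean => t.
have hz : Cmod (cpt (w a) (rad a) t - w a) = rad a by rewrite Cmod_cpt; lra.
rewrite (F_invariant hz); have nz := Csub_neq0 (gamma_circle hz).
by move: (cpt (w a) (rad a) t) nz => z nz; rewrite !Cpow_1_r; field.
Qed.

Lemma residue a :
  cmean (fun z => F (Some z) y * (z - w a) ^ 1)%C (w a) (rad a) = RtoC 0.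
Proof.
case: a => i [|]; last exact: residue_false.
by rewrite cmean_residue_neg residue_false; ring.
Qed.

(** With u = gamma_a z one has z - w_a = rho / (u - w_(-a)) and F(z) = - rho F(u) / (z - w_a)^2.
    Thus a principal coefficient at w_a becomes a Taylor coefficient at w_(-a). *)
Lemma moment_relation a n :
  cmean (fun z => F (Some z) y * (z - w a) ^ n.+2)%C (w a) (rad a) =
  (- rho a.1 ^ n.+1 * cmean (fun z => F (Some z) y * / (z - w (neg a)) ^ n) (w (neg a)) (rad (neg a)))%C.
Proof.
have ra := radius_gt0 hC hsq a; have r0 := @rho_neq0 g w rho hC a.1.
have cF : ccirc (fun z => F (Some z) y * / (z - w (neg a)) ^ n)%C (w (neg a)) (rad (neg a)).
  by apply: ccircM; [apply: F_ccirc | apply: ccirc_inv_sub_pow; rewrite rad_neg].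
rewrite -(@cmean_inversion _ (w a) (w (neg a)) (rad (neg a)) (rho a.1)) //; last first.
  by rewrite (Cmod_rho hsq).
rewrite rad_neg.
have cG : ccirc (fun z => F (Some (w (neg a) + rho a.1 / (z - w a))) y *
     / (w (neg a) + rho a.1 / (z - w a) - w (neg a)) ^ n)%C (w a) (rad a).
  move=> t.
  have hz : Cmod (cpt (w a) (rad a) t - w a) = rad a by rewrite Cmod_cpt //; lra.
  have h := gamma_image_circle hz.
  apply: (ccont_comp (f := fun u => (F (Some u) y * / (u - w (neg a)) ^ n)%C)
    (h := fun z => (w (neg a) + rho a.1 / (z - w a))%C)).
    apply: cdiff_ccont; apply: cdiffD; first exact: cdiff_const.
    apply: cdiff_div; [exact: cdiff_const | exact: cdiff_sub |].
    exact: cpt_neq0.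
  apply: cdiff_ccont; apply: cdiffM.
    by apply: F_cdiff; [apply: circle_fund h | apply: circle_neq_y h].
  apply: cdiffV; first by apply: cdiff_pow; apply: cdiff_sub.
  by apply: Cpow_nz; apply/Cmod_gt_0; rewrite h rad_neg.
rewrite -(cmeanZ _ cG); apply: eq_cmean => t.
have hz : Cmod (cpt (w a) (rad a) t - w a) = rad a by rewrite Cmod_cpt; lra.
rewrite (F_invariant hz); have nz := Csub_neq0 (gamma_circle hz).
move: (cpt (w a) (rad a) t) nz => z nz.
rewrite (_ : w (neg a) + rho a.1 / (z - w a) - w (neg a) = rho a.1 / (z - w a))%C; last by ring.
rewrite /Cdiv Cpow_mult_l Cpow_inv // !Cpow_S.
have n1 := Cpow_nz _ n nz; have n2 := Cpow_nz _ n r0.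
move: ((z - w a) ^ n)%C (rho a.1 ^ n)%C n1 n2 => u v n1 n2.
rewrite -[((z - w a) ^ 0)%C]/(RtoC 1).
by field; repeat split.
Qed.

End Omega.

(** * Decomposition into principal parts *)

Lemma omega0_cdiff (y : sphere) z : Some z <> y -> cdiff (fun z => omega0 (Some z) y) z.
Proof.
case: y => [y0|] ne; last exact: cdiff_const.
apply: cdiffV; first by apply: cdiff_pow; apply: cdiff_sub.
by apply: Cpow_nz; apply: Csub_neq0 => e; apply: ne; rewrite e.
Qed.

Section Decomposition.
Variables (g : nat) (w : letter g -> C) (rho sq : 'I_g -> C).
Hypotheses (hC : schottky_space w rho) (hsq : forall i : 'I_g, (sq i * sq i)%C = rho i).
Variables (lam mu : R) (y : sphere).
Hypothesis lam1 : 1 < lam.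
Hypothesis hlam : forall a b : letter g, a <> b ->
  lam * (radius rho a + radius rho b) < Cmod (w a - w b).
Hypothesis hmu : 1 < mu <= lam.
Hypothesis hy : forall a, outer w a (mu * radius rho a) y.

Notation rad := (radius rho).
Notation V z := (fund w rho mu (Some z)).
Notation LT := ('I_g * bool)%type.

Variables (f G K : C -> C) (d : R).
Hypothesis fG : forall z, V z -> Some z <> y -> f z = (omega0 (Some z) y + G z)%C.
Hypothesis dG : forall z, V z -> cdiff G z.
Hypothesis d0 : 0 < d.
Hypothesis cK : ccont K (RtoC 0).
Hypothesis GK : forall s, s <> RtoC 0 -> Cmod s < d -> G (/ s)%C = (- (s * s) * K s)%C.

(** The coefficient of (z - w_a)^(-n-1) in the Laurent series of f around the circle. *)
Definition res (a : letter g) (n : nat) : C :=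
  cmean (fun z => f z * (z - w a) ^ n.+1)%C (w a) (rad a).

Hypothesis res0 : forall a, res a 0 = RtoC 0.

(** Strictly between 1 and mu: the closed annulus from rad / nu to nu rad around a circle lies in
    the domain of G and avoids y. *)
Let nu := (1 + mu) / 2.
Let nu1 : 1 < nu < mu. Proof. by rewrite /nu; lra. Qed.
Let r0 (a : letter g) : 0 < rad a. Proof. exact: radius_gt0 hC hsq a. Qed.
Let rin a := rad a / nu.
Let rout a := nu * rad a.
Let rin0 a : 0 < rin a. Proof. by apply: Rdiv_lt_0_compat => //; lra. Qed.
Let rin1 a : rin a < rad a. Proof. by apply/Rlt_div_l; [lra | have := r0 a; nra]. Qed.
Let rout1 a : rad a < rout a. Proof. by have := r0 a; rewrite /rout; nra. Qed.

Lemma rin_mu a : rad a / mu < rin a.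
Proof.
apply: Rmult_lt_compat_l => //; apply: Rinv_lt_contravar; last lra.
by apply: Rmult_lt_0_compat; lra.
Qed.

Lemma rout_lam a : rout a <= lam * rad a.
Proof. by apply: Rmult_le_compat_r; [apply: Rlt_le | lra]. Qed.

Lemma disc_far a b z : a <> b -> Cmod (z - w a) <= rout a -> rad b < Cmod (z - w b).
Proof.
move=> ab hz; have ba : b <> a by move=> e; apply: ab.
have := hlam ba; have := Cmod_sub_ge (w b - w a) (z - w a).
have -> : (w b - w a - (z - w a) = - (z - w b))%C by ring.
rewrite Cmod_opp => h1 h2; have := rout_lam a; have := r0 b; nra.
Qed.

Lemma annulus_V a z : rin a <= Cmod (z - w a) <= rout a -> V z.
Proof.
move=> hz b /=; case: (eqVneq (b : LT) a) => [->|/eqP ba].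
  by have := rin_mu a; lra.
have ab : a <> b by move=> e; apply: ba.
have h := disc_far ab (proj2 hz).
by have := rin_mu b; have := rin1 b; lra.
Qed.

Lemma disc_neq_y a z : Cmod (z - w a) <= rad a -> Some z <> y.
Proof. by move=> hz e; have := hy a; rewrite -e /=; have := r0 a; nra. Qed.

Lemma G_ccirc a r : rin a <= r <= rout a -> ccirc G (w a) r.
Proof.
move=> hr; apply: ccirc_cdiff; first by have := rin0 a; lra.
by move=> z hz; apply: dG; apply: (@annulus_V a); rewrite hz.
Qed.

(** omega0(., y) is holomorphic in the disc, so f and G have the same principal coefficients; those
    of G may be computed on any circle of the annulus. *)
Lemma G_moment a n r : rin a <= r <= rout a ->
  cmean (fun z => G z * (z - w a) ^ n.+1)%C (w a) r = res a n.
Proof.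
move=> hr; have ri := rin0 a; have ri1 := rin1 a; have ro := rout1 a; have ra := r0 a.
have an r' : rin a <= r' <= rout a -> cmean (fun z => G z * (z - w a) ^ n.+1)%C (w a) r' =
   cmean (fun z => G z * (z - w a) ^ n.+1)%C (w a) (rin a).
  move=> hr'; symmetry; apply: cmean_annulus; first lra.
  move=> z hz; apply: cdiffM; last by apply: cdiff_pow; apply: cdiff_sub.
  by apply: dG; apply: (@annulus_V a); lra.
rewrite an // -(an (rad a)); last lra.
have om : cmean (fun z => omega0 (Some z) y * (z - w a) ^ n.+1)%C (w a) (rad a) = RtoC 0.
  rewrite cmean_disc //; first by rewrite Cpow_S; ring.
  move=> z hz; apply: cdiffM; last by apply: cdiff_pow; apply: cdiff_sub.
  by apply: omega0_cdiff; apply: disc_neq_y hz.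
have com : ccirc (fun z => omega0 (Some z) y * (z - w a) ^ n.+1)%C (w a) (rad a).
  apply: ccircM; last exact: ccirc_sub_pow.
  by apply: ccirc_cdiff => [|z hz]; [lra | apply: omega0_cdiff; apply: (@disc_neq_y a); lra].
have cGm : ccirc (fun z => G z * (z - w a) ^ n.+1)%C (w a) (rad a).
  by apply: ccircM; [apply: G_ccirc; lra | apply: ccirc_sub_pow].
have := cmeanD com cGm; rewrite om Cplus_0_l => <-.
apply: eq_cmean => t.
have hz : Cmod (cpt (w a) (rad a) t - w a) = rad a by rewrite Cmod_cpt; lra.
rewrite fG; first by ring.
- by apply: (@annulus_V a); lra.
by apply: (@disc_neq_y a); lra.
Qed.

(** Computed on the inner circle of the annulus, the coefficients decay with a ratio below rad a, so
    the principal part converges on the circle and slightly inside it. *)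
Lemma res_geo a : exists B, geo (rin a) B (fun n => res a n.+1).
Proof.
have ri := rin0 a; have ri1 := rin1 a; have ro := rout1 a.
have cG : ccirc G (w a) (rin a) by apply: G_ccirc; lra.
have [B B0 hB] := ccirc_bounded cG.
exists (2 * (B * rin a ^ 2)) => n.
rewrite -(@G_moment a n.+1 (rin a)); last lra.
have -> : 2 * (B * rin a ^ 2) * rin a ^ n = 2 * (B * rin a ^ n.+2) by rewrite /=; ring.
apply: cmean_bound; first by apply: ccircM => //; apply: ccirc_sub_pow.
move=> t ht; rewrite Cmod_mult Cmod_pow Cmod_cpt; last lra.
by apply: Rmult_le_compat_r; [apply: pow_le; lra | apply: hB].
Qed.

(** A power series in u = 1 / (z - w_a). As the residue vanishes, the principal part starts with the
    double pole, whence the index n + 1 here and the factor u^2 in [sing]. *)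
Definition polar_part (a : letter g) (u : C) : C := cser (fun n => res a n.+1 * u ^ n)%C.

Definition sing (a : letter g) (z : C) : C :=
  ((/ (z - w a)) ^ 2 * polar_part a (/ (z - w a)))%C.

Lemma polar_part_cdiff a u : rin a * Cmod u < 1 -> cdiff (polar_part a) u.
Proof.
move=> hu; have [B hB] := res_geo a.
exact: (cser_pow_cdiff (rin0 a) hB hu).
Qed.

Lemma inv_small a z : rin a < Cmod (z - w a) -> (z - w a)%C <> RtoC 0 /\ rin a * Cmod (/ (z - w a)) < 1.
Proof.
move=> hz; have ri := rin0 a; have nz : (z - w a)%C <> RtoC 0 by apply/Cmod_gt_0; lra.
split=> //; rewrite Cmod_inv //.
by apply/Rlt_div_l; lra.
Qed.

Lemma sing_cdiff a z : rin a < Cmod (z - w a) -> cdiff (sing a) z.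
Proof.
move=> /inv_small[nz hz].
have di : cdiff (fun z => / (z - w a))%C z by apply: cdiffV => //; apply: cdiff_sub.
apply: cdiffM; first exact: cdiff_pow.
by apply: (cdiff_comp (f := polar_part a)) => //; apply: polar_part_cdiff.
Qed.

Lemma sing_geo a z : rin a < Cmod (z - w a) ->
  exists theta c, 0 <= theta < 1 /\ geo theta c (fun n => res a n.+1 * (/ (z - w a)) ^ n)%C.
Proof.
move=> /inv_small[nz hz]; have [B hB] := res_geo a.
exists (rin a * Cmod (/ (z - w a))), B; split.
  by split => //; apply: Rmult_le_pos; [apply: Rlt_le | apply: Cmod_ge_0].
move=> n; rewrite Cmod_mult Cmod_pow Rpow_mult_distr -Rmult_assoc.
by apply: Rmult_le_compat_r => //; apply: pow_le; apply: Cmod_ge_0.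
Qed.

Lemma singE a z : rin a < Cmod (z - w a) ->
  cser (fun n => res a n * / (z - w a) ^ n.+1)%C = sing a z.
Proof.
move=> hz; have [nz _] := inv_small hz; have [th [c [ht hg]]] := sing_geo hz.
pose u := (/ (z - w a))%C.
have e n : (res a n.+1 * / (z - w a) ^ n.+2 = u ^ 2 * (res a n.+1 * u ^ n))%C.
  by rewrite -Cpow_inv // -/u !Cpow_S /=; ring.
have hg2 : geo th (Cmod (u ^ 2) * c) (fun n => res a n.+1 * / (z - w a) ^ n.+2)%C.
  by move=> n; rewrite e; apply: (geoZ (u ^ 2)%C hg).
have key : cser (fun n => res a n.+1 * / (z - w a) ^ n.+2)%C = sing a z.
  by rewrite /sing -/u /polar_part -(cserZ (u ^ 2)%C ht hg); apply: eq_cser.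
(* This ratio is at least 1/2, so the shift of the index by one costs a factor of at most 2, even
   for th = 0. *)
have th' : 0 <= (1 + th) / 2 < 1 by lra.
have c0 := geo_ge0 hg2.
move: hg2 c0; set C0 := (Cmod _ * c) => hg2 c0.
have hg3 : geo ((1 + th) / 2) (2 * C0) (fun n => res a n * / (z - w a) ^ n.+1)%C.
  case=> [|n].
    by rewrite res0 Cmult_0_l Cmod_0 [_ ^ 0]/= Rmult_1_r; lra.
  apply: Rle_trans (hg2 n) _.
  have h1 : th ^ n <= ((1 + th) / 2) ^ n by apply: pow_incr; lra.
  have h2 : 0 <= th ^ n by apply: pow_le; lra.
  rewrite (_ : ((1 + th) / 2) ^ n.+1 = (1 + th) / 2 * ((1 + th) / 2) ^ n) //.
  set q := ((1 + th) / 2) ^ n in h1 *.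
  have -> : 2 * C0 * ((1 + th) / 2 * q) = (1 + th) * (C0 * q) by field.
  have : C0 * th ^ n <= C0 * q by apply: Rmult_le_compat_l.
  have : 0 <= C0 * th ^ n by apply: Rmult_le_pos.
  nra.
by rewrite (cser_recl th' hg3) res0 key; ring.
Qed.

Definition reg (a : letter g) (z : C) : C :=
  cser (fun n => cmean (fun z => G z * / (z - w a) ^ n) (w a) (rout a) * (z - w a) ^ n)%C.

Lemma reg_cdiff a z : Cmod (z - w a) < rout a -> cdiff (reg a) z.
Proof.
move=> hz; have ro := rout1 a; have ra := r0 a; have ri1 := rin1 a.
have ro0 : 0 < rout a by lra.
have cG : ccirc G (w a) (rout a) by apply: G_ccirc; lra.
have [B B0 hB] := ccirc_bounded cG.
have hg : geo (/ rout a) (2 * B) (fun n => cmean (fun z => G z * / (z - w a) ^ n)%C (w a) (rout a)).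
  move=> n; rewrite Rmult_assoc; apply: cmean_bound.
    by apply: ccircM => //; apply: ccirc_inv_sub_pow.
  move=> t ht; rewrite Cmod_mult Cmod_inv; last by apply: Cpow_nz; apply: cpt_neq0.
  rewrite Cmod_pow Cmod_cpt; last lra.
  rewrite pow_inv; apply: Rmult_le_compat_r; last exact: hB.
  by apply: Rlt_le; apply: Rinv_0_lt_compat; apply: pow_lt.
apply: (cdiff_comp (f := fun u => cser (fun n => cmean (fun z => G z * / (z - w a) ^ n) (w a) (rout a) * u ^ n)%C)
   (h := fun z => (z - w a)%C)).
  exact: cdiff_sub.
apply: (cser_pow_cdiff _ hg); first exact: Rinv_0_lt_compat.
by rewrite Rmult_comm; apply/Rlt_div_l; lra.
Qed.

Lemma laurent_G a z : rin a < Cmod (z - w a) < rout a -> G z = (reg a z + sing a z)%C.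
Proof.
move=> hz; have ri := rin0 a; have ro := rout1 a; have ri1 := rin1 a.
rewrite (@laurent G (w a) z (rin a) (rout a) ri hz); last first.
  by move=> u hu; apply: dG; apply: (@annulus_V a).
congr Cplus; rewrite -(singE (proj1 hz)); apply: eq_cser => n.
by congr Cmult; apply: G_moment; lra.
Qed.

Let other a z := (csum (fun b : LT => sing b z) - sing a z)%C.

Lemma sing_other a : forall z, other a z = csum (fun b : LT => if b == a then RtoC 0 else sing b z).
Proof.
move=> z; rewrite /other /csum (bigD1 a) //= [RHS](bigD1 (a : LT)) //= eqxx.
have aux (x u : C) : (x + u - x = 0 + u)%C by ring.
rewrite aux; congr Cplus.
by apply: eq_bigr => b /negbTE ->.
Qed.

Lemma other_cdiff a z : Cmod (z - w a) <= rout a -> cdiff (other a) z.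
Proof.
move=> hz; apply: (cdiff_ext (fun z => esym (sing_other a z))).
apply: (cdiff_csum (f := fun (b : LT) z => if b == a then RtoC 0 else sing b z)) => b.
case: eqP => [_|ba]; first exact: cdiff_const.
apply: sing_cdiff; have ab : a <> b by move=> e; apply: ba.
by have := disc_far ab hz; have := rin1 b; lra.
Qed.

Let in_disc z (a : LT) : bool := is_left (Rle_dec (Cmod (z - w a)) (rad a)).

Lemma in_discP z a : reflect (Cmod (z - w a) <= rad a) (in_disc z a).
Proof. by rewrite /in_disc; case: Rle_dec => h /=; constructor. Qed.

(* [G] minus its principal parts, continued across each disc by the regular part
   of the Laurent series of [G]: an entire function. *)
Let E z : C := if [pick a | in_disc z a] is Some a then (reg a z - other a z)%C
  else (G z - csum (fun b : LT => sing b z))%C.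

Lemma E_near a z : Cmod (z - w a) < rout a -> E z = (reg a z - other a z)%C.
Proof.
move=> hz; rewrite /E; case: pickP => [b /in_discP hb|none].
  case: (eqVneq (a : LT) b) => [->//|/eqP ab].
  by have := disc_far ab (Rlt_le _ _ hz); lra.
have h : rad a < Cmod (z - w a).
  by apply: Rnot_le_lt => h; have := none a; move/in_discP: h => ->.
rewrite (@laurent_G a); last by have := rin1 a; lra.
by rewrite /other; ring.
Qed.

Lemma E_far z : (forall a, rad a < Cmod (z - w a)) ->
  E z = (G z - csum (fun b : LT => sing b z))%C.
Proof.
move=> h; rewrite /E; case: pickP => [b /in_discP hb|//].
by have := h b; lra.
Qed.

Lemma sing_sum_cdiff z : (forall a, rin a < Cmod (z - w a)) ->
  cdiff (fun z => csum (fun b : LT => sing b z)) z.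
Proof. by move=> h; apply: cdiff_csum => a; apply: sing_cdiff. Qed.

Lemma E_cdiff z : cdiff E z.
Proof.
case: (pickP (fun a : LT => is_left (Rlt_dec (Cmod (z - w a)) (rout a)))) => [a|none].
  case: Rlt_dec => // ha _.
  have p : 0 < rout a - Cmod (z - w a) by lra.
  apply: (@cdiff_local (fun z => reg a z - other a z)%C _ _ _ p).
    move=> x hx; symmetry; apply: E_near.
    have -> : (x - w a = (x - z) + (z - w a))%C by ring.
    by apply: Rle_lt_trans (Cmod_triangle _ _) _; lra.
  by apply: cdiffB; [apply: reg_cdiff | apply: other_cdiff; lra].
have far a : rout a <= Cmod (z - w a).
  by have := none a; case: Rlt_dec => // h _; lra.
have hV1 : fund w rho 1 (Some z).
  by move=> a /=; rewrite Rdiv_1_r; have := far a; have := rout1 a; lra.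
have [e e0 he] := fund_open_fin hV1.
have he' x a : Cmod (x - z) < e -> rad a < Cmod (x - w a).
  by move=> hx; have := he x hx a => /=; rewrite Rdiv_1_r.
apply: (@cdiff_local (fun z => G z - csum (fun b : LT => sing b z))%C _ _ _ e0).
  by move=> x hx; rewrite E_far // => a; apply: he'.
apply: cdiffB.
  apply: dG => a /=; have := far a; have := rout1 a; have := rin1 a; have := rin_mu a; lra.
by apply: sing_sum_cdiff => a; have := far a; have := rout1 a; have := rin1 a; lra.
Qed.

(* In the coordinate s = 1/z at infinity. *)
Let sing_inf a s : C :=
  ((/ (1 - s * w a)) ^ 2 * polar_part a (s / (1 - s * w a)))%C.

Lemma sing_inf_ccont a : ccont (sing_inf a) (RtoC 0).
Proof.
have e1 : (1 - 0 * w a = 1)%C by ring.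
have n1 : (1 - 0 * w a)%C <> RtoC 0 by rewrite e1 => /RtoC_inj; lra.
have dl : cdiff (fun s => 1 - s * w a)%C (RtoC 0).
  apply: cdiffB; first exact: cdiff_const.
  by apply: cdiffM; [apply: cdiff_id | apply: cdiff_const].
apply: cdiff_ccont; apply: cdiffM; first by apply: cdiff_pow; apply: cdiffV.
apply: (cdiff_comp (f := polar_part a) (h := fun s => (s / (1 - s * w a))%C)).
  by apply: cdiff_div => //; apply: cdiff_id.
apply: polar_part_cdiff; rewrite e1 (_ : 0 / 1 = 0)%C; first by rewrite Cmod_0; lra.
by rewrite /Cdiv Cmult_0_l.
Qed.

Lemma sing_infE a s : s <> RtoC 0 -> (1 - s * w a)%C <> RtoC 0 ->
  sing a (/ s)%C = (s * s * sing_inf a s)%C.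
Proof.
move=> ns n1; rewrite /sing /sing_inf.
have -> : (/ s - w a = (1 - s * w a) / s)%C by field.
have -> : (/ ((1 - s * w a) / s) = s / (1 - s * w a))%C by field; split.
by rewrite /Cdiv Cpow_mult_l /=; ring.
Qed.

Lemma one_sub_neq0 : exists2 e, 0 < e & forall s (a : letter g), Cmod s < e -> (1 - s * w a)%C <> RtoC 0.
Proof.
have h (a : LT) : 0 < / (Cmod (w a) + 1).
  by apply: Rinv_0_lt_compat; have := Cmod_ge_0 (w a); lra.
have [e e0 he] := fin_pos_lower h; exists e => // s a hs e1.
have := Cmod_sub_ge 1 (s * w a); rewrite e1 Cmod_0 Cmod_1 Cmod_mult => h1.
have w0 := Cmod_ge_0 (w a); have s0 := Cmod_ge_0 s.
have h2 : Cmod s * (Cmod (w a) + 1) < 1.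
  have h3 : Cmod s < / (Cmod (w a) + 1) by apply: Rlt_le_trans hs (he a).
  have := Rmult_lt_compat_r (Cmod (w a) + 1) _ _ ltac:(lra) h3.
  by rewrite Rinv_l; lra.
nra.
Qed.

(** Minus the coefficient of E dz in the coordinate s = 1/z. Its continuity at 0 gives E =
    O(|z|^(-2)), which feeds Liouville's theorem and later identifies the value at infinity. *)
Let Kinf s : C := (- K s - csum (fun a : LT => sing_inf a s))%C.

Lemma Kinf_ccont : ccont Kinf (RtoC 0).
Proof.
have h : ccont (fun s => csum (fun a : LT => sing_inf a s)) (RtoC 0).
  rewrite /csum; elim: (index_enum _) => [|a s IH].
    by apply: (@ccont_ext (fun _ => RtoC 0)) => [x|]; [rewrite big_nil | apply: ccont_const].
  apply: (@ccont_ext (fun x => sing_inf a x + \big[Cplus/RtoC 0]_(b <- s) sing_inf b x)%C) => [x|].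
    by rewrite big_cons.
  by apply: ccontD => //; apply: sing_inf_ccont.
apply: (@ccont_ext (fun s => - (1) * K s + - (1) * csum (fun a : LT => sing_inf a s))%C).
  by move=> s; rewrite /Kinf; ring.
by apply: ccontD; apply: ccontM => //; apply: ccont_const.
Qed.

Lemma E_inf : exists2 e, 0 < e & forall s, s <> RtoC 0 -> Cmod s < e -> E (/ s)%C = (s * s * Kinf s)%C.
Proof.
have [e e0 he] := one_sub_neq0.
have h (a : LT) : 0 < / (Cmod (w a) + rad a).
  by apply: Rinv_0_lt_compat; have := Cmod_ge_0 (w a); have := r0 a; lra.
have [e' e'0 he'] := fin_pos_lower h.
exists (Rmin d (Rmin e e')); first by repeat apply: Rmin_glb_lt.
move=> s ns hs.
have h1 := Rlt_le_trans _ _ _ hs (Rmin_l _ _); have h2 := Rlt_le_trans _ _ _ hs (Rmin_r _ _).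
have h3 := Rlt_le_trans _ _ _ h2 (Rmin_l _ _); have h4 := Rlt_le_trans _ _ _ h2 (Rmin_r _ _).
have ps : 0 < Cmod s by apply/Cmod_gt_0.
rewrite E_far.
  rewrite GK // (eq_csum (G := fun a : LT => s * s * sing_inf a s)%C); last first.
    by move=> a; apply: sing_infE => //; apply: he.
  rewrite csumMl /Kinf.
  have aux (k u : C) : (- (s * s) * k - s * s * u = s * s * (- k - u))%C by ring.
  exact: aux.
move=> a; have := Cmod_sub_ge (/ s) (w a); rewrite Cmod_inv // => h5.
have h6 : Cmod s < / (Cmod (w a) + rad a) by apply: Rlt_le_trans h4 (he' a).
have w0 := Cmod_ge_0 (w a); have ra := r0 a.
have : Cmod (w a) + rad a < / Cmod s.
  rewrite -(Rinv_inv (Cmod (w a) + rad a)); apply: Rinv_lt_contravar => //.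
  by apply: Rmult_lt_0_compat => //; apply: Rinv_0_lt_compat; lra.
lra.
Qed.

Lemma E_zero z : E z = RtoC 0.
Proof.
apply: liouville E_cdiff _ z => e e0.
have [e1 e10 h1] := E_inf.
have [d1 d10 h2] := Kinf_ccont (ltac:(lra) : 0 < 1).
pose B := Cmod (Kinf (RtoC 0)) + 1.
have B0 : 0 < B by rewrite /B; have := Cmod_ge_0 (Kinf (RtoC 0)); lra.
pose m := Rmin (Rmin e1 d1) (Rmin 1 (e / B)).
have eB : 0 < e / B by apply: Rdiv_lt_0_compat.
have m0 : 0 < m by repeat apply: Rmin_glb_lt => //; lra.
exists (/ m) => u hu.
have u0 : 0 < Cmod u by apply: Rlt_trans hu; apply: Rinv_0_lt_compat.
have nu0 : u <> RtoC 0 by apply/Cmod_gt_0.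
have ns : (/ u)%C <> RtoC 0 by apply/Cmod_gt_0; rewrite Cmod_inv //; apply: Rinv_0_lt_compat.
have hs : Cmod (/ u) < m.
  rewrite Cmod_inv // -(Rinv_inv m); apply: Rinv_lt_contravar => //.
  by apply: Rmult_lt_0_compat => //; apply: Rinv_0_lt_compat.
have q1 : m <= e1 by apply: Rle_trans (Rmin_l _ _) (Rmin_l _ _).
have q2 : m <= d1 by apply: Rle_trans (Rmin_l _ _) (Rmin_r _ _).
have q3 : m <= 1 by apply: Rle_trans (Rmin_r _ _) (Rmin_l _ _).
have q4 : m <= e / B by apply: Rle_trans (Rmin_r _ _) (Rmin_r _ _).
have -> : u = (/ (/ u))%C by field.
rewrite (h1 _ ns); last lra.
move: hs ns; move: (/ u)%C => s hs ns.
have hk := h2 s ltac:(rewrite (_ : s - 0 = s)%C; [lra | ring]).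
have kB : Cmod (Kinf s) <= B.
  by have := Cmod_sub_ge (Kinf s) (Kinf (RtoC 0)); rewrite /B; lra.
rewrite !Cmod_mult; have s0 := Cmod_ge_0 s.
have : Cmod s * Cmod s <= e / B.
  apply: Rle_trans q4; nra.
move=> h5; have -> : e = e / B * B by field; lra.
by apply: Rmult_le_compat => //; [apply: Rmult_le_pos | apply: Cmod_ge_0].
Qed.

Lemma decomposition z : (forall a, rin a < Cmod (z - w a)) -> G z = csum (fun b : LT => sing b z).
Proof.
move=> hz; case: (pickP (in_disc z)) => [a /in_discP ha|none].
  have ho : Cmod (z - w a) < rout a by have := rout1 a; lra.
  rewrite (@laurent_G a z (conj (hz a) ho)).
  have := E_zero z; rewrite (E_near ho) /other => h.
  have -> : csum (fun b : LT => sing b z) = (reg a z + sing a z - (reg a z - (csum (fun b : LT => sing b z) - sing a z)))%C by ring.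
  by rewrite h; ring.
have far a : rad a < Cmod (z - w a).
  by apply: Rnot_le_lt => h; have := none a; move/in_discP: h => ->.
have := E_zero z; rewrite (E_far far) => h.
have -> : G z = (G z - csum (fun b : LT => sing b z) + csum (fun b : LT => sing b z))%C by ring.
by rewrite h; ring.
Qed.

(** As E vanishes, so does [Kinf] away from 0, and at 0 by continuity. Only the double poles
    contribute at infinity, the poles of higher order vanishing there. *)
Lemma decomposition_inf : K (RtoC 0) = (- csum (fun b : LT => res b 1))%C.
Proof.
have e : Kinf (RtoC 0) = RtoC 0.
  apply: Ceq_small => e e0; have [d1 d10 h1] := Kinf_ccont e0.
  have [e1 e10 h2] := E_inf.
  pose m := Rmin e1 d1 / 2.
  have m0 : 0 < Rmin e1 d1 by apply: Rmin_glb_lt.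
  have q1 := Rmin_l e1 d1; have q2 := Rmin_r e1 d1.
  have hm : Cmod (RtoC m) = m by rewrite Cmod_R Rabs_pos_eq /m; lra.
  have ns : RtoC m <> RtoC 0 by move=> /RtoC_inj; rewrite /m; lra.
  have k0 : Kinf (RtoC m) = RtoC 0.
    have := h2 (RtoC m) ns ltac:(rewrite hm /m; lra); rewrite E_zero => h.
    have -> : Kinf (RtoC m) = (/ RtoC m * / RtoC m * (RtoC m * RtoC m * Kinf (RtoC m)))%C by field.
    by rewrite -h; ring.
  have := h1 (RtoC m) ltac:(rewrite (_ : RtoC m - 0 = RtoC m)%C; [rewrite hm /m; lra | ring]).
  rewrite k0 -Cmod_opp (_ : - (0 - Kinf 0) = Kinf 0 - 0)%C; last by ring.
  by move=> h; apply: Rlt_le.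
have -> : K (RtoC 0) = (- Kinf (RtoC 0) - csum (fun b : LT => sing_inf b (RtoC 0)))%C.
  by rewrite /Kinf; ring.
rewrite e (_ : csum (fun b : LT => sing_inf b (RtoC 0)) = csum (fun b : LT => res b 1)); first by ring.
apply: eq_csum => b; rewrite /sing_inf.
have -> : (1 - 0 * w b = 1)%C by ring.
rewrite Cinv_one Cpow_1_l Cmult_1_l /polar_part (cser_delta (n0 := 0%nat)).
  by rewrite /=; ring.
move=> n hn; rewrite /Cdiv Cmult_0_l; case: n hn => // n _.
by rewrite Cpow_S; ring.
Qed.

End Decomposition.

(** * The linear system for the principal parts *)

(** With k = n + 1 and l = m + 1, the real factor of A is expressed by the binomial coefficient that
    [pole_moment] produces. *)
Lemma Acoef_real n m :
  (-1) ^ n.+1 * INR (n.+1 + m.+1 - 1)`! /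
    (sqrt (INR n.+1 * INR m.+1) * INR (n.+1 - 1)`! * INR (m.+1 - 1)`!) =
  - ((-1) ^ n * INR 'C(m.+1 + n, n) * sqrt (INR m.+1) / sqrt (INR n.+1)).
Proof.
have hn : 0 < INR n.+1 by apply: lt_0_INR; lia.
have hm : 0 < INR m.+1 by apply: lt_0_INR; lia.
have fn := @INR_fact_neq0 n; have fm := @INR_fact_neq0 m.
have sn := sqrt_lt_R0 _ hn; have sm := sqrt_lt_R0 _ hm.
have -> : (n.+1 + m.+1 - 1 = m.+1 + n)%nat by lia.
rewrite -(@bin_fact (m.+1 + n) n); last by lia.
rewrite addnK !subSS !subn0 factS !mult_INR sqrt_mult; try lra.
have e := sqrt_sqrt (INR m.+1) ltac:(lra).
rewrite -{1}e (_ : (-1) ^ n.+1 = -1 * (-1) ^ n) //.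
by field; repeat split=> //; lra.
Qed.

Section System.
Variables (g : nat) (w : letter g -> C) (rho sq : 'I_g -> C).
Hypotheses (hC : schottky_space w rho) (hsq : forall i : 'I_g, (sq i * sq i)%C = rho i).
Variables (lam mu : R) (y : sphere).
Hypothesis lam1 : 1 < lam.
Hypothesis hlam : forall a b : letter g, a <> b ->
  lam * (radius rho a + radius rho b) < Cmod (w a - w b).
Hypothesis hmu : 1 < mu <= lam.
Hypothesis hy : forall a, outer w a (mu * radius rho a) y.

Notation rad := (radius rho).
Notation V z := (fund w rho mu (Some z)).
Notation LT := ('I_g * bool)%type.

Variables (f G K : C -> C) (d : R).
Hypothesis fG : forall z, V z -> Some z <> y -> f z = (omega0 (Some z) y + G z)%C.
Hypothesis dG : forall z, V z -> cdiff G z.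
Hypothesis d0 : 0 < d.
Hypothesis cK : ccont K (RtoC 0).
Hypothesis GK : forall s, s <> RtoC 0 -> Cmod s < d -> G (/ s)%C = (- (s * s) * K s)%C.
Notation rs a n := (res w rho f a n).
Hypothesis res0 : forall a, rs a 0 = RtoC 0.
Hypothesis mr : forall a n, rs a n.+1 =
  (- rho a.1 ^ n.+1 * cmean (fun z => f z * / (z - w (neg a)) ^ n) (w (neg a)) (rad (neg a)))%C.
Hypothesis A_le1 : forall i j, Cmod (Amat w sq i j) <= 1.

Let nu := (1 + mu) / 2.
Let nu1 : 1 < nu < mu. Proof. by rewrite /nu; lra. Qed.
Let r0 (a : letter g) : 0 < rad a. Proof. exact: radius_gt0 hC hsq a. Qed.
Let rin a := rad a / nu.
Let rin0 a : 0 < rin a. Proof. by apply: Rdiv_lt_0_compat => //; lra. Qed.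
Let rin1 a : rin a < rad a. Proof. by apply/Rlt_div_l; [lra | have := r0 a; nra]. Qed.
Let inu : 0 <= / nu < 1.
Proof.
have p : 0 < / nu by apply: Rinv_0_lt_compat; lra.
by split; [lra | rewrite -Rinv_1; apply: Rinv_lt_contravar; lra].
Qed.

Lemma circle_far b c z : Cmod (z - w c) = rad c -> rad b <= Cmod (z - w b).
Proof.
move=> hz; case: (eqVneq (b : LT) c) => [->|/eqP bc]; first lra.
have := hlam bc; have := Cmod_sub_ge (w b - w c) (z - w c).
have -> : (w b - w c - (z - w c) = - (z - w b))%C by ring.
by rewrite Cmod_opp => h1 h2; have := r0 b; have := r0 c; nra.
Qed.

Lemma sing_ser q b z : rin b < Cmod (z - w b) ->
  (q * sing w rho f b z)%C = cser (fun m => q * (rs b m.+1 * / (z - w b) ^ m.+2))%C.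
Proof.
move=> hz; have [th [c [ht hg]]] := sing_geo hC hsq hlam hmu hy fG dG hz.
have nz : (z - w b)%C <> RtoC 0 by apply/Cmod_gt_0; have := rin0 b; lra.
rewrite /sing /polar_part Cmult_assoc -(cserZ _ ht hg); apply: eq_cser => m.
by rewrite -(Cpow_inv _ m.+2) // !Cpow_S; ring.
Qed.

Lemma sing_cd a z : rin a < Cmod (z - w a) -> cdiff (sing w rho f a) z.
Proof. exact: (sing_cdiff hC hsq hlam hmu hy fG dG). Qed.

Lemma center_far b c : Cmod (w c - w b) <> rad c.
Proof.
case: (eqVneq (b : LT) c) => [->|/eqP bc] e.
  by have := r0 c; rewrite -e (_ : w c - w c = 0)%C ?Cmod_0; [lra | ring].
have cb : c <> b by move=> h; apply: bc.
by have := hlam cb; have := r0 b; have := r0 c; nra.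
Qed.

(** The n-th Taylor coefficient at w_c of the principal part at w_b, computed term by term. The
    principal part at w_c itself has only negative powers there, which accounts for the zero blocks
    a = -b of A. *)
Lemma sing_moment b c n :
  cmean (fun z => sing w rho f b z * / (z - w c) ^ n)%C (w c) (rad c) =
  if (b : LT) == c then RtoC 0 else
  cser (fun m => rs b m.+1 * (INR 'C(m.+1 + n, n) * ((- (1)) ^ n / (w c - w b) ^ (m.+2 + n))))%C.
Proof.
pose H m z := (/ (z - w c) ^ n * (rs b m.+1 * / (z - w b) ^ m.+2))%C.
have c1 m : ccirc (fun z => / (z - w b) ^ m.+2 * / (z - w c) ^ n)%C (w c) (rad c).
  by apply: ccircM; [apply: ccirc_inv_pow => //; apply: center_far | apply: ccirc_inv_sub_pow].
have cH m : ccirc (H m) (w c) (rad c).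
  apply: (@ccirc_ext (fun z => rs b m.+1 * (/ (z - w b) ^ m.+2 * / (z - w c) ^ n))%C).
    by move=> z; rewrite /H; ring.
  by apply: ccircM; [apply: ccirc_cst | apply: c1].
have HE t : (sing w rho f b (cpt (w c) (rad c) t) * / (cpt (w c) (rad c) t - w c) ^ n)%C =
    cser (fun m => H m (cpt (w c) (rad c) t)).
  rewrite Cmult_comm sing_ser // -/(rin b); have := rin1 b.
  have hz : Cmod (cpt (w c) (rad c) t - w c) = rad c by rewrite Cmod_cpt //; apply: Rlt_le.
  by have := circle_far b hz; lra.
have cS : ccirc (fun z => cser (fun m => H m z)) (w c) (rad c).
  move=> t; set z := cpt _ _ _.
  have hz : Cmod (z - w c) = rad c by rewrite Cmod_cpt //; apply: Rlt_le.
  have hb : 0 < Cmod (z - w b) - rin b by have := circle_far b hz; have := rin1 b; lra.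
  apply: (@ccont_local (fun z => / (z - w c) ^ n * sing w rho f b z)%C _ _ _ hb).
    move=> x hx; apply: sing_ser.
    have := Cmod_sub_ge (z - w b) (- (x - z)); rewrite Cmod_opp.
    have -> : (z - w b - - (x - z) = x - w b)%C by ring.
    by rewrite -/(rin b); lra.
  apply: ccontM; first exact: ccirc_inv_sub_pow.
  by apply: cdiff_ccont; apply: sing_cd; rewrite -/(rin b); lra.
have [B hB] := res_geo hC hsq hlam hmu hy fG dG b.
have rb := r0 b; have rc := r0 c.
(* On the circle around w_c one has |z - w_b| >= rad b, while the coefficients at w_b decay like
   (rad b / nu)^m; the quotient has ratio 1 / nu. *)
have bound m t : Cmod (H m (cpt (w c) (rad c) t)) <= / rad c ^ n * (B * / rad b ^ 2) * (/ nu) ^ m.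
  have hz : Cmod (cpt (w c) (rad c) t - w c) = rad c by rewrite Cmod_cpt //; apply: Rlt_le.
  have hb := circle_far b hz; move: hz hb; set z := cpt _ _ _ => hz hb.
  have nc : (z - w c)%C <> RtoC 0 by apply/Cmod_gt_0; lra.
  have nb : (z - w b)%C <> RtoC 0 by apply/Cmod_gt_0; lra.
  have : Cmod (rs b m.+1) <= B * rin b ^ m := hB m.
  rewrite /H; move: (rs b m.+1) => q hq.
  rewrite !Cmod_mult !Cmod_inv; try exact: Cpow_nz.
  rewrite !Cmod_pow hz Rmult_assoc; apply: Rmult_le_compat_l.
    by apply: Rlt_le; apply: Rinv_0_lt_compat; apply: pow_lt.
  have -> : B * / rad b ^ 2 * (/ nu) ^ m = B * rin b ^ m * / rad b ^ m.+2.
    rewrite /rin /Rdiv Rpow_mult_distr (_ : rad b ^ m.+2 = rad b ^ 2 * rad b ^ m); last by rewrite /=; ring.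
    by field; repeat split; first [lra | apply: pow_nonzero; lra].
  apply: Rmult_le_compat; [exact: Cmod_ge_0 | | exact: hq | ].
    by apply: Rlt_le; apply: Rinv_0_lt_compat; apply: pow_lt; lra.
  apply: Rinv_le_contravar; first by apply: pow_lt.
  by apply: pow_incr; lra.
rewrite (@eq_cmean _ (fun z => cser (fun m => H m z)) _ _ HE) (cmean_cser inu cH cS bound).
have mE m : cmean (H m) (w c) (rad c) =
    (rs b m.+1 * cmean (fun z => / (z - w b) ^ m.+2 * / (z - w c) ^ n) (w c) (rad c))%C.
  by rewrite -(cmeanZ _ (c1 m)); apply: eq_cmean => t; rewrite /H; ring.
case: eqVneq => [bc|/eqP bc].
  have m0 m : cmean (H m) (w c) (rad c) = RtoC 0.
    rewrite mE -[RHS](Cmult_0_r (rs b m.+1)) -(cmean_inv_pow (w c) (m.+1 + n) rc).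
    congr Cmult; apply: eq_cmean => t; rewrite bc.
    have := @cpt_neq0 (w c) _ t rc; move: (_ - w c)%C => u nu0.
    by rewrite (_ : (m.+1 + n).+1 = m.+2 + n)%nat // Cpow_add_r; field; split; apply: Cpow_nz.
  by rewrite (cser_delta (n0 := 0%nat)) ?m0.
apply: eq_cser => m; rewrite mE; congr Cmult.
rewrite pole_moment //; split=> //.
have cb : c <> b by move=> h; apply: bc.
by have := hlam cb; nra.
Qed.

(** The Taylor coefficients of (z - y)^(-2) at w_c are (n+1) (y - w_c)^(-n-2), which is L_c(n+1, y)
    up to normalization. For y at infinity omega0 is constant and only n = 0 survives, in accordance
    with [Lform]. *)
Lemma omega0_moment c n :
  (sq c.1 ^ n.+1 * cmean (fun z => omega0 (Some z) y * / (z - w c) ^ n) (w c) (rad c))%C =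
  (RtoC (sqrt (INR n.+1)) * Lform w sq c n.+1 y)%C.
Proof.
have rc := r0 c.
have hn : 0 < INR n.+1 by apply: lt_0_INR; lia.
move: hy; case: y => [y0|] hy'.
  have h := hy' c; rewrite /= in h.
  have h1 : Cmod (w c - y0) = Cmod (y0 - w c) by rewrite -Cmod_opp; congr Cmod; ring.
  rewrite (@pole_moment _ _ _ n 1); last by split=> //; rewrite h1; nra.
  rewrite add1n binSn /Lform.
  have nz : (y0 - w c)%C <> RtoC 0 by apply/Cmod_gt_0; nra.
  have -> : (w c - y0 = - (1) * (y0 - w c))%C by ring.
  have -> : RtoC (INR n.+1) = (RtoC (sqrt (INR n.+1)) * RtoC (sqrt (INR n.+1)))%C.
    by rewrite -RtoC_mult sqrt_sqrt //; lra.
  rewrite (_ : (2 + n)%nat = n.+2) // Cpow_mult_l (_ : (- (1)) ^ n.+2 = (- (1)) ^ n)%C; last first.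
    by rewrite !Cpow_S; ring.
  have n1 : ((- (1)) ^ n)%C <> RtoC 0.
    by apply: Cpow_nz => /(f_equal Cmod); rewrite Cmod_opp Cmod_1 Cmod_0; lra.
  have n2 := Cpow_nz _ n.+2 nz.
  by field; split.
rewrite /omega0 /Lform; case: n hn => [|n] hn.
  rewrite (eq_cmean (h := fun _ => - (1))%C) ?cmean_const; last by move=> t; rewrite /=; field; lra.
  by rewrite /= sqrt_1; ring.
have cc : ccirc (fun z => / (z - w c) ^ n.+1)%C (w c) (rad c) by apply: ccirc_inv_sub_pow.
by rewrite (cmeanZ _ cc) cmean_inv_pow // /=; ring.
Qed.

Lemma f_moment c n :
  cmean (fun z => f z * / (z - w c) ^ n)%C (w c) (rad c) =
  (cmean (fun z => omega0 (Some z) y * / (z - w c) ^ n) (w c) (rad c) +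
   csum (fun b : LT => if b == c then RtoC 0 else
     cser (fun m => rs b m.+1 * (INR 'C(m.+1 + n, n) * ((- (1)) ^ n / (w c - w b) ^ (m.+2 + n))))))%C.
Proof.
have rc := r0 c.
have ci : ccirc (fun z => / (z - w c) ^ n)%C (w c) (rad c) by apply: ccirc_inv_sub_pow.
have hcirc t : Cmod (cpt (w c) (rad c) t - w c) = rad c by rewrite Cmod_cpt //; apply: Rlt_le.
have ne t := @circle_neq_y _ _ _ _ hC hsq _ _ _ hmu hy c _ (hcirc t).
have co : ccirc (fun z => omega0 (Some z) y * / (z - w c) ^ n)%C (w c) (rad c).
  by apply: ccircM => // t; apply: cdiff_ccont; apply: omega0_cdiff; apply: ne.
have cs b : ccirc (fun z => sing w rho f b z * / (z - w c) ^ n)%C (w c) (rad c).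
  apply: ccircM => // t; apply: cdiff_ccont; apply: sing_cd.
  by have := circle_far b (hcirc t); have := rin1 b; lra.
have [cS eS] := cmean_csum (T := LT) cs.
rewrite (eq_csum (G := fun b => cmean (fun z => sing w rho f b z * / (z - w c) ^ n)%C (w c) (rad c))).
  rewrite -eS -(cmeanD co cS); apply: eq_cmean => t.
  have hV := circle_fund hC hsq lam1 hlam hmu (hcirc t).
  rewrite (fG hV (@ne t)).
  rewrite (decomposition hC hsq hlam hmu hy fG dG d0 cK GK res0); last first.
    by move=> a; apply: Rlt_le_trans (rin1 a) (circle_far a (hcirc t)).
  by rewrite csumMr Cmult_plus_distr_r.
by move=> b; rewrite sing_moment.
Qed.

(** Dividing by the normalization of L_a(k, z), with k = n + 1, makes the term of index (a, n) in L
    X equal to the part of f of order (z - w_a)^(-k-1). *)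
Definition moment_vec : vec g := fun i =>
  (rs i.1 i.2.+1 / (RtoC (sqrt (INR i.2.+1)) * sq i.1.1 ^ i.2.+1))%C.

Lemma sqrt_INR_ge1 n : 1 <= sqrt (INR n.+1).
Proof.
rewrite -{1}sqrt_1; apply: sqrt_le_1_alt; rewrite (_ : 1 = INR 1) //.
by apply: le_INR; lia.
Qed.

Lemma moment_vec_decays : decays (/ nu) moment_vec.
Proof.
pose B a := proj1_sig (constructive_indefinite_description _ (res_geo hC hsq hlam hmu hy fG dG a)).
have hB a : geo (rin a) (B a) (fun n => rs a n.+1).
  exact: (proj2_sig (constructive_indefinite_description _ (res_geo hC hsq hlam hmu hy fG dG a))).
have B0 a : 0 <= B a := geo_ge0 (hB a).
have Br a : 0 <= B a / rad a by apply: Rdiv_le_0_compat.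
exists (rsum (fun a : LT => B a / rad a)) => -[a n].
have ra := r0 a; have q0 : 0 <= (/ nu) ^ n by apply: pow_le; lra.
apply: Rle_trans (Rmult_le_compat_r _ _ _ q0 (@rsum_ge _ (fun a : LT => B a / rad a) a Br)).
have s1 := sqrt_INR_ge1 n; have sz := @sq_neq0 _ _ _ _ hC hsq a.1.
have nz : (RtoC (sqrt (INR n.+1)) * sq a.1 ^ n.+1)%C <> RtoC 0.
  apply: Cmult_neq_0; last exact: Cpow_nz.
  by move=> /RtoC_inj; lra.
have : Cmod (rs a n.+1) <= B a * rin a ^ n := hB a n.
rewrite /moment_vec [(a, n).1]/= [(a, n).2]/=; move: (rs a n.+1) => q hq.
rewrite Cmod_div // Cmod_mult Cmod_R Rabs_pos_eq; last lra.
rewrite Cmod_pow -(radiusE hsq).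
have -> : B a / rad a * (/ nu) ^ n = B a * rin a ^ n / rad a ^ n.+1.
  rewrite /rin /Rdiv Rpow_mult_distr (_ : rad a ^ n.+1 = rad a * rad a ^ n) //.
  by field; split; [apply: pow_nonzero; lra | lra].
have p := pow_lt _ n.+1 ra.
apply: Rmult_le_compat; [exact: Cmod_ge_0 | | exact: hq |].
  by apply: Rlt_le; apply: Rinv_0_lt_compat; nra.
by apply: Rinv_le_contravar => //; nra.
Qed.

Lemma moment_system i :
  moment_vec i = (- Rcol w sq y i + isum (fun k => Amat w sq i k * moment_vec k))%C.
Proof.
case: i => a n; have [c hc] := moment_vec_decays.
have hu (b : LT) : geo (/ nu) c (fun m => Amat w sq (a, n) (b, m) * moment_vec (b, m))%C.
  move=> m; apply: Rle_trans (hc (b, m)); rewrite Cmod_mult.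
  by have := A_le1 (a, n) (b, m); have := Cmod_ge_0 (moment_vec (b, m)); nra.
rewrite /isum (cser_csum inu hu).
have hn : 0 < INR n.+1 by apply: lt_0_INR; lia.
have sn : RtoC (sqrt (INR n.+1)) <> RtoC 0.
  by move=> /RtoC_inj; have := sqrt_INR_ge1 n; lra.
have sa := Cpow_nz _ n.+1 (@sq_neq0 _ _ _ _ hC hsq a.1).
set S := csum _.
(* The factor - rho^(n+1) of [moment_relation] divided by the normalization of [moment_vec], with
   rho = sq^2; it is common to all contributions to the row (a, n). *)
pose k := (- (sq a.1 ^ n.+1 / RtoC (sqrt (INR n.+1))))%C.
have k0 : k <> RtoC 0.
  move=> e; apply: sa.
  have -> : (sq a.1 ^ n.+1 = - k * RtoC (sqrt (INR n.+1)))%C by rewrite /k; field.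
  by rewrite e; ring.
have SE : S = (k * csum (fun b : LT => if b == neg a then RtoC 0 else
     cser (fun m => rs b m.+1 * (INR 'C(m.+1 + n, n) * ((- (1)) ^ n / (w (neg a) - w b) ^ (m.+2 + n))))))%C.
  rewrite /S -csumMl; apply: eq_csum => b.
  case: eqVneq => [ba|/eqP ba].
    rewrite (cser_delta (n0 := 0%nat)) => [|m _]; last first.
      by rewrite /Amat /Acoef ba /= negK eqxx Cmult_0_l.
    by rewrite /Amat /Acoef ba /= negK eqxx Cmult_0_l Cmult_0_r.
  have nab : neg a <> b by move=> e; apply: ba.
  rewrite [in RHS](eq_cser (f' := fun m => / k * (Amat w sq (a, n) (b, m) * moment_vec (b, m)))%C).
    have aux (x : C) : x = (k * (/ k * x))%C by field.
    by rewrite (cserZ _ inu (hu b)); apply: aux.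
  move=> m; rewrite /Amat /Acoef /moment_vec [(a, n).1]/= [(a, n).2]/= [(b, m).1]/= [(b, m).2]/=.
  case: eqP => [e|_]; first by case: ba; rewrite e negK.
  rewrite Acoef_real /k.
  have sm : RtoC (sqrt (INR m.+1)) <> RtoC 0.
    by move=> /RtoC_inj; have := sqrt_INR_ge1 m; lra.
  have sb := Cpow_nz _ m.+1 (@sq_neq0 _ _ _ _ hC hsq b.1).
  have wn : (w (neg a) - w b)%C <> RtoC 0.
    by apply/Cmod_gt_0; have := hlam nab; have := r0 (neg a); have := r0 b; nra.
  have -> : (n.+1 + m.+1 = m.+2 + n)%nat by lia.
  have wp := Cpow_nz _ (m.+2 + n) wn.
  have rn : sqrt (INR n.+1) <> 0 by have := sqrt_INR_ge1 n; lra.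
  rewrite RtoC_opp (RtoC_div _ _ rn) !RtoC_mult RtoC_pow.
  have -> : (- (1))%C = RtoC (-1) by rewrite -RtoC_opp.
  move: (rs b m.+1) (RtoC (-1) ^ n)%C (RtoC (INR 'C(_, _))) => q e v.
  by field; repeat split.
rewrite SE {1}/moment_vec [(a, n).1]/= [(a, n).2]/= mr f_moment.
have om := omega0_moment (neg a) n.
have -> : Rcol w sq y (a, n) = (/ RtoC (sqrt (INR n.+1)) * (RtoC (sqrt (INR n.+1)) * Lform w sq (neg a) n.+1 y))%C.
  by rewrite /Rcol [(a, n).1]/= [(a, n).2]/=; field.
rewrite -om /k -hsq Cpow_mult_l; set u := cmean _ _ _; set v := csum _.
have aux (s q x z : C) : s <> RtoC 0 -> q <> RtoC 0 ->
  (- (q * q) * (x + z) / (s * q) = - (/ s * (q * x)) + - (q / s) * z)%C by move=> *; field.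
exact: aux.
Qed.

Lemma row_moment theta z : 0 <= theta < 1 -> decays theta (Lrow w sq (Some z)) ->
  (forall a, rad a < Cmod (z - w a)) ->
  isum (fun i => Lrow w sq (Some z) i * moment_vec i)%C = csum (fun b : LT => sing w rho f b z).
Proof.
move=> ht [cL hL] hz; have [c hc] := moment_vec_decays.
have hu (b : LT) : geo (/ nu) (cL * c) (fun m => Lrow w sq (Some z) (b, m) * moment_vec (b, m))%C.
  move=> m; rewrite Cmod_mult Rmult_assoc.
  apply: Rmult_le_compat; [exact: Cmod_ge_0 | exact: Cmod_ge_0 | | exact: (hc (b, m))].
  apply: Rle_trans (hL (b, m)) _; have c0 := hL (b, 0%nat); rewrite /= Rmult_1_r in c0.
  rewrite -[X in _ <= X]Rmult_1_r; apply: Rmult_le_compat_l.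
    by apply: Rle_trans c0; apply: Cmod_ge_0.
  by rewrite -(pow1 m); apply: pow_incr; rewrite /=; lra.
rewrite /isum (cser_csum inu hu); apply: eq_csum => b.
rewrite -[RHS]Cmult_1_l sing_ser; last by apply: Rlt_trans (rin1 b) (hz b).
apply: eq_cser => m; rewrite /Lrow /Lform /moment_vec [(b, m).1]/= [(b, m).2]/=.
have sm : RtoC (sqrt (INR m.+1)) <> RtoC 0.
  by move=> /RtoC_inj; have := sqrt_INR_ge1 m; lra.
have sb := Cpow_nz _ m.+1 (@sq_neq0 _ _ _ _ hC hsq b.1).
have nz : (z - w b)%C <> RtoC 0 by apply/Cmod_gt_0; have := hz b; have := r0 b; lra.
have np := Cpow_nz _ m.+2 nz.
by move: (rs b m.+1) => q; field; repeat split.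
Qed.

Lemma row_moment_inf :
  isum (fun i => Lrow w sq None i * moment_vec i)%C = (- csum (fun b : LT => rs b 1))%C.
Proof.
rewrite /isum (cser_delta (n0 := 0%nat)) => [|m hm]; last first.
  rewrite (eq_csum (G := fun=> RtoC 0)) ?csum0 // => b.
  by case: m hm => // m _; rewrite /Lrow /Lform /= Cmult_0_l.
rewrite -csumN; apply: eq_csum => b; rewrite /Lrow /Lform /moment_vec [(b, _).1]/= [(b, _).2]/= eqxx.
have sb := @sq_neq0 _ _ _ _ hC hsq b.1.
rewrite (_ : INR 1 = 1) // sqrt_1 Cpow_1_r.
by move: (rs b 1) => q; field.
Qed.

End System.

(** * Decay of L and R, and the formula *)

Lemma sqrt_geometric q : 0 < q < 1 ->
  exists theta c, [/\ q <= theta < 1, 0 <= c & forall n, sqrt (INR n.+1) * q ^ n <= c * theta ^ n].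
Proof.
(* The factor sqrt k of L_a(k, x) is absorbed by Bernoulli's inequality (1 + x)^n >= 1 + n x, at the
   price of a ratio theta strictly between q and 1. *)
move=> hq; pose theta := (1 + q) / 2; pose x := theta / q - 1.
have t1 : q < theta < 1 by rewrite /theta; lra.
have x0 : 0 < x by rewrite /x; suff : 1 < theta / q by [lra]; apply/Rlt_div_r; lra.
have xi : 0 < / x by apply: Rinv_0_lt_compat.
exists theta, (1 + / x); split; [lra | lra |] => n.
have hn : 1 <= INR n.+1 by rewrite (_ : 1 = INR 1) //; apply: le_INR; lia.
have h1 : sqrt (INR n.+1) <= INR n.+1.
  rewrite -[X in _ <= X]sqrt_Rsqr; last lra.
  by apply: sqrt_le_1_alt; rewrite /Rsqr; nra.
have h2 := @poly n x x0.
have -> : theta ^ n = (1 + x) ^ n * q ^ n.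
  by rewrite -Rpow_mult_distr; congr pow; rewrite /x; field; lra.
rewrite -Rmult_assoc; apply: Rmult_le_compat_r; first by apply: pow_le; lra.
apply: Rle_trans h1 _; rewrite S_INR.
have -> : INR n + 1 = 1 * 1 + / x * (INR n * x) by field; lra.
have := pos_INR n => n0; have nx : 0 <= INR n * x by nra.
apply: Rle_trans (_ : (1 + / x) * (1 + INR n * x) <= _); first nra.
by apply: Rmult_le_compat_l => //; lra.
Qed.

Section Decay.
Variables (g : nat) (w : letter g -> C) (rho sq : 'I_g -> C).
Hypotheses (hC : schottky_space w rho) (hsq : forall i : 'I_g, (sq i * sq i)%C = rho i).
Notation rad := (radius rho).

(** One statement for both vectors: h is the identity for the row L and the negation for the column
    R. *)
Lemma Lform_decays mu (h : letter g -> letter g) p : 1 < mu ->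
  (forall a, outer w a (mu * rad a) p) ->
  exists theta, 0 <= theta < 1 /\ decays theta (fun i : index g => Lform w sq (h i.1) i.2.+1 p).
Proof.
move=> m1; have r0 a := radius_gt0 hC hsq a.
case: p => [z|] hp.
  have im : 0 < / mu < 1.
    by split; [apply: Rinv_0_lt_compat; lra | rewrite -Rinv_1; apply: Rinv_lt_contravar; lra].
  have [theta [c [ht c0 hc]]] := sqrt_geometric im.
  pose B (a : 'I_g * bool) := / rad (h a).
  have B0 a : 0 <= B a by apply: Rlt_le; apply: Rinv_0_lt_compat.
  exists theta; split; first lra.
  exists (rsum B * c) => -[a n]; rewrite [(a, n).1]/= [(a, n).2]/=.
  rewrite Rmult_assoc; apply: Rle_trans (Rmult_le_compat_r _ _ _ _ (@rsum_ge _ B a B0)); last first.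
    by apply: Rmult_le_pos => //; apply: pow_le; lra.
  apply: Rle_trans (Rmult_le_compat_l _ _ _ (B0 a) (hc n)).
  rewrite /B /Lform; have := r0 (h a); have := hp (h a); rewrite [outer _ _ _ _]/=.
  move: (h a) => b hb rb.
  have hD : 0 < Cmod (z - w b) by nra.
  have nz : (z - w b)%C <> RtoC 0 by apply/Cmod_gt_0.
  have s0 := sqrt_pos (INR n.+1).
  rewrite Cmod_div; last exact: (Cpow_nz _ n.+2).
  rewrite Cmod_mult Cmod_R Rabs_pos_eq // !Cmod_pow -(radiusE hsq).
  move: (Cmod _) hb hD => D hb hD.
  have e : sqrt (INR n.+1) * rad b ^ n.+1 / D ^ n.+2 =
      / D * (sqrt (INR n.+1) * ((rad b / D) ^ n * (rad b / D))).
    rewrite /Rdiv Rpow_mult_distr pow_inv (_ : D ^ n.+2 = D * D * D ^ n); last by rewrite /=; ring.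
    rewrite (_ : rad b ^ n.+1 = rad b * rad b ^ n) //; field.
    by repeat split; first [lra | apply: pow_nonzero; lra].
  have q1 : rad b / D <= / mu.
    apply/Rle_div_l => //; apply: (Rmult_le_reg_l mu); first lra.
    by rewrite -Rmult_assoc Rinv_r; lra.
  have q0 : 0 <= rad b / D by apply: Rdiv_le_0_compat; lra.
  rewrite e; apply: Rmult_le_compat.
  - by apply: Rlt_le; apply: Rinv_0_lt_compat.
  - by apply: Rmult_le_pos => //; apply: Rmult_le_pos => //; apply: pow_le.
  - by apply: Rinv_le_contravar => //; nra.
  apply: Rmult_le_compat_l => //; rewrite -[X in _ <= X]Rmult_1_r.
  by apply: Rmult_le_compat => //; [apply: pow_le | apply: pow_incr | lra].
(* At infinity only the entries with k = 1 are nonzero, so any ratio in (0, 1) serves. *)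
exists (/ 2); split; first lra.
exists (rsum (fun a : 'I_g * bool => Cmod (sq (h a).1))) => -[a n]; rewrite [(a, n).1]/= [(a, n).2]/=.
have S0 : forall a : 'I_g * bool, 0 <= Cmod (sq (h a).1) by move=> b; apply: Cmod_ge_0.
have s0 := @rsum_ge _ _ a S0; have := S0 a.
case: n => [|n] /=; first by rewrite Cmod_opp Rmult_1_r.
rewrite Cmod_0 => h0; apply: Rmult_le_pos; first lra.
by apply: Rmult_le_pos; [lra | apply: pow_le; lra].
Qed.

End Decay.

Lemma decays_mono g theta theta' (u : vec g) : 0 <= theta <= theta' -> decays theta u -> decays theta' u.
Proof. by move=> ht [c hc]; exists c; apply: geov_mono hc. Qed.

Theorem proposition3p2 (g : nat) (w : letter g -> C) (rho sq : 'I_g -> C)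
    (hg : is_true (1 <= g)%nat) (hC : schottky_space w rho)
    (hsq : forall i : 'I_g, (sq i * sq i)%C = rho i) :
  exists M : mat g,
    is_neumann_sum (Amat w sq) M /\
    is_inverse (subm (@idm g) (Amat w sq)) M /\
    forall x y : sphere,
      fundamental_region w rho x -> fundamental_region w rho y ->
      exists (v : vec g) (s : C),
        is_mulmv M (Rcol w sq y) v /\
        is_sum (fun i => (Lrow w sq x i * v i)%C) s /\
        forall omega : bidiff, normalized_bidiff w rho omega ->
          x <> y -> omega x y = (omega0 x y - s)%C.
Proof.
have [theta [B [ht Bc AE]]] := Amat_scaled hC hsq.
have A_le1 i j : Cmod (Amat w sq i j) <= 1.
  apply: Rle_trans (A_bound_r ht Bc AE i j) _; rewrite Rmult_1_l -(pow1 j.2).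
  by apply: pow_incr; lra.
exists (minv theta B); split; first exact: (neumann_sum ht Bc AE).
split; first exact: (minv_inverse ht Bc AE).
move=> x y hx hy.
have [lam lam1 hlam] := separation hC hsq.
have [mx hmx ox] := exists_mu hC hsq lam1 hx.
have [mu hmu oy] := exists_mu hC hsq lam1 hy.
have [tx [htx Lx]] := Lform_decays hC hsq (fun a => a) (proj1 hmx) ox.
have [ty [hty Ry]] := Lform_decays hC hsq (@neg g) (proj1 hmu) oy.
pose nu := (1 + mu) / 2.
have inu : 0 < / nu < 1.
  split; first by apply: Rinv_0_lt_compat; rewrite /nu; lra.
  by rewrite -Rinv_1; apply: Rinv_lt_contravar; rewrite /nu; lra.
have shrink a m : 1 < m -> radius rho a / m < radius rho a.
  by move=> m1; apply/Rlt_div_l; [lra | have := radius_gt0 hC hsq a; nra].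
(* A common ratio for the matrix, for R(y) and for the moment vector, as [minv_solve] requires. *)
pose T := Rmax theta (Rmax ty (/ nu)).
have T1 : theta <= T by apply: Rmax_l.
have T2 : Rmax ty (/ nu) <= T by apply: Rmax_r.
have T3 := Rmax_l ty (/ nu); have T4 := Rmax_r ty (/ nu).
have hT : theta <= T < 1 by split=> //; repeat apply: Rmax_lub_lt; lra.
have RT : decays T (Rcol w sq y) by apply: decays_mono Ry; lra.
pose v i := isum (fun k => minv theta B i k * Rcol w sq y k)%C.
have [c hv] := minv_mul_bound ht Bc hT RT; rewrite -/v in hv.
have [cL hL] := Lx.
have T0 : 0 <= T < 1 by lra.
have hLv : decays T (fun i => Lrow w sq x i * v i)%C.
  exists (cL * c) => i; rewrite Cmod_mult Rmult_assoc.
  apply: Rmult_le_compat; [exact: Cmod_ge_0 | exact: Cmod_ge_0 | | exact: hv].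
  apply: Rle_trans (hL i) _; have c0 := hL (i.1, 0%nat); rewrite /= Rmult_1_r in c0.
  rewrite -[X in _ <= X]Rmult_1_r; apply: Rmult_le_compat_l.
    by apply: Rle_trans c0; apply: Cmod_ge_0.
  by rewrite -(pow1 i.2); apply: pow_incr; lra.
exists v, (isum (fun i => Lrow w sq x i * v i)%C).
split; first exact: (minv_mulmv ht Bc hT RT).
split; first exact: decays_is_sum hLv.
move=> F hF xy.
have [G [fG dG [K [d [d0 cK GK KE]]]]] := regular_part hC hsq lam1 hlam hmu oy hF.
pose f z := F (Some z) y.
have res0 a : res w rho f a 0 = RtoC 0 by apply: (residue hC hsq lam1 hlam hmu oy hF).
have mr := moment_relation hC hsq lam1 hlam hmu oy hF.
have sys := moment_system hC hsq lam1 hlam hmu oy fG dG d0 cK GK res0 mr A_le1.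
have Xd : decays T (moment_vec w rho sq f).
  by apply: decays_mono (moment_vec_decays hC hsq hlam hmu oy fG dG); rewrite -/nu; lra.
have vE i : v i = (- moment_vec w rho sq f i)%C := minv_solve ht Bc AE hT Xd RT sys i.
have -> : isum (fun i => Lrow w sq x i * v i)%C = (- isum (fun i => Lrow w sq x i * moment_vec w rho sq f i))%C.
  have hLX : decays T (fun i => Lrow w sq x i * moment_vec w rho sq f i)%C.
    case: hLv => c' hc'; exists c' => i; have := hc' i.
    by rewrite vE; move: (moment_vec _ _ _ _ _) => q; rewrite !Cmod_mult Cmod_opp.
  rewrite (eq_isum (v := fun i => - (1) * (Lrow w sq x i * moment_vec w rho sq f i))%C).
    by rewrite (decays_isumZ _ T0 hLX); ring.
  by move=> i; rewrite vE; ring.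
(* In both cases the regular part of omega at x equals L(x) X. At infinity it is the coefficient
   K(0) in the coordinate 1/z. *)
case: x hx xy ox Lx {hL hLv} => [z|] hx xy ox Lx.
  rewrite (row_moment hC hsq hlam hmu oy fG dG htx Lx hx).
  rewrite fG //; last first.
    by move=> a /=; apply: Rlt_trans (hx a); apply: shrink; lra.
  rewrite (decomposition hC hsq hlam hmu oy fG dG d0 cK GK res0); first by ring.
  by move=> a; apply: Rlt_trans (hx a); apply: shrink; rewrite -/nu /nu; lra.
rewrite KE; last by move=> e; apply: xy.
rewrite (decomposition_inf hC hsq hlam hmu oy fG dG d0 cK GK res0) (row_moment_inf hC hsq f).
have aux (p q : C) : (p + - q = p - - - q)%C by ring.
exact: aux.
Qed.
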